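(* If $w$ is convex, then $$\sup_{\tau\in\mathcal{T}}J(\tau)=\sup_{0<a\leq s\leq b}\Big[\Big(1-w\Big(\frac{s-a}{b-a}\Big)\Big)u(a)+w\Big(\frac{s-a}{b-a}\Big)u(b)\Big].$$ Moreover, if $(a^*,b^* )$ attains the maximum $$(a^*,b^* )=\operatorname*{argmax}_{0<a\leq s\leq b}\Big[\Big(1-w\Big(\frac{s-a}{b-a}\Big)\Big)u(a)+w\Big(\frac{s-a}{b-a}\Big)u(b)\Big],$$ then $$\tau_{(a^*,b^* )}:=\begin{cases}\inf\{t\geq0: S_t\notin(a^*,b^* )\},& a^*<b^*,\\ 0,& a^*=b^*\end{cases}$$ is an optimal stopping time, i.e. $\tau_{(a^*,b^* )}\in\mathcal{T}$ maximizes $J$ over $\mathcal{T}$. (When $a=b=s$ the bracketed expression is understood to be $u(s)$.)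
   Context: Let $\{B_t\}_{t\ge0}$ be a standard one-dimensional Brownian motion on a filtered probability space $(\Omega,\mathcal{F},\{\mathcal{F}_t\}_{t\geq0},\mathbf{P})$, let $\sigma>0$ and $\beta\neq0$ be real constants, and let $\{S_t\}_{t\ge0}$ solve $\mathrm{d}S_t=\beta\sigma S_t\,\mathrm{d}B_t$, $S_0=s>0$. $\mathcal{T}$ is the set of all $\{\mathcal{F}_t\}$-stopping times $\tau$ with $\mathbf{P}(\tau<+\infty)=1$. For $\tau\in\mathcal{T}$, $J(\tau):=\int_0^\infty w(\mathbf{P}(u(S_\tau)>x))\,\mathrm{d}x\in[0,\infty]$. Standing assumption: $u:[0,\infty)\to[0,\infty)$ is nondecreasing and absolutely continuous (on every compact interval) with $u(0)=0$; $w:[0,1]\to[0,1]$ is strictly increasing and absolutely continuous with $w(0)=0$, $w(1)=1$. *)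

(* Defs.v *)
From HB Require Import structures.
From mathcomp Require Import all_boot all_order all_algebra.
From mathcomp Require Import all_classical all_reals all_analysis.

Set Implicit Arguments.
Unset Strict Implicit.
Unset Printing Implicit Defensive.

Import Order.TTheory GRing.Theory Num.Theory.
Import numFieldNormedType.Exports.

Local Open Scope classical_set_scope.
Local Open Scope ring_scope.

(* Time is [0, +oo[, embedded in R: a process is a function R -> Omega -> R,
   a filtration a function R -> set (set Omega), and nothing is required or
   used at negative times. *)

Definition filtration (R : realType) (d : measure_display)
    (Omega : measurableType d) (F : R -> set (set Omega)) : Prop :=
  [/\ forall t : R, 0 <= t -> sigma_algebra setT (F t),
      forall t : R, 0 <= t -> F t `<=` @measurable d Omega &
      forall r t : R, 0 <= r -> r <= t -> F r `<=` F t].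

Definition measurable_wrt (R : realType) (Omega : Type)
    (G : set (set Omega)) (X : Omega -> R) : Prop :=
  forall A : set R, measurable A -> G (X @^-1` A).

Definition adapted (R : realType) (Omega : Type)
    (F : R -> set (set Omega)) (X : R -> Omega -> R) : Prop :=
  forall t : R, 0 <= t -> measurable_wrt (F t) (X t).

Definition continuous_paths (R : realType) (Omega : Type)
    (X : R -> Omega -> R) : Prop :=
  forall w, {within `[0, +oo[%classic, continuous (fun t => X t w)}.

Definition brownian_motion (R : realType) (d : measure_display)
    (Omega : measurableType d) (P : probability Omega R)
    (F : R -> set (set Omega)) (B : R -> Omega -> R) : Prop :=
  [/\ adapted F B /\ continuous_paths B,
      P [set w | B 0 w = 0] = 1%E,
      forall r t : R, 0 <= r -> r < t -> forall A : set R, measurable A ->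
        P [set w | A (B t w - B r w)] = normal_prob 0 (Num.sqrt (t - r)) A &
      forall r t : R, 0 <= r -> r < t -> forall (E : set Omega) (A : set R),
        F r E -> measurable A ->
        P (E `&` [set w | A (B t w - B r w)])
          = (P E * P [set w | A (B t w - B r w)%R])%E].

(* sum_(i < n) xi_i 1_{]t_i, t_{i+1}]}, each xi_i bounded and
   F_{t_i}-measurable *)
Record simple_process (R : realType) (Omega : Type)
    (F : R -> set (set Omega)) := SimpleProcess {
  sp_size : nat ;
  sp_time : nat -> R ;
  sp_coef : nat -> Omega -> R ;
  sp_time_ge0 : 0 <= sp_time 0%N ;
  sp_time_le : forall i, (i < sp_size)%N -> sp_time i <= sp_time i.+1 ;
  sp_coef_bounded : forall i, (i < sp_size)%N ->
    exists M : R, forall w, `|sp_coef i w| <= M ;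
  sp_coef_measurable : forall i, (i < sp_size)%N ->
    measurable_wrt (F (sp_time i)) (sp_coef i) }.

Definition sp_value (R : realType) (Omega : Type) (F : R -> set (set Omega))
    (phi : simple_process F) (r : R) (w : Omega) : R :=
  \sum_(i < sp_size phi | sp_time phi i < r <= sp_time phi i.+1)
    sp_coef phi i w.

Definition simple_integral (R : realType) (Omega : Type)
    (F : R -> set (set Omega)) (B : R -> Omega -> R)
    (phi : simple_process F) (t : R) (w : Omega) : R :=
  \sum_(i < sp_size phi) sp_coef phi i w *
    (B (Num.min t (sp_time phi i.+1)) w - B (Num.min t (sp_time phi i)) w).

Definition tends_to0_in_probability (R : realType) (d : measure_display)
    (Omega : measurableType d) (P : probability Omega R)
    (Y : nat -> Omega -> \bar R) : Prop :=
  forall e : R, 0 < e ->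
    (fun n => P [set w | (e%:E <= Y n w)%E]) @ \oo --> 0%E.

Definition approximates (R : realType) (d : measure_display)
    (Omega : measurableType d) (P : probability Omega R)
    (F : R -> set (set Omega)) (H : R -> Omega -> R) (t : R)
    (phi : nat -> simple_process F) : Prop :=
  tends_to0_in_probability P (fun n w =>
    \int[@lebesgue_measure R]_(r in `[0%R, t])
      ((sp_value (phi n) r w - H r w) ^+ 2)%R%:E)%E.

(* X is (a version of) the Ito integral of H dB over [0, t]: the limit in
   probability of the integrals of simple processes approximating H in
   L^2([0, t]) in probability, for whichever such approximation. *)
Definition is_ito_integral (R : realType) (d : measure_display)
    (Omega : measurableType d) (P : probability Omega R)
    (F : R -> set (set Omega)) (B H : R -> Omega -> R) (t : R)
    (X : Omega -> R) : Prop :=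
  (exists phi : nat -> simple_process F, approximates P H t phi) /\
  (forall phi : nat -> simple_process F, approximates P H t phi ->
    tends_to0_in_probability P
      (fun n w => `|simple_integral B (phi n) t w - X w|%:E)).

(* S solves dS_t = g(S_t) dB_t, S_0 = s0 *)
Definition solves_sde (R : realType) (d : measure_display)
    (Omega : measurableType d) (P : probability Omega R)
    (F : R -> set (set Omega)) (B : R -> Omega -> R) (g : R -> R) (s0 : R)
    (S : R -> Omega -> R) : Prop :=
  [/\ adapted F S, continuous_paths S, P [set w | S 0 w = s0] = 1%E &
      forall t : R, 0 <= t ->
        is_ito_integral P F B (fun r w => g (S r w)) t (fun w => S t w - s0)].

Definition stopping_time (R : realType) (Omega : Type)
    (F : R -> set (set Omega)) (tau : Omega -> \bar R) : Prop :=
  (forall w, (0 <= tau w)%E) /\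
  (forall t : R, 0 <= t -> F t [set w | (tau w <= t%:E)%E]).

Definition finite_stopping_times (R : realType) (d : measure_display)
    (Omega : measurableType d) (P : probability Omega R)
    (F : R -> set (set Omega)) : set (Omega -> \bar R) :=
  [set tau | stopping_time F tau /\ P [set w | (tau w < +oo)%E] = 1%E].

(* The value on the null event {tau = +oo} is immaterial. *)
Definition stopped_value (R : realType) (Omega : Type) (S : R -> Omega -> R)
    (tau : Omega -> \bar R) (w : Omega) : R := S (fine (tau w)) w.

(* u is a function on [0, +oo[, so {u(S_tau) > x} is the event that S_tau lies
   in that domain (almost sure) and u(S_tau) > x.  Without the first condition
   the event could depend on the junk values of u on negative reals and fail
   to be measurable. *)
Definition J (R : realType) (d : measure_display)
    (Omega : measurableType d) (P : probability Omega R)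
    (u w : R -> R) (S : R -> Omega -> R) (tau : Omega -> \bar R) : \bar R :=
  (\int[@lebesgue_measure R]_(x in `[0%R, +oo[)
    (w (fine (P [set om | (0 <= stopped_value S tau om)%R /\
                          (x < u (stopped_value S tau om))%R])))%:E)%E.

Definition abs_continuous_on (R : realType) (a b : R) (f : R -> R) : Prop :=
  forall e : R, 0 < e -> exists2 delta : R, 0 < delta &
    forall (n : nat) (x y : 'I_n -> R),
      (forall i, a <= x i /\ x i <= y i /\ y i <= b) ->
      trivIset setT (fun i => `]x i, y i[%classic) ->
      \sum_(i < n) (y i - x i) < delta ->
      \sum_(i < n) `|f (y i) - f (x i)| < e.

Definition payoff_function (R : realType) (u : R -> R) : Prop :=
  [/\ u 0 = 0, forall x, 0 <= x -> 0 <= u x,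
      forall x y, 0 <= x -> x <= y -> u x <= u y &
      forall a b, 0 <= a -> a <= b -> abs_continuous_on a b u].

Definition distortion_function (R : realType) (w : R -> R) : Prop :=
  [/\ w 0 = 0 /\ w 1 = 1, forall p, 0 <= p <= 1 -> 0 <= w p <= 1,
      forall p q, 0 <= p -> p < q -> q <= 1 -> w p < w q &
      abs_continuous_on 0 1 w].

Definition admissible (R : realType) (s : R) (ab : R * R) : Prop :=
  [/\ 0 < ab.1, ab.1 <= s & s <= ab.2].

Definition two_point_value (R : realType) (u w : R -> R) (s : R)
    (ab : R * R) : R :=
  let: (a, b) := ab in
  if a == b then u s
  else (1 - w ((s - a) / (b - a))) * u a + w ((s - a) / (b - a)) * u b.

(* The infimum of the empty set is +oo. *)
Definition exit_time (R : realType) (Omega : Type) (S : R -> Omega -> R)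
    (a b : R) (w : Omega) : \bar R :=
  if a < b then
    ereal_inf [set t%:E | t in [set t : R | 0 <= t /\ ~ (a < S t w < b)]]
  else 0%E.

(* Main.v *)
(* Upper bound.  Any stopped value [S_tau] is nonnegative with mean at most [s] (positivity and
   the supermartingale property), so adding a constant gives [Y >= 0] of mean [s] with
   [J tau] at most the distorted payoff of [Y].  With [Y'] an independent copy of [Y], the law of
   [Y] is a mixture of the two-point laws of mean [s] carried by [{Y, Y'}], [Y <= s < Y']; by
   Jensen's inequality for the convex [w] and Tonelli's theorem, the distorted payoff of [Y] is
   at most an average of two-point values.

   Attainment.  For [0 < a < s < b] the exit time of []a, b[[ is almost surely finite and [S]
   stopped there has mean [s], which determines the weights of [a] and [b].

   The two facts about [S] needed above, positivity and [E S_tau = s] at times [tau] before which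
   [S] is bounded, come from approximating [S_tau - s] in probability by martingale transforms of
   the increments of [B] on a grid, and from the Ito isometry for these transforms. *)

Require Import Defs.
From HB Require Import structures.
From mathcomp Require Import all_boot all_order all_algebra.
From mathcomp Require Import all_classical all_reals all_analysis.
From mathcomp Require Import measurable_realfun ring lra.

Set Implicit Arguments.
Unset Strict Implicit.
Unset Printing Implicit Defensive.

Import Order.TTheory GRing.Theory Num.Theory.
Import numFieldNormedType.Exports.

Local Open Scope classical_set_scope.
Local Open Scope ring_scope.

(** * Moments of the normal distribution *)

Section normal_moments.
Variable R : realType.
Local Notation mu := (@lebesgue_measure R).

(** The stochastic integral is specified only as a limit in probability, at each fixed time, of
    integrals of simple processes; an isometry or a martingale property does not come with it. Grid
    sums do have both, with a second moment bound independent of the grid, and convergence in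
    probability under such a bound is weak convergence in L^2. The properties of [S] follow from the
    choice of the test variable: the constant [1] gives means, the limit itself gives second moment
    bounds, and [B T - B 0] gives the finiteness of exit times. Random times are reached through a
    second, coarser grid, since for a fixed coarse grid only finitely many deterministic times
    matter. Positivity has to come before the rest: the exit estimate needs the sign of the
    integrand, and the supermartingale bound, by Fatou's lemma, needs nonnegative values. In the
    upper bound, mean exactly [s] makes the expected excess above [s] equal to the expected deficit
    below it, which is what lets two-point laws reassemble into the law of [Y]. Jensen's inequality
    goes through secants because the slope of [w] at [1] may be infinite. *)

Lemma ge0_integralT_opp (f : R -> \bar R) :
  measurable_fun [set: R] f -> (forall r, 0 <= f r)%E ->
  (\int[mu]_r f r = \int[mu]_r f (- r)%R)%E.
Proof.
move=> mf f0.
transitivity (\int[pushforward mu (-%R : R -> measurableTypeR R)]_r f r)%E.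
  by apply: eq_measure_integral => //= A mA AS; exact/esym/lebesgue_measureN.
by rewrite ge0_integral_pushforward//=.
Qed.

Variable sigma : R.
Hypothesis s0 : 0 < sigma.
Let v := sigma ^+ 2.
Let h (x : R) : R := expR (- (x ^+ 2 / (v *+ 2))).
Let F (x : R) : R := x * h x.

Let v0 : 0 < v. Proof. by rewrite exprn_gt0. Qed.

Let is_derive_F (x : R) : is_derive x 1 F ((1 - x ^+ 2 / v) * h x).
Proof.
have dh : is_derive x 1 h (h x * (- (x / v))).
  have : is_derive x 1 (fun x : R => - (x ^+ 2 / (v *+ 2))) (- (x / v)).
    rewrite [f in is_derive _ _ f _](_ : _ = - ((v *+ 2)^-1 *: (id ^+ 2))); last first.
      by apply/funext => y; rewrite !fctE /= /GRing.scale/= mulrC.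
    apply: is_derive_eq; rewrite /= /GRing.scale /= mulr1 expr1 -mulr_natl.
    by field; rewrite lt0r_neq0.
  by move=> dg; exact: (@is_derive1_comp _ expR).
have -> : (1 - x ^+ 2 / v) * h x = x *: (h x * (- (x / v))) + h x *: (1 : R).
  by rewrite /GRing.scale/=; field; rewrite lt0r_neq0.
exact: (@is_deriveM _ _ id h).
Qed.

Let continuous_h : continuous h.
Proof.
move=> x; apply: (@continuous_comp _ _ _ (fun x : R => - (x ^+ 2 / (v *+ 2))) expR).
  apply: cvgN; apply: cvgM; last exact: cvg_cst.
  exact: exprn_continuous.
exact: continuous_expR.
Qed.

Let h_gt0 x : 0 < h x. Proof. exact: expR_gt0. Qed.

Let continuous_F : continuous F.
Proof. by move=> x; apply: cvgM; [exact: cvg_id|exact: continuous_h]. Qed.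

(** The inequality [1 + y <= expR y] at [y = x ^+ 2 / (v *+ 2)] gives [F x <= v *+ 2 / x] for
    positive [x]. *)
Let cvg_F : F x @[x --> +oo] --> 0.
Proof.
apply: (@squeeze_cvgr _ _ _ _ (cst 0) (fun x => v *+ 2 * x^-1)).
- near=> x; have x0 : 0 < x by near: x; exact: nbhs_pinfty_gt.
  rewrite mulr_ge0 ?(ltW x0) ?(ltW (h_gt0 _))//=.
  rewrite /F /h expRN ler_pdivrMr ?expR_gt0//.
  have := @expR_ge1Dx _ (x ^+ 2 / (v *+ 2)).
  move=> H; apply: (@le_trans _ _ (v *+ 2 / x * (1 + x ^+ 2 / (v *+ 2)))); last first.
    by rewrite ler_wpM2l// divr_ge0 ?(ltW x0)// mulrn_wge0// ltW.
  have -> : v *+ 2 / x * (1 + x ^+ 2 / (v *+ 2)) = v *+ 2 / x + x.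
    by rewrite -mulr_natl; field; rewrite !lt0r_neq0.
  by rewrite lerDr divr_ge0 ?(ltW x0)// mulrn_wge0// ltW.
- exact: cvg_cst.
- rewrite -[X in _ --> X](mulr0 (v *+ 2)); apply: cvgM; first exact: cvg_cst.
  by apply: (@gtr0_cvgV0 _ _ _ _ id _).2; [near=> x; near: x; exact: nbhs_pinfty_gt|exact: cvg_id].
Unshelve. all: by end_near. Qed.

Let cont_sub (A : set R) (f : R -> R) : continuous f -> {within A, continuous f}.
Proof. by move=> cf; exact: continuous_subspaceT. Qed.

Let r : R := Num.sqrt v.
Let r0 : 0 < r. Proof. by rewrite sqrtr_gt0. Qed.
Let rr : r ^+ 2 = v. Proof. by rewrite sqr_sqrtr// ltW. Qed.

Let cont_q : continuous (fun x : R => (1 - x ^+ 2 / v) * h x : R).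
Proof.
move=> x; apply: cvgM; last exact: continuous_h.
apply: cvgB; first exact: cvg_cst.
by apply: cvgM; [exact: exprn_continuous|exact: cvg_cst].
Qed.

Let int_lo : (\int[mu]_(x in `[0%R, r]) ((1 - x ^+ 2 / v) * h x)%:E = (F r)%:E)%E.
Proof.
rewrite (@continuous_FTC2 _ _ F)//.
- by rewrite {2}/F mul0r sube0.
- exact: cont_sub.
- split; [by move=> x _; apply: ex_derive; exact: is_derive_F| |];
    [apply: cvg_at_right_filter|apply: cvg_at_left_filter]; exact: continuous_F.
- by move=> x _; rewrite derive1E; apply: derive_val; exact: is_derive_F.
Qed.

Let int_hi : (\int[mu]_(x in `[r, +oo[) ((x ^+ 2 / v - 1) * h x)%:E = (F r)%:E)%E.
Proof.
have dNF (x : R) : is_derive x 1 (- F) ((x ^+ 2 / v - 1) * h x).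
  have -> : (x ^+ 2 / v - 1) * h x = - ((1 - x ^+ 2 / v) * h x) by ring.
  by apply: is_deriveN; exact: is_derive_F.
rewrite (@ge0_continuous_FTC2y _ _ (- F) _ 0)//.
- by rewrite sub0e -EFinN opprK.
- move=> x rx; rewrite mulr_ge0 ?(ltW (h_gt0 _))// subr_ge0 ler_pdivlMr// mul1r -rr.
  by rewrite ler_sqr ?nnegrE ?(ltW r0)// (le_trans (ltW r0)).
- apply: cont_sub => x; apply: cvgM; last exact: continuous_h.
  apply: cvgB; last exact: cvg_cst.
  by apply: cvgM; [exact: exprn_continuous|exact: cvg_cst].
- by rewrite -oppr0; apply: cvgN; exact: cvg_F.
- by apply: cvg_at_right_filter; apply: cvgN; exact: continuous_F.
- by move=> x _; rewrite derive1E; apply: derive_val; exact: dNF.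
Qed.

Let mh : measurable_fun setT h. Proof. exact: continuous_measurable_fun. Qed.
Let mqh : measurable_fun setT (fun x : R => x ^+ 2 / v * h x).
Proof.
apply: continuous_measurable_fun => x; apply: cvgM; last exact: continuous_h.
by apply: cvgM; [exact: exprn_continuous|exact: cvg_cst].
Qed.

(* [F] vanishes at [0] and at infinity and its derivative is the difference of the two
   integrands; the half-line is split at [r], where that derivative changes sign. *)
Let int_half : (\int[mu]_(x in `[0%R, +oo[) (x ^+ 2 / v * h x)%:E
                = \int[mu]_(x in `[0%R, +oo[) (h x)%:E)%E.
Proof.
have split_r (f : R -> \bar R) : measurable_fun setT f -> (forall x, 0 <= f x)%E ->
    (\int[mu]_(x in `[0%R, +oo[) f x
     = \int[mu]_(x in `[0%R, r]) f x + \int[mu]_(x in `[r, +oo[) f x)%E.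
  move=> mf f0; rewrite -(@integral_itv_obnd_cbnd _ r); last exact: measurable_funTS.
  rewrite -ge0_integral_setU//=.
  - rewrite -itv_bndbnd_setU//= bnd_simp// ltW//.
  - exact: measurable_funTS.
  - rewrite disj_set2E; apply/eqP/seteqP; split => // x [] /=.
    by rewrite !in_itv/= => /andP[_ xr] /andP[rx _]; move: (lt_le_trans rx xr); rewrite ltxx.
have mE (D : set R) (f : R -> R) : measurable_fun setT f ->
    measurable_fun D (fun x => (f x)%:E).
  by move=> mf; apply/measurable_funTS/measurable_EFinP.
have h0 x : (0 <= h x)%R by exact: ltW.
have q0 x : (0 <= x ^+ 2 / v * h x)%R by rewrite mulr_ge0// divr_ge0 ?sqr_ge0// ltW.
rewrite !split_r; try by [exact: mE|move=> x; rewrite lee_fin].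
have lo : (\int[mu]_(x in `[0%R, r]) (h x)%:E =
    \int[mu]_(x in `[0%R, r]) (x ^+ 2 / v * h x)%:E + (F r)%:E)%E.
  rewrite -int_lo -ge0_integralD//=.
  - by apply: eq_integral => x _; rewrite -EFinD; congr EFin; ring.
  - by move=> x _; rewrite lee_fin.
  - exact: mE.
  - move=> x; rewrite in_itv/= => /andP[x0 xr]; rewrite lee_fin mulr_ge0//.
    by rewrite subr_ge0 ler_pdivrMr// mul1r -rr ler_sqr ?nnegrE// ltW.
  - by apply: mE; exact: continuous_measurable_fun.
have hi : (\int[mu]_(x in `[r, +oo[) (x ^+ 2 / v * h x)%:E =
    \int[mu]_(x in `[r, +oo[) (h x)%:E + (F r)%:E)%E.
  rewrite -int_hi -ge0_integralD//=.
  - by apply: eq_integral => x _; rewrite -EFinD; congr EFin; ring.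
  - by move=> x _; rewrite lee_fin.
  - exact: mE.
  - move=> x; rewrite in_itv/= andbT => rx; rewrite lee_fin mulr_ge0//.
    rewrite subr_ge0 ler_pdivlMr// mul1r -rr.
    by rewrite ler_sqr ?nnegrE ?(ltW r0)// (le_trans (ltW r0)).
  - have -> : (fun x => ((x ^+ 2 / v - 1) * h x)%:E) = (fun x => ((x ^+ 2 / v * h x) - h x)%:E).
      by apply/funext => x; congr EFin; ring.
    by apply: mE; exact: measurable_funB.
by rewrite lo hi addeA addeAC.
Qed.

Let np : normal_pdf 0 sigma = (fun x => normal_peak sigma * h x).
Proof.
rewrite normal_pdfE ?gt_eqF//; apply/funext => x.
by rewrite /normal_fun subr0 /h mulNr.
Qed.

Let even_int (f : R -> R) : continuous f -> (forall x, 0 <= f x) -> (forall x, f (- x) = f x) ->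
  (\int[mu]_x (f x)%:E = 2%:E * \int[mu]_(x in `[0%R, +oo[) (f x)%:E)%E.
Proof.
move=> cf f0 fe; rewrite ge0_symfun_integralT//; last by move=> x /=; rewrite fe.
by rewrite set_itvcy.
Qed.

(** The Radon-Nikodym derivative of the normal law and its explicit density have the same integral
    over every measurable set, hence agree almost everywhere; the change of variables for the former
    carries over to the latter. *)
Let normal_integral (f : R -> \bar R) : measurable_fun setT f -> (forall x, (0 <= f x)%E) ->
  (\int[normal_prob 0 sigma]_x f x = \int[mu]_x (f x * (normal_pdf 0 sigma x)%:E))%E.
Proof.
move=> mf f0; have numu := normal_prob_dominates 0 sigma.
rewrite -(Radon_Nikodym_SigmaFinite.change_of_variables numu f0 measurableT mf).
have pdf_RN : ae_eq mu setT (Radon_Nikodym_SigmaFinite.f (normal_prob 0 sigma) mu)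
    (fun x => (normal_pdf 0 sigma x)%:E).
  apply: integral_ae_eq => //; first exact: Radon_Nikodym_SigmaFinite.f_integrable.
    by apply/measurable_EFinP; exact: measurable_normal_pdf.
  by move=> E _ mE; rewrite -Radon_Nikodym_SigmaFinite.f_integral.
apply: ae_eq_integral => //.
- apply: emeasurable_funM => //.
  exact: measurable_int (Radon_Nikodym_SigmaFinite.f_integrable numu).
- by apply: emeasurable_funM => //; apply/measurable_EFinP; exact: measurable_normal_pdf.
- by apply: filterS pdf_RN => x H _; rewrite H.
Qed.

Lemma normal_second_moment :
  (\int[normal_prob 0 sigma]_x (x ^+ 2)%:E = (sigma ^+ 2)%:E)%E.
Proof.
rewrite normal_integral//; last 2 first.
- by apply/measurable_EFinP; exact: measurable_funX.
- by move=> x; rewrite lee_fin sqr_ge0.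
have pk := normal_peak_gt0 (lt0r_neq0 s0).
have pkh : (\int[mu]_x (h x)%:E * (normal_peak sigma)%:E = 1)%E.
  rewrite -(integral_normal_pdf 0 sigma) np -ge0_integralZr//=.
  - by apply: eq_integral => x _; rewrite -EFinM mulrC.
  - exact/measurable_EFinP.
  - by move=> x _; rewrite lee_fin ltW.
  - by rewrite lee_fin ltW.
transitivity (v%:E * (\int[mu]_x (x ^+ 2 / v * h x)%:E * (normal_peak sigma)%:E))%E.
  rewrite -ge0_integralZr//=; last 3 first.
  - exact/measurable_EFinP.
  - by move=> x _; rewrite lee_fin mulr_ge0 ?(ltW (h_gt0 _))// divr_ge0 ?sqr_ge0// ltW.
  - by rewrite lee_fin ltW.
  rewrite -ge0_integralZl//=; last 3 first.
  - by apply: emeasurable_funM => //; exact/measurable_EFinP.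
  - move=> x _; rewrite mule_ge0// lee_fin.
      by rewrite mulr_ge0 ?(ltW (h_gt0 _))// divr_ge0 ?sqr_ge0// ltW.
    by rewrite ltW.
  - by rewrite lee_fin ltW.
  apply: eq_integral => x _; rewrite np -!EFinM; congr EFin.
  by field; rewrite lt0r_neq0.
rewrite even_int; last 3 first.
- move=> x; apply: cvgM; last exact: continuous_h.
  by apply: cvgM; [exact: exprn_continuous|exact: cvg_cst].
- by move=> x; rewrite mulr_ge0 ?(ltW (h_gt0 _))// divr_ge0 ?sqr_ge0// ltW.
- by move=> x; rewrite /h sqrrN.
rewrite int_half -even_int//; last 2 first.
- by move=> x; rewrite ltW.
- by move=> x; rewrite /h sqrrN.
by rewrite pkh mule1.
Qed.

Let sq_int : (normal_prob 0 sigma).-integrable setT (fun x : R => (x ^+ 2)%:E).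
Proof.
apply/integrableP; split; first by apply/measurable_EFinP; exact: measurable_funX.
under eq_integral do rewrite gee0_abs ?lee_fin ?sqr_ge0//.
by rewrite normal_second_moment ltry.
Qed.

Lemma integrable_normal_id : (normal_prob 0 sigma).-integrable setT (fun x : R => x%:E).
Proof.
have H : (normal_prob 0 sigma).-integrable setT (fun x : R => (1 + (x ^+ 2)%:E)%E).
  by apply: integrableD => //; exact: finite_measure_integrable_cst.
apply: le_integrable H => //.
  exact/measurable_EFinP.
move=> x _; rewrite -EFinD/= lee_fin [leRHS]ger0_norm ?addr_ge0 ?sqr_ge0//.
have := sqr_ge0 (`|x| - 1); rewrite -(real_normK (num_real x)); have := normr_ge0 x; nra.
Qed.

(** Reflection exchanges the positive and the negative part of the identity and fixes the density,
    so the two parts have the same integral. *)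
Lemma normal_mean : (\int[normal_prob 0 sigma]_x x%:E = 0)%E.
Proof.
rewrite integralE.
suff -> : (\int[normal_prob 0 sigma]_x (EFin^\+ x) = \int[normal_prob 0 sigma]_x (EFin^\- x))%E.
  rewrite subee//; apply: integrable_neg_fin_num => //; exact: integrable_normal_id.
have mE : measurable_fun setT (EFin : R -> \bar R) by exact/measurable_EFinP.
rewrite !normal_integral//; [|exact: measurable_funeneg|exact: measurable_funepos].
rewrite ge0_integralT_opp.
- apply: eq_integral => x _; rewrite np /h sqrrN; congr (_ * _)%E.
  by rewrite funeposE funenegE.
- apply: emeasurable_funM; first exact: measurable_funepos.
  by apply/measurable_EFinP; exact: measurable_normal_pdf.
- by move=> x; rewrite mule_ge0// lee_fin normal_pdf_ge0.
Qed.

End normal_moments.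

(** * Independence and square-integrable martingale transforms *)

Section independence.
Context (R : realType) d (Omega : measurableType d) (P : probability Omega R).
Variables (G : set (set Omega)) (Y Z : Omega -> R).
Hypothesis G_meas : G `<=` measurable.
Hypothesis mY : measurable_wrt G Y.
Hypothesis mZ : measurable_fun setT Z.
Hypothesis indep : forall (E : set Omega) (A : set R), G E -> measurable A ->
  P (E `&` (Z @^-1` A)) = (P E * P (Z @^-1` A))%E.

Let mY' : measurable_fun setT Y.
Proof. by move=> _ A mA; rewrite setTI; apply: G_meas; exact: mY. Qed.

Let YRV : {RV P >-> R} := HB.pack Y (isMeasurableFun.Build _ _ _ _ Y mY').
Let ZRV : {RV P >-> R} := HB.pack Z (isMeasurableFun.Build _ _ _ _ Z mZ).
Let mYZ : measurable_fun setT (fun w => (Y w, Z w)).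
Proof. exact: measurable_fun_pair. Qed.
Let YZ : {RV P >-> (R * R)%type} :=
  HB.pack (fun w => (Y w, Z w)) (isMeasurableFun.Build _ _ _ _ _ mYZ).

(** A product measure is determined by its values on rectangles, and on rectangles the claim is the
    independence of events. Both product formulas below are Fubini's theorem against this joint
    law. *)
Let joint : forall X : set (R * R), measurable X ->
  (distribution P YRV \x distribution P ZRV)%E X = distribution P YZ X.
Proof.
apply: product_measure_unique => A B mA mB.
rewrite /distribution/= /pushforward /=.
rewrite -indep//; last exact: mY.
Qed.

Lemma ge0_integral_indep (f g : R -> \bar R) :
  measurable_fun setT f -> measurable_fun setT g ->
  (forall x, 0 <= f x)%E -> (forall x, 0 <= g x)%E ->
  (\int[P]_w (f (Y w) * g (Z w)) = \int[P]_w f (Y w) * \int[P]_w g (Z w))%E.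
Proof.
move=> mf mg f0 g0.
have mfg : measurable_fun setT (fun p : R * R => f p.1 * g p.2)%E.
  by apply: emeasurable_funM; apply: measurableT_comp.
have fg0 (p : R * R) : (0 <= f p.1 * g p.2)%E by rewrite mule_ge0.
have := @ge0_integral_distribution _ _ _ _ _ P YZ _ mfg fg0; rewrite /comp /= => <-.
rewrite (eq_measure_integral (distribution P YRV \x distribution P ZRV)%E); last first.
  by move=> A mA _; exact/esym/joint.
rewrite fubini_tonelli1//= /fubini_F /=.
under eq_integral do rewrite ge0_integralZl//.
rewrite ge0_integralZr//; last exact: integral_ge0.
by rewrite !ge0_integral_distribution.
Qed.

Lemma integral_indep : P.-integrable setT (EFin \o Y) -> P.-integrable setT (EFin \o Z) ->
  P.-integrable setT (fun w => (Y w * Z w)%:E) /\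
  (\int[P]_w (Y w * Z w)%:E = \int[P]_w (Y w)%:E * \int[P]_w (Z w)%:E)%E.
Proof.
move=> iY iZ.
have iYZ : P.-integrable setT (fun w => (Y w * Z w)%:E).
  apply/integrableP; split; first by apply/measurable_EFinP; exact: measurable_funM.
  under eq_integral do rewrite EFinM abseM.
  rewrite (ge0_integral_indep (f := abse \o EFin) (g := abse \o EFin))//.
  - have [[_ Yoo] [_ Zoo]] := (integrableP _ _ _ iY, integrableP _ _ _ iZ).
    have i0 : (0 <= \int[P]_w (abse \o EFin) (Y w))%E by apply: integral_ge0 => w _ /=; rewrite lee_fin.
    by apply: lte_mul_pinfty; [exact: i0|rewrite ge0_fin_numE|exact: Zoo].
  - by apply: measurableT_comp => //; exact/measurable_EFinP.
  - by apply: measurableT_comp => //; exact/measurable_EFinP.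
  - by move=> x; rewrite /= lee_fin.
  - by move=> x; rewrite /= lee_fin.
split => //.
have mfg : measurable_fun setT (fun p : R * R => (p.1 * p.2)%:E)%E.
  by apply/measurable_EFinP; exact: measurable_funM.
have := @integral_distribution _ _ _ _ _ P YZ _ mfg iYZ; rewrite /comp /= => <-.
rewrite (eq_measure_integral (distribution P YRV \x distribution P ZRV)%E); last first.
  by move=> A mA _; exact/esym/joint.
have mab : measurable_fun setT (fun p : R * R => `|(p.1 * p.2)%:E|)%E.
  exact: measurableT_comp.
have iprod : (distribution P YRV \x distribution P ZRV)%E.-integrable setT
    (fun p : R * R => (p.1 * p.2)%:E).
  apply/integrableP; split => //.
  rewrite (eq_measure_integral (distribution P YZ)) => [|A mA _]; last exact: joint.
  rewrite ge0_integral_distribution//=.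
  by have /integrableP[] := iYZ.
have iY' : (distribution P YRV).-integrable setT (fun x : R => x%:E).
  apply/integrableP; split; first exact/measurable_EFinP.
  rewrite ge0_integral_distribution//; first by have /integrableP[] := iY.
  by apply: measurableT_comp => //; exact/measurable_EFinP.
have iZ' : (distribution P ZRV).-integrable setT (fun x : R => x%:E).
  apply/integrableP; split; first exact/measurable_EFinP.
  rewrite ge0_integral_distribution//; first by have /integrableP[] := iZ.
  by apply: measurableT_comp => //; exact/measurable_EFinP.
rewrite -integral12_prod_meas1//= /fubini_F /=.
have cE : (\int[distribution P ZRV]_y y%:E = \int[P]_w (Z w)%:E)%E.
  by rewrite integral_distribution//; exact/measurable_EFinP.
have cfin : (\int[P]_w (Z w)%:E)%E \is a fin_num by exact: integrable_fin_num.
have inner (x : R) : (\int[distribution P ZRV]_y (x * y)%:E = x%:E * (fine (\int[P]_w (Z w)%:E))%:E)%E.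
  by rewrite fineK// -cE -integralZl//; apply: eq_integral => y _; rewrite EFinM.
under eq_integral do rewrite inner.
rewrite integralZr// fineK// integral_distribution//; exact/measurable_EFinP.
Qed.

End independence.

(** Makes [G] the measurable structure of a type, so that the closure properties of measurable
    functions transfer to [measurable_wrt]. *)
Lemma measurable_wrtP (R : realType) (Omega : pointedType) (G : set (set Omega))
    (X : Omega -> R) : sigma_algebra setT G ->
  measurable_wrt G X <-> measurable_fun setT (X : g_sigma_algebraType G -> R).
Proof.
move=> sG; have GE : @measurable _ (g_sigma_algebraType G) = G by exact: sigma_algebra_id.
split => [mX _ A mA|mX A mA]; first by rewrite setTI GE; exact: mX.
by have := mX measurableT A mA; rewrite setTI GE.
Qed.

Lemma measurable_wrt_sub (R : realType) (Omega : Type) (G G' : set (set Omega))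
    (X : Omega -> R) : G `<=` G' -> measurable_wrt G X -> measurable_wrt G' X.
Proof. by move=> GG' mX A mA; apply/GG'/mX. Qed.

Section measurable_wrt.
Context (R : realType) (Omega : pointedType) (G : set (set Omega)).
Hypothesis sG : sigma_algebra setT G.
Implicit Types X Y : Omega -> R.

Lemma measurable_wrt_cst (r : R) : measurable_wrt G (fun _ : Omega => r).
Proof. by apply/(measurable_wrtP _ sG); exact: measurable_cst. Qed.

Lemma measurable_wrtD X Y : measurable_wrt G X -> measurable_wrt G Y ->
  measurable_wrt G (fun w => X w + Y w).
Proof.
by move=> /(measurable_wrtP _ sG) mX /(measurable_wrtP _ sG) mY;
  apply/(measurable_wrtP _ sG); exact: measurable_funD.
Qed.

Lemma measurable_wrtM X Y : measurable_wrt G X -> measurable_wrt G Y ->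
  measurable_wrt G (fun w => X w * Y w).
Proof.
by move=> /(measurable_wrtP _ sG) mX /(measurable_wrtP _ sG) mY;
  apply/(measurable_wrtP _ sG); exact: measurable_funM.
Qed.

Lemma measurable_wrt_comp (f : R -> R) X : measurable_fun setT f -> measurable_wrt G X ->
  measurable_wrt G (f \o X).
Proof.
by move=> mf /(measurable_wrtP _ sG) mX;
  apply/(measurable_wrtP _ sG); exact: (measurableT_comp mf mX).
Qed.

Lemma measurable_wrt_indic (A : set Omega) : G A -> measurable_wrt G (\1_A : Omega -> R).
Proof.
move=> GA; apply/(measurable_wrtP _ sG).
apply: (@measurable_indic _ (g_sigma_algebraType G)).
by rewrite /measurable/= sigma_algebra_id.
Qed.

End measurable_wrt.

Section square_integrable.
Context (R : realType) d (Omega : measurableType d) (P : probability Omega R).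
Implicit Types X Y : Omega -> R.

Definition square_integrable X :=
  measurable_fun setT X /\ P.-integrable setT (fun w => (X w ^+ 2)%:E).

Lemma square_integrable_mul X Y : square_integrable X -> square_integrable Y ->
  P.-integrable setT (fun w => (X w * Y w)%:E).
Proof.
move=> [mX iX] [mY iY].
have iS : P.-integrable setT (fun w => ((X w ^+ 2)%:E + (Y w ^+ 2)%:E)%E) by exact: integrableD.
apply: le_integrable iS => //; first by apply/measurable_EFinP; exact: measurable_funM.
move=> w _; rewrite -EFinD/= lee_fin [leRHS]ger0_norm ?addr_ge0 ?sqr_ge0//.
by rewrite ler_norml; have := sqr_ge0 (X w + Y w); have := sqr_ge0 (X w - Y w); nra.
Qed.

Lemma square_integrable_bounded X (M : R) : measurable_fun setT X ->
  (forall w, `|X w| <= M) -> square_integrable X.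
Proof.
move=> mX bX; split => //.
have iM : P.-integrable setT (fun=> (M ^+ 2)%:E) by exact: finite_measure_integrable_cst.
apply: le_integrable iM => //.
  by apply/measurable_EFinP; exact: measurable_funX.
move=> w _ /=; rewrite lee_fin ger0_norm ?sqr_ge0// ger0_norm ?sqr_ge0//.
by rewrite -(real_normK (num_real (X w))) ler_sqr ?nnegrE// (le_trans _ (bX w)).
Qed.

Lemma square_integrable_cst (r : R) : square_integrable (fun=> r).
Proof. by apply: (@square_integrable_bounded _ `|r|). Qed.

Lemma square_integrable_integrable X : square_integrable X -> P.-integrable setT (EFin \o X).
Proof.
move=> iX; have := square_integrable_mul iX (square_integrable_cst 1).
by under eq_fun do rewrite mulr1.
Qed.

Lemma square_integrableD X Y : square_integrable X -> square_integrable Y ->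
  square_integrable (fun w => X w + Y w).
Proof.
move=> iX iY; split; first by apply: measurable_funD; [case: iX|case: iY].
have -> : (fun w => ((X w + Y w) ^+ 2)%:E) = (fun w => ((X w ^+ 2)%:E + (Y w ^+ 2)%:E)
    + ((X w * Y w)%:E + (X w * Y w)%:E))%E.
  by apply/funext => w; rewrite -!EFinD; congr EFin; ring.
by apply: integrableD => //; apply: integrableD => //;
  [case: iX|case: iY|exact: square_integrable_mul|exact: square_integrable_mul].
Qed.

Lemma square_integrable_mul_bounded X Y (M : R) : measurable_fun setT X ->
  (forall w, `|X w| <= M) -> square_integrable Y -> square_integrable (fun w => X w * Y w).
Proof.
move=> mX bX [mY iY]; split; first exact: measurable_funM.
have iM : P.-integrable setT (fun w => ((M ^+ 2)%:E * (Y w ^+ 2)%:E)%E) by exact: integrableZl.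
apply: le_integrable iM => //.
  by apply/measurable_EFinP; apply: measurable_funX; exact: measurable_funM.
move=> w _; rewrite -EFinM/= lee_fin exprMn !normrM.
have XM : `|X w| <= `|M| by rewrite (le_trans (bX w))// ler_norm.
by apply: ler_wpM2r; [exact: mulr_ge0|exact: ler_pM].
Qed.

Lemma square_integrableN X : square_integrable X -> square_integrable (fun w => - X w).
Proof.
move=> iX; have := @square_integrable_mul_bounded (fun=> -1) _ `|-1| (measurable_cst _) (fun=> lexx _) iX.
by under eq_fun do rewrite mulN1r.
Qed.

Lemma square_integrableB X Y : square_integrable X -> square_integrable Y ->
  square_integrable (fun w => X w - Y w).
Proof. by move=> iX iY; apply: square_integrableD => //; exact: square_integrableN. Qed.

End square_integrable.

Section discrete_isometry.
Context (R : realType) d (Omega : measurableType d) (P : probability Omega R).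
Variables (G : nat -> set (set Omega)) (D : nat -> Omega -> R) (v : nat -> R).
Hypothesis sG : forall i, sigma_algebra setT (G i).
Hypothesis G_meas : forall i, G i `<=` measurable.
Hypothesis G_mono : forall i, G i `<=` G i.+1.
Hypothesis mD : forall i, measurable_wrt (G i.+1) (D i).
Hypothesis D_sq : forall i, square_integrable P (D i).
Hypothesis D_mean : forall i, (\int[P]_w (D i w))%R = 0.
Hypothesis D_var : forall i, (\int[P]_w (D i w ^+ 2))%R = v i.
Hypothesis D_indep : forall i (E : set Omega) (A : set R), G i E -> measurable A ->
  P (E `&` (D i @^-1` A)) = (P E * P (D i @^-1` A))%E.

(** The index is what makes these integrands predictable: [xi i] is known from [G i], while the
    increment [D i] that it multiplies is independent of [G i]. Then [transform] is the discrete
    stochastic integral of [xi] against the martingale with increments [D]. *)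
Definition predictable_bounded (xi : nat -> Omega -> R) :=
  forall i, measurable_wrt (G i) (xi i) /\ exists M : R, forall w, `|xi i w| <= M.

Definition transform (xi : nat -> Omega -> R) n (w : Omega) : R :=
  \sum_(i < n) xi i w * D i w.

Let measG i (X : Omega -> R) : measurable_wrt (G i) X -> measurable_fun setT X.
Proof. by move=> mX _ A mA; rewrite setTI; apply: (@G_meas i); exact: mX. Qed.

Lemma transform_measurable xi n : predictable_bounded xi ->
  measurable_wrt (G n) (transform xi n).
Proof.
move=> pxi; elim: n => [|n IH].
  by rewrite /transform; under eq_fun do rewrite big_ord0; exact: measurable_wrt_cst.
rewrite /transform; under eq_fun do rewrite big_ord_recr/=.
apply: measurable_wrtD => //; first exact: measurable_wrt_sub IH.
by apply: measurable_wrtM => //; apply: measurable_wrt_sub (pxi n).1.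
Qed.

Lemma transform_square_integrable xi n : predictable_bounded xi ->
  square_integrable P (transform xi n).
Proof.
move=> pxi; elim: n => [|n IH].
  by rewrite /transform; under eq_fun do rewrite big_ord0; exact: square_integrable_cst.
rewrite /transform; under eq_fun do rewrite big_ord_recr/=.
apply: square_integrableD => //.
have [mxi [M bM]] := pxi n.
by apply: square_integrable_mul_bounded bM _ => //; exact: measG mxi.
Qed.

Let mean_indep i (Y : Omega -> R) : measurable_wrt (G i) Y -> P.-integrable setT (EFin \o Y) ->
  (\int[P]_w (Y w * D i w))%R = 0.
Proof.
move=> mY iY.
have iD : P.-integrable setT (EFin \o D i) by exact: square_integrable_integrable.
have [_ YD] := integral_indep (@G_meas i) mY (D_sq i).1 (@D_indep i) iY iD.
rewrite /Rintegral YD fineM; last 2 first.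
- exact: integrable_fin_num.
- exact: integrable_fin_num.
by rewrite [X in _ * X](D_mean i) mulr0.
Qed.

Let var_indep i (Y : Omega -> R) (M : R) : measurable_wrt (G i) Y -> (forall w, `|Y w| <= M) ->
  (\int[P]_w (Y w * (D i w) ^+ 2))%R = (\int[P]_w Y w)%R * v i.
Proof.
move=> mY bY.
have iY : P.-integrable setT (EFin \o Y).
  apply: square_integrable_integrable; apply: square_integrable_bounded bY; exact: measG mY.
have mD2 : measurable_fun setT (fun w => D i w ^+ 2).
  by apply: measurable_funX; exact: (D_sq i).1.
have ind2 (E : set Omega) (A : set R) : G i E -> measurable A ->
    P (E `&` ((fun w => D i w ^+ 2)%R @^-1` A)) = (P E * P ((fun w => D i w ^+ 2)%R @^-1` A))%E.
  move=> GE mA; apply: (@D_indep i E ((fun x => x ^+ 2) @^-1` A)) => //.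
  by rewrite -[X in measurable X]setTI; exact: (@exprn_measurable _ setT 2).
have [_ YD] := integral_indep (@G_meas i) mY mD2 ind2 iY (D_sq i).2.
rewrite /Rintegral YD fineM; last 2 first.
- exact: integrable_fin_num.
- by apply: integrable_fin_num => //; exact: (D_sq i).2.
by rewrite -D_var.
Qed.

Lemma transform_mean xi n : predictable_bounded xi -> (\int[P]_w (transform xi n w))%R = 0.
Proof.
move=> pxi; elim: n => [|n IH].
  by rewrite /transform; under eq_Rintegral do rewrite big_ord0; rewrite Rintegral_cst// mul0r.
have [mxi [M bM]] := pxi n.
rewrite /transform; under eq_Rintegral do rewrite big_ord_recr/=.
rewrite RintegralD//; last 2 first.
- exact: square_integrable_integrable (transform_square_integrable _ _).
- apply: square_integrable_integrable.
  by apply: square_integrable_mul_bounded bM _ => //; exact: measG mxi.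
rewrite [X in X + _]IH add0r mean_indep//.
apply: square_integrable_integrable; apply: square_integrable_bounded bM; exact: measG mxi.
Qed.

(** In the product at step [n], the cross terms vanish because a factor known from [G n] multiplies
    the centred independent [D n]; only the product of the two last increments contributes. The
    bilinear form serves twice: with equal integrands for second moments, and with [eta] constantly
    [1] to test a sum against [B T - B 0]. *)
Lemma transform_isometry xi eta n : predictable_bounded xi -> predictable_bounded eta ->
  (\int[P]_w (transform xi n w * transform eta n w))%R =
  \sum_(i < n) (\int[P]_w (xi i w * eta i w))%R * v i.
Proof.
move=> pxi peta; elim: n => [|n IH].
  rewrite big_ord0 /transform; under eq_Rintegral do rewrite big_ord0 mul0r.
  by rewrite Rintegral_cst// mul0r.
rewrite big_ord_recr/= -IH.
have [[mxi [M bM]] [meta [N bN]]] := (pxi n, peta n).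
set X := transform xi n; set Y := transform eta n.
have [sX sY] : square_integrable P X /\ square_integrable P Y.
  by split; exact: transform_square_integrable.
have [sxi seta] : square_integrable P (xi n) /\ square_integrable P (eta n).
  by split; [apply: square_integrable_bounded bM; exact: measG mxi
            |apply: square_integrable_bounded bN; exact: measG meta].
have [sxD setaD] : square_integrable P (fun w => xi n w * D n w) /\
    square_integrable P (fun w => eta n w * D n w).
  by split; [apply: square_integrable_mul_bounded bM _ => //; exact: measG mxi
            |apply: square_integrable_mul_bounded bN _ => //; exact: measG meta].
have i1 := square_integrable_mul sX sY.
have i2 := square_integrable_mul sX setaD.
have i3 := square_integrable_mul sxD sY.
have i4 := square_integrable_mul sxD setaD.
transitivity (\int[P]_w ((X w * Y w + X w * (eta n w * D n w)) +
    (xi n w * D n w * Y w + xi n w * D n w * (eta n w * D n w))))%R.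
  by apply: eq_Rintegral => w _; rewrite /transform !big_ord_recr/= -/(X w) -/(Y w) /X /Y/transform; ring.
have mX : measurable_wrt (G n) X by exact: transform_measurable.
have mY : measurable_wrt (G n) Y by exact: transform_measurable.
rewrite RintegralD//; [|exact: (integrableD measurableT i1 i2)|exact: (integrableD measurableT i3 i4)].
rewrite !RintegralD//.
have -> : (\int[P]_w (X w * (eta n w * D n w)))%R = 0.
  under eq_Rintegral do rewrite mulrA; apply: mean_indep; first exact: measurable_wrtM.
  exact: square_integrable_mul.
have -> : (\int[P]_w (xi n w * D n w * Y w))%R = 0.
  under eq_Rintegral do rewrite mulrAC; apply: mean_indep; first exact: measurable_wrtM.
  exact: square_integrable_mul.
rewrite addr0 add0r; congr (_ + _).
transitivity (\int[P]_w ((xi n w * eta n w) * D n w ^+ 2))%R.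
  by apply: eq_Rintegral => w _; ring.
apply: (@var_indep _ _ (M * N)); first exact: measurable_wrtM.
by move=> w; rewrite normrM ler_pM.
Qed.

End discrete_isometry.

(** * Convergence in probability and Brownian increments *)

Section expectation.
Context (R : realType) d (Omega : measurableType d) (P : probability Omega R).
Implicit Types X Y Z : Omega -> R.

Lemma Rintegral_indic_probability (A : set Omega) : measurable A ->
  (\int[P]_w (\1_A w))%R = fine (P A).
Proof. by move=> mA; rewrite /Rintegral integral_indic// setIT. Qed.

Lemma integrable_indic_probability (A : set Omega) : measurable A ->
  P.-integrable setT (fun w => (\1_A w : R)%:E).
Proof.
move=> mA; apply: square_integrable_integrable.
apply: (@square_integrable_bounded _ _ _ _ _ 1) => [|w]; first exact: measurable_indic.
by rewrite indicE; case: (_ \in _); rewrite ?normr1 ?normr0.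
Qed.

Lemma Rintegral_dominated_cvg (X_ : nat -> Omega -> R) X (g : Omega -> R) :
  (forall n, measurable_fun setT (X_ n)) -> measurable_fun setT X ->
  {ae P, forall w, X_ n w @[n --> \oo] --> X w} ->
  P.-integrable setT (EFin \o g) -> {ae P, forall w, forall n, `|X_ n w| <= g w} ->
  (\int[P]_w X_ n w)%R @[n --> \oo] --> (\int[P]_w X w)%R.
Proof.
move=> mX_ mX Xcvg ig Xg.
have [|||||iX _ H] := @dominated_convergence _ _ _ P setT measurableT
  (fun n w => (X_ n w)%:E) (EFin \o X) (EFin \o g).
- by move=> n; exact/measurable_EFinP.
- exact/measurable_EFinP.
- apply: filterS Xcvg => w Xw _.
  by apply: cvg_EFin => //; exact: nearW.
- exact: ig.
- by apply: filterS Xg => w Xw n _; rewrite /= lee_fin.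
- by apply: fine_cvg; rewrite fineK ?integrable_fin_num.
Qed.

(** Dominated convergence of the indicators. This is the passage from pathwise statements to
    convergence in probability. *)
Lemma cvg_probability0 (A : nat -> set Omega) : (forall n, measurable (A n)) ->
  {ae P, forall w, \forall n \near \oo, ~ A n w} -> P (A n) @[n --> \oo] --> 0%E.
Proof.
move=> mA evA.
have : (\int[P]_w (\1_(A n) w))%R @[n --> \oo] --> (\int[P]_w (cst 0 w))%R.
  apply: (@Rintegral_dominated_cvg _ _ (cst 1)).
  - by move=> n; exact: measurable_indic.
  - exact: measurable_cst.
  - apply: filterS evA => w Aw; apply: cvg_near_cst.
    by apply: filterS Aw => n Anw; rewrite indicE memNset.
  - exact: finite_measure_integrable_cst.
  - by apply: aeW => w n; rewrite indicE; case: (_ \in _); rewrite ?normr1 ?normr0.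
rewrite Rintegral_cst// mul0r => H.
under eq_fun do rewrite -[P _]fineK ?fin_num_measure// -Rintegral_indic_probability//.
by apply: cvg_EFin => //; exact: nearW.
Qed.

Lemma square_integrable_tail Z (e : R) : square_integrable P Z -> 0 < e ->
  exists2 L : R, 0 < L & (\int[P]_w (Z w ^+ 2 * \1_[set w | L <= `|Z w|] w))%R <= e.
Proof.
move=> [mZ iZ] e0.
have mA n : measurable [set w | n.+1%:R <= `|Z w| :> R].
  rewrite -[X in measurable X]setTI.
  by apply: measurable_fun_le => //; exact: measurableT_comp.
have : (\int[P]_w (Z w ^+ 2 * \1_[set w | n.+1%:R <= `|Z w|] w))%R @[n --> \oo]
    --> (\int[P]_w (cst 0 w))%R.
  apply: (@Rintegral_dominated_cvg _ _ (fun w => Z w ^+ 2)) => //.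
  - move=> n; apply: measurable_funM; first exact: measurable_funX.
    exact: measurable_indic.
  - apply: aeW => w; apply: cvg_near_cst; near=> n.
    rewrite indicE memNset ?mulr0//=; apply/negP; rewrite -ltNge.
    rewrite (@lt_le_trans _ _ n%:R)// ?ler_nat//.
    near: n; exact: nbhs_infty_gtr.
  - apply: aeW => w n; rewrite normrM ger0_norm ?sqr_ge0// indicE.
    by case: (_ \in _); rewrite ?normr1 ?normr0 ?mulr1 ?mulr0 ?sqr_ge0.
rewrite Rintegral_cst// mul0r => /cvgrPdist_le/(_ _ e0)[N _ /(_ N (leqnn _))].
rewrite sub0r normrN => H; exists N.+1%:R => //.
by rewrite (le_trans (ler_norm _)).
Unshelve. all: by end_near. Qed.

(** Where [Y] is close to [X] the error is at most [dl * |Z|]. On the remaining event of small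
    probability, [|Y - X| * |Z|] is split by the weighted arithmetic-geometric inequality: the
    square of [Y - X] is controlled by [C] times a small weight, and the square of [Z] by its tail
    beyond [L] or by [L ^+ 2] times the probability of the event. *)
Lemma weak_convergence X Z (C eta : R) : square_integrable P X -> square_integrable P Z ->
  0 <= C -> 0 < eta -> exists2 dl : R, 0 < dl & forall Y, square_integrable P Y ->
  (\int[P]_w ((Y w - X w) ^+ 2))%R <= C ->
  fine (P [set w | dl <= `|Y w - X w|]) <= dl ->
  `|(\int[P]_w (Y w * Z w))%R - (\int[P]_w (X w * Z w))%R| <= eta.
Proof.
move=> sX sZ C0 eta0.
(* The constants distribute [eta]: [a] makes the term in [(Y - X) ^+ 2] at most [eta / 4], [L] does
   the same for the tail of [Z ^+ 2], and [dl] leaves [eta / 2] for the two terms that carry [dl]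
   and the probability. *)
pose a := eta / (2 * (C + 1)).
have C1 : 0 < C + 1 by rewrite ltr_wpDl.
have a0 : 0 < a by rewrite divr_gt0// mulr_gt0.
have [L L0 HL] := square_integrable_tail sZ (mulr_gt0 a0 (divr_gt0 eta0 (ltr0n _ 2))).
pose EZ := (\int[P]_w `|Z w|)%R.
have EZ0 : 0 <= EZ by exact: Rintegral_ge0.
pose K := EZ + L ^+ 2 / (2 * a).
have K0 : 0 <= K by rewrite addr_ge0// divr_ge0 ?sqr_ge0// mulr_ge0// ltW.
exists (eta / (2 * (K + 1))) => [|Y sY YX PYX].
  by rewrite divr_gt0// mulr_gt0// ltr_wpDl.
set dl := eta / _ in PYX *.
have dl0 : 0 < dl by rewrite divr_gt0// mulr_gt0// ltr_wpDl.
set A := [set w | dl <= `|Y w - X w|] in PYX.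
have sYX := square_integrableB sY sX.
have mA : measurable A.
  rewrite -[A]setTI; apply: measurable_fun_le => //.
  by apply: measurableT_comp => //; case: sYX.
have mB : measurable [set w | L <= `|Z w|].
  rewrite -[X in measurable X]setTI; apply: measurable_fun_le => //.
  by apply: measurableT_comp => //; case: sZ.
have iYXZ := square_integrable_mul sYX sZ.
rewrite -RintegralB//; [|exact: square_integrable_mul|exact: square_integrable_mul].
have -> : (\int[P]_w (Y w * Z w - X w * Z w))%R = (\int[P]_w ((Y w - X w) * Z w))%R.
  by apply: eq_Rintegral => w _; rewrite mulrBl.
apply: le_trans; first exact: le_normr_Rintegral.
have iU2 := sYX.2; have iZ2 := sZ.2.
have sind (E : set Omega) : measurable E -> square_integrable P (\1_E : Omega -> R).
  move=> mE; apply: (@square_integrable_bounded _ _ _ _ _ 1); first exact: measurable_indic.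
  by move=> w; rewrite indicE; case: (_ \in _); rewrite ?normr1 ?normr0.
have iA := square_integrable_integrable (sind _ mA).
have iZB : P.-integrable setT (fun w => (Z w ^+ 2 * \1_[set w | L <= `|Z w|] w)%:E).
  apply: le_integrable iZ2 => //.
    apply/measurable_EFinP; apply: measurable_funM; last exact: measurable_indic.
    by apply: measurable_funX; case: sZ.
  move=> w _ /=; rewrite lee_fin normrM ger0_norm ?sqr_ge0// indicE.
  by case: (_ \in _); rewrite ?normr1 ?normr0 ?mulr1 ?mulr0 ?sqr_ge0.
have iaZ : P.-integrable setT (EFin \o (fun w => `|Z w|)).
  exact: (integrable_abse (square_integrable_integrable sZ)).
have i1 : P.-integrable setT (EFin \o (fun w => dl * `|Z w|)) by exact: (integrableZl _ _ iaZ).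
have i2 : P.-integrable setT (EFin \o (fun w => a / 2 * (Y w - X w) ^+ 2)).
  exact: (integrableZl _ _ iU2).
have i3 : P.-integrable setT (EFin \o (fun w => L ^+ 2 / (2 * a) * \1_A w)).
  exact: (integrableZl _ _ iA).
have i4 : P.-integrable setT
    (EFin \o (fun w => (2 * a)^-1 * (Z w ^+ 2 * \1_[set w | L <= `|Z w|] w))).
  exact: (integrableZl _ _ iZB).
have i34 := integrableD measurableT i3 i4.
have i12 := integrableD measurableT i1 i2.
(* The pointwise bound has three cases: off [A] the first term suffices; on [A] the second one is
   joined by the fourth when [|Z|] is at least [L], and by the third otherwise. *)
apply: (@le_trans _ _ (\int[P]_w ((dl * `|Z w| + a / 2 * (Y w - X w) ^+ 2) +
   (L ^+ 2 / (2 * a) * \1_A w + (2 * a)^-1 * (Z w ^+ 2 * \1_[set w | L <= `|Z w|] w)))))%R.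
  apply: le_Rintegral => //.
  - exact: (integrable_abse iYXZ).
  - exact: (integrableD measurableT i12 i34).
  move=> w _; set U := Y w - X w; rewrite normrM.
  have U2 : `|U| ^+ 2 = U ^+ 2 by rewrite real_normK// num_real.
  have Z2 : `|Z w| ^+ 2 = Z w ^+ 2 by rewrite real_normK// num_real.
  have Z0 := normr_ge0 (Z w); have U0 := normr_ge0 U.
  have amgm : `|U| * `|Z w| <= a / 2 * U ^+ 2 + (2 * a)^-1 * Z w ^+ 2.
    rewrite -U2 -Z2 -subr_ge0.
    have -> : a / 2 * `|U| ^+ 2 + (2 * a)^-1 * `|Z w| ^+ 2 - `|U| * `|Z w| =
      (2 * a)^-1 * (a * `|U| - `|Z w|) ^+ 2 by field; rewrite lt0r_neq0.
    by rewrite mulr_ge0 ?sqr_ge0// invr_ge0 mulr_ge0// ltW.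
  have ia0 : 0 <= (2 * a)^-1 by rewrite invr_ge0 mulr_ge0// ltW.
  have aU : 0 <= a / 2 * U ^+ 2 by rewrite mulr_ge0 ?sqr_ge0// divr_ge0// ltW.
  have dZ : 0 <= dl * `|Z w| by rewrite mulr_ge0// ltW.
  have L2 : 0 <= L ^+ 2 / (2 * a) by rewrite mulr_ge0 ?sqr_ge0.
  have Z2a : 0 <= (2 * a)^-1 * Z w ^+ 2 by rewrite mulr_ge0 ?sqr_ge0.
  rewrite !indicE; have [wA|wA] := boolP (w \in A); last first.
    rewrite mulr0 add0r; apply: (@le_trans _ _ (dl * `|Z w|)).
      rewrite ler_wpM2r// ltW// ltNge; apply: contra wA => H; exact/mem_set.
    by rewrite -addrA lerDl addr_ge0// mulr_ge0// mulr_ge0 ?sqr_ge0.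
  have [wB|wB] := boolP (w \in _); rewrite !mulr1 ?mulr0 ?addr0.
    by apply: (le_trans amgm); lra.
  have ZL : `|Z w| <= L by rewrite ltW// ltNge; apply: contra wB => H; exact/mem_set.
  have ZL2 : (2 * a)^-1 * Z w ^+ 2 <= L ^+ 2 / (2 * a).
    by rewrite mulrC ler_wpM2r// -Z2 ler_sqr ?nnegrE// ltW.
  by apply: (le_trans amgm); lra.
rewrite RintegralD// RintegralD// RintegralD// !RintegralZl//.
rewrite Rintegral_indic_probability//.
have iaE : (2 * a)^-1 * (a * (eta / 2)) = eta / 4 by field; rewrite lt0r_neq0.
have t4 : (2 * a)^-1 * (\int[P]_w (Z w ^+ 2 * \1_[set w | L <= `|Z w|] w))%R <= eta / 4.
  by rewrite -iaE ler_wpM2l// invr_ge0 mulr_ge0// ltW.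
have t2 : a / 2 * (\int[P]_w (Y w - X w) ^+ 2)%R <= eta / 4.
  apply: (@le_trans _ _ (a / 2 * (C + 1))).
    apply: ler_wpM2l; first by rewrite divr_ge0 ?(ltW a0).
    by rewrite (le_trans YX)// lerDl.
  rewrite le_eqVlt; apply/orP; left; apply/eqP; rewrite /a; field; rewrite lt0r_neq0//.
have t13 : dl * EZ + L ^+ 2 / (2 * a) * fine (P A) <= eta / 2.
  apply: (@le_trans _ _ (dl * (K + 1))).
    rewrite /K !mulrDr mulr1 -addrA lerD2l (@le_trans _ _ (dl * (L ^+ 2 / (2 * a))))//.
      by rewrite mulrC ler_wpM2r// divr_ge0 ?sqr_ge0// mulr_ge0// ltW.
    by rewrite lerDl ltW.
  by rewrite le_eqVlt; apply/orP; left; apply/eqP; rewrite /dl; field; rewrite lt0r_neq0// ltr_wpDl.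
rewrite -/EZ; lra.
Qed.

End expectation.

Section brownian_increment.
Context (R : realType) d (Omega : measurableType d) (P : probability Omega R).
Variables (F : R -> set (set Omega)) (B : R -> Omega -> R).
Hypothesis hF : filtration F.
Hypothesis hB : brownian_motion P F B.
Variables (r t : R).
Hypotheses (r0 : 0 <= r) (rt : r < t).
Let D (w : Omega) : R := B t w - B r w.

Lemma brownian_increment_measurable : measurable_wrt (F t) D.
Proof.
case: hF => sF _ Fmono; case: hB => -[aB _] _ _ _.
have t0 : 0 <= t by rewrite (le_trans r0)// ltW.
have sFt := sF _ t0.
apply: measurable_wrtD => //; first exact: aB.
apply: (@measurable_wrt_comp _ _ _ sFt (fun x => - x)) => //.
  exact: oppr_measurable.
by apply: measurable_wrt_sub (aB _ r0); apply: Fmono => //; exact: ltW.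
Qed.

Let mD : measurable_fun setT D.
Proof.
move=> _ A mA; rewrite setTI; case: hF => _ FS _; apply: (FS t).
  by rewrite (le_trans r0)// ltW.
exact: brownian_increment_measurable.
Qed.
Let mD' : measurable_fun setT (D : Omega -> measurableTypeR R). Proof. exact: mD. Qed.
Let DRV : {mfun Omega >-> measurableTypeR R} :=
  HB.pack (D : Omega -> measurableTypeR R) (isMeasurableFun.Build _ _ _ (measurableTypeR R) _ mD').

Let D_law (A : set (measurableTypeR R)) : measurable A ->
  distribution P DRV A = normal_prob 0 (Num.sqrt (t - r)) A.
Proof. by move=> mA; case: hB => _ _ H _; exact: (H r t r0 rt A mA). Qed.

Let s0 : 0 < Num.sqrt (t - r). Proof. by rewrite sqrtr_gt0 subr_gt0. Qed.

Let ED2 : (\int[P]_w (D w ^+ 2)%:E = (t - r)%:E)%E.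
Proof.
have m2 : measurable_fun setT (fun x : measurableTypeR R => (x ^+ 2)%:E).
  by apply/measurable_EFinP; exact: measurable_funX.
have := @ge0_integral_distribution _ _ _ _ _ P DRV _ m2.
rewrite /comp/= => <- => [|y]; last by rewrite lee_fin sqr_ge0.
transitivity (\int[normal_prob 0 (Num.sqrt (t - r))]_x (x ^+ 2)%:E)%E.
  by apply: eq_measure_integral => A mA _; exact: D_law.
by rewrite normal_second_moment// sqr_sqrtr// subr_ge0 ltW.
Qed.

Lemma brownian_increment_square_integrable : square_integrable P D.
Proof.
split => //; apply/integrableP; split.
  by apply/measurable_EFinP; exact: measurable_funX.
under eq_integral do rewrite gee0_abs ?lee_fin ?sqr_ge0//.
by rewrite ED2 ltry.
Qed.

Lemma brownian_increment_variance : (\int[P]_w (D w ^+ 2))%R = t - r.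
Proof. by rewrite /Rintegral ED2. Qed.

Lemma brownian_increment_mean : (\int[P]_w (D w))%R = 0.
Proof.
have iD := square_integrable_integrable brownian_increment_square_integrable.
have mE : measurable_fun setT (EFin : measurableTypeR R -> \bar R) by exact/measurable_EFinP.
have := @integral_distribution _ _ _ _ _ P DRV _ mE iD.
rewrite /Rintegral /comp/= => <-.
transitivity (fine (\int[normal_prob 0 (Num.sqrt (t - r))]_x x%:E)%E).
  by congr fine; apply: eq_measure_integral => A mA _; exact: D_law.
by rewrite normal_mean.
Qed.

Lemma brownian_increment_indep (E : set Omega) (A : set R) : F r E -> measurable A ->
  P (E `&` (D @^-1` A)) = (P E * P (D @^-1` A))%E.
Proof. by move=> FE mA; case: hB => _ _ _; exact. Qed.

End brownian_increment.

(** * Riemann sums of the stochastic integral *)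

Section clamp.
Variable R : realType.
Implicit Types m x : R.

Definition clamp m x : R := Num.max (- m) (Num.min m x).

Lemma normr_clamp m x : 0 <= m -> `|clamp m x| <= m.
Proof.
by move=> m0; rewrite /clamp ler_norml le_max lexx/= ge_max ge_min lexx/= andbT; lra.
Qed.

Lemma clamp_id m x : `|x| <= m -> clamp m x = x.
Proof.
rewrite ler_norml => /andP[mx xm]; rewrite /clamp; case: (leP m x) => H; last by case: (leP _ _) => //; lra.
have -> : x = m by lra.
by case: (leP _ _) => //; lra.
Qed.

Lemma normr_clamp_le m x : 0 <= m -> `|clamp m x| <= `|x|.
Proof.
move=> m0; have [|/ltW xm] := leP `|x| m; first by move=> /clamp_id ->.
exact: le_trans (normr_clamp _ m0) xm.
Qed.

Lemma clamp_mul_ge0 m x : 0 <= m -> 0 <= x * clamp m x.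
Proof.
move=> m0; have [x0|x0] := leP 0 x.
  by rewrite mulr_ge0// /clamp le_max le_min m0 x0 orbT.
by rewrite mulr_le0// /clamp ?ge_max ?ge_min ?oppr_le0 ?m0 ?(ltW x0) ?orbT.
Qed.

Lemma measurable_clamp m : measurable_fun setT (clamp m).
Proof. by apply: measurable_maxr => //; exact: measurable_minr. Qed.

End clamp.

Section continuous_paths.
Context (R : realType) (Omega : Type) (X : R -> Omega -> R).
Hypothesis cX : continuous_paths X.

Lemma continuous_path_dist w (r e : R) : 0 <= r -> 0 < e -> exists2 dl : R, 0 < dl &
  forall t, 0 <= t -> `|r - t| < dl -> `|X r w - X t w| < e.
Proof.
move=> r0 e0; have /subspace_continuousP H := @cX w.
have := H r; rewrite /= in_itv/= andbT => /(_ r0)/cvgrPdist_lt/(_ _ e0).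
rewrite near_withinE => -[dl/= dl0 Hdl]; exists dl => // t t0 rt.
by apply: Hdl => //; rewrite in_itv/= andbT.
Qed.

(** Paths are constrained only at nonnegative times; freezing them at their initial value before [0]
    gives continuous functions on the whole line. *)
Lemma continuous_path_max w : continuous (fun r : R => X (Num.max 0 r) w).
Proof.
move=> r; apply/cvgrPdist_lt => e e0.
have [|dl dl0 H] := @continuous_path_dist w (Num.max 0 r) e _ e0; first by rewrite le_max lexx.
exists dl => //= t rt; apply: H; first by rewrite le_max lexx.
apply: le_lt_trans rt; case: (leP 0 r) => r0; case: (leP 0 t) => t0; rewrite ?subrr ?normr0//.
  by rewrite subr0 [leRHS]ger0_norm ?ger0_norm; lra.
by rewrite sub0r normrN [leRHS]ler0_norm ?ger0_norm; lra.
Qed.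

Lemma continuous_path_bounded w (T : R) : exists M : R, forall r, 0 <= r <= T -> `|X r w| <= M.
Proof.
have [T0|T0] := leP 0 T; last by exists 0 => r /andP[r0 rT]; lra.
have cN : {within `[0, T], continuous (fun r : R => `|X (Num.max 0 r) w|)}.
  by apply: continuous_subspaceT => r; apply: cvg_norm; exact: continuous_path_max.
have [c _ H] := EVT_max T0 cN.
exists `|X (Num.max 0 c) w| => r /andP[r0 rT].
by have := H r; rewrite in_itv/= r0 rT => /(_ isT); rewrite (max_idPr r0).
Qed.

End continuous_paths.

(** The process is the pointwise limit of its values at the last point of the grid of mesh
    [1 / n.+1] not after [p.2]; a preimage under such an approximation is a countable union of
    measurable rectangles. *)
Lemma measurable_continuous_process (R : realType) d (Omega : measurableType d)
    (X : R -> Omega -> R) : (forall r, measurable_fun setT (X r)) ->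
  (forall w, continuous (X ^~ w)) -> measurable_fun setT (fun p : Omega * R => X p.2 p.1).
Proof.
move=> mX cX.
pose g n (p : Omega * R) := X ((Num.floor (n.+1%:R * p.2))%:~R / n.+1%:R) p.1.
apply: (@measurable_fun_cvg _ _ _ _ g).
  move=> n _ A mA; rewrite setTI.
  have -> : g n @^-1` A = \bigcup_(k : int) ((X (k%:~R / n.+1%:R) @^-1` A) `*`
      `[k%:~R / n.+1%:R, (k + 1)%:~R / n.+1%:R[%classic).
    apply/seteqP; split => [[w r]|[w r] [k _ []]]; rewrite /g /=.
      move=> Aw; exists (Num.floor (n.+1%:R * r)) => //=; split => //.
      by rewrite in_itv/= ler_pdivrMr// ltr_pdivlMr// mulrC floor_itv.
    rewrite in_itv/= ler_pdivrMr// ltr_pdivlMr// => Aw kr.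
    by rewrite (@floor_def _ _ k)// mulrC.
  apply: countable_bigcupT_measurable => // k; apply: measurableX => //.
  by rewrite -[X in measurable X]setTI; exact: mX.
move=> [w r] _; rewrite /g /=; apply: (cvg_comp _ (X ^~ w)); last exact: cX.
apply/cvgrPdist_le => e e0; near=> n.
have /andP[f1 f2] := floor_itv (n.+1%:R * r : R).
have n0 : 0 < n.+1%:R :> R by [].
rewrite ger0_norm; last by rewrite subr_ge0 ler_pdivrMr// (mulrC r).
rewrite lerBlDr -(ler_pM2r n0) mulrDl divfK ?lt0r_neq0//.
rewrite intrD in f2.
have en : 1 <= e * n.+1%:R.
  rewrite -ler_pdivrMl// mulr1 ltW// (@lt_le_trans _ _ n%:R)// ?ler_nat//.
  by near: n; exact: nbhs_infty_gtr.
lra.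
Unshelve. all: by end_near. Qed.

Section euler_approximation.
Context (R : realType) d (Omega : measurableType d) (P : probability Omega R).
Variables (F : R -> set (set Omega)) (B S : R -> Omega -> R) (c s : R).
Hypothesis hF : filtration F.
Hypothesis hB : brownian_motion P F B.
Hypothesis hS : solves_sde P F B (fun x => c * x) s S.

Lemma sde_paths_continuous : continuous_paths S. Proof. by case: hS. Qed.

Lemma adapted_measurable (X : R -> Omega -> R) (r : R) : adapted F X -> 0 <= r ->
  measurable_fun setT (X r).
Proof.
move=> aX r0 _ A mA; rewrite setTI; case: hF => _ Fm _.
by apply: (Fm r r0); exact: aX.
Qed.

Lemma sde_measurable (r : R) : 0 <= r -> measurable_fun setT (S r).
Proof. by move=> r0; apply: adapted_measurable => //; case: hS. Qed.

(** The truncation at level [m] is there because the coefficients of a simple process must be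
    bounded; [m] tends to infinity as the mesh tends to [0]. *)
Definition euler_coef (h : R) (m i : nat) (w : Omega) : R := clamp m%:R (c * S (i%:R * h) w).

Lemma euler_coef_measurable (h : R) m i : 0 <= h ->
  measurable_wrt (F (i%:R * h)) (euler_coef h m i).
Proof.
move=> h0; have ih0 : 0 <= i%:R * h by rewrite mulr_ge0.
case: hF => sF _ _; have sFi := sF _ ih0.
apply: (measurable_wrt_comp sFi (f := fun x => clamp m%:R (c * x))).
  by apply: measurableT_comp; [exact: measurable_clamp|exact: mulrl_measurable].
by case: hS => aS _ _ _; exact: aS.
Qed.

Section simple.
Variables (h : R) (h0 : 0 < h) (n m : nat).

Let time (i : nat) : R := i%:R * h.

Let time_ge0 : 0 <= time 0. Proof. by rewrite /time mul0r. Qed.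

Let time_le i : (i < n)%N -> time i <= time i.+1.
Proof. by move=> _; rewrite /time ler_wpM2r ?ler_nat// ltW. Qed.

Let coef_bounded i : (i < n)%N -> exists M : R, forall w, `|euler_coef h m i w| <= M.
Proof. by move=> _; exists m%:R => w; exact: normr_clamp. Qed.

Let coef_measurable i : (i < n)%N -> measurable_wrt (F (time i)) (euler_coef h m i).
Proof. by move=> _; apply: euler_coef_measurable; exact: ltW. Qed.

Definition euler_process : simple_process F :=
  SimpleProcess time_ge0 time_le coef_bounded coef_measurable.

Lemma euler_process_value (r : R) (w : Omega) : 0 < r <= n%:R * h ->
  exists i, [/\ (i < n)%N, i%:R * h < r <= i.+1%:R * h &
                sp_value euler_process r w = euler_coef h m i w].
Proof.
move=> /andP[r0 rn].
have ex : exists i, r <= i.+1%:R * h.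
  by exists n; rewrite (le_trans rn)// ler_wpM2r ?ler_nat// ltW.
case: (ex_minnP ex) => i ri imin; exists i.
have ir : i%:R * h < r.
  case: i ri imin => [|i] ri imin; first by rewrite mul0r.
  by rewrite ltNge; apply/negP => /imin; rewrite ltnn.
have iN : (i < n)%N.
  rewrite ltnNge; apply/negP => ni.
  have := lt_le_trans ir rn; rewrite ltNge ler_wpM2r ?ler_nat//.
  exact: ltW.
split; [by []|by rewrite ir ri|].
rewrite /sp_value/= (big_pred1 (Ordinal iN))//= => j.
apply/idP/eqP => [/andP[jr rj]|->/=]; last by rewrite /time ir ri.
apply/val_inj => /=; apply/eqP; rewrite eqn_leq -ltnS -[X in _ && X]ltnS.
have lt_time (a b : nat) : a%:R * h < b%:R * h -> (a < b)%N by rewrite ltr_pM2r// ltr_nat.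
by rewrite !lt_time// ?(lt_le_trans jr ri) ?(lt_le_trans ir rj).
Qed.

Lemma euler_process_integral (j : nat) (w : Omega) : (j <= n)%N ->
  simple_integral B euler_process (time j) w =
  \sum_(i < j) euler_coef h m i w * (B (time i.+1) w - B (time i) w).
Proof.
move=> jn; rewrite /simple_integral /=.
have timeM (a b : nat) : (a <= b)%N -> time a <= time b.
  by move=> ab; rewrite /time ler_wpM2r ?ler_nat// ltW.
rewrite (big_ord_widen n (fun i => euler_coef h m i w * (B (time i.+1) w - B (time i) w)))//.
rewrite [RHS]big_mkcond/=; apply: eq_bigr => i _; case: ifPn => ij.
  by rewrite !(min_idPr _)// timeM// ltnW.
by rewrite -leqNgt in ij; rewrite !(min_idPl _) ?timeM ?subrr ?mulr0// (leq_trans ij).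
Qed.

End simple.

Section euler_convergence.
Variables (T : R) (T0 : 0 < T) (n m : nat -> nat).
Hypothesis n_gt0 : forall k, (0 < n k)%N.
Hypothesis n_oo : n k @[k --> \oo] --> \oo.
Hypothesis m_oo : m k @[k --> \oo] --> \oo.

Let h k : R := T / (n k)%:R.
Let h_gt0 k : 0 < h k. Proof. by rewrite divr_gt0// ltr0n. Qed.
Let hn k : (n k)%:R * h k = T.
Proof. by rewrite /h mulrC divfK// pnatr_eq0 -lt0n. Qed.

Let phi k : simple_process F := euler_process (h_gt0 k) (n k) (m k).

Let h_cvg0 : h k @[k --> \oo] --> 0.
Proof.
rewrite -(mulr0 T); apply: cvgM; first exact: cvg_cst.
apply/gtr0_cvgV0; first by apply: nearW => k; rewrite ltr0n.
exact/cvgrnyP.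
Qed.

Let err k (w : Omega) (r : R) : R := (sp_value (phi k) r w - c * S r w) ^+ 2.

(** Equal to [err] at nonnegative times, and jointly measurable because negative times are sent to
    [0]. *)
Let err' k (w : Omega) (r : R) : R := (sp_value (phi k) r w - c * S (Num.max 0 r) w) ^+ 2.

Let joint_err k : measurable_fun setT (fun p : Omega * R => err' k p.1 p.2).
Proof.
apply: measurable_funX; apply: measurable_funB; last first.
  apply: measurable_funM => //.
  apply: (@measurable_continuous_process _ _ _ (fun r w => S (Num.max 0 r) w)).
    by move=> r; apply: sde_measurable; rewrite le_max lexx.
  by move=> w; exact: (continuous_path_max sde_paths_continuous).
rewrite /sp_value.
have -> : (fun p : Omega * R => \sum_(i < sp_size (phi k) |
      sp_time (phi k) i < p.2 <= sp_time (phi k) i.+1) sp_coef (phi k) i p.1) =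
    (fun p : Omega * R => \sum_(i < sp_size (phi k)) sp_coef (phi k) i p.1 *
      \1_(`]sp_time (phi k) i, sp_time (phi k) i.+1]%classic) p.2).
  apply/funext => p; rewrite big_mkcond; apply: eq_bigr => i _.
  rewrite indicE; case: ifPn => [H|/negP H]; first by rewrite mem_set ?mulr1//= in_itv.
  by rewrite memNset ?mulr0//= in_itv.
apply: measurable_sum => i; apply: measurable_funM.
  apply: (measurableT_comp (f := sp_coef (phi k) i)) => //.
  move=> _ A mA; rewrite setTI; case: hF => _ Fm _.
  apply: (Fm (i%:R * h k)); first by rewrite mulr_ge0// ltW.
  by apply: (sp_coef_measurable (i := i)).
apply: (measurableT_comp (f := \1_(`]sp_time (phi k) i, sp_time (phi k) i.+1]%classic) : R -> R)) => //.
Qed.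

Let integral_errE k (t : R) (w : Omega) : (\int[@lebesgue_measure R]_(r in `[0%R, t]) (err k w r)%:E =
  \int[@lebesgue_measure R]_(r in `[0%R, t]) (err' k w r)%:E)%E.
Proof.
apply: eq_integral => r; rewrite inE/= in_itv/= => /andP[r0 _].
by rewrite /err /err' (max_idPr r0).
Qed.

Let measurable_integral_err k (t : R) :
  measurable_fun setT (fun w => \int[@lebesgue_measure R]_(r in `[0%R, t]) (err' k w r)%:E)%E.
Proof.
have -> : (fun w => \int[@lebesgue_measure R]_(r in `[0%R, t]) (err' k w r)%:E)%E =
  fubini_F (@lebesgue_measure R) (fun p : Omega * measurableTypeR R => (err' k p.1 p.2 * \1_(`[0, t]%classic) p.2)%:E).
  apply/funext => w; rewrite /fubini_F [LHS]integral_mkcond.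
  apply: (@eq_integral _ (measurableTypeR R) R (@lebesgue_measure R) setT) => r _.
  by rewrite patchE indicE; case: (_ \in _); rewrite ?mulr1 ?mulr0.
apply: measurable_fun_fubini_tonelli_F.
  apply/measurable_EFinP; apply: measurable_funM; first exact: joint_err.
  by apply: (measurableT_comp (f := \1_(`[0, t]%classic) : R -> R)).
by move=> p; rewrite lee_fin mulr_ge0 ?sqr_ge0// indicE.
Qed.

(** A single path is bounded on [[0, T]], so its truncation is eventually inactive and a constant
    dominates the errors; continuity at each time [r] then suffices, by dominated convergence in
    [r]. *)
Let integral_err_cvg (t : R) (w : Omega) : 0 <= t <= T ->
  (\int[@lebesgue_measure R]_(r in `[0%R, t]) (err' k w r)%:E @[k --> \oo] --> 0)%E.
Proof.
move=> /andP[t0 tT].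
have merr k : measurable_fun setT (err' k w).
  exact: (measurableT_comp (joint_err k) (measurable_fun_pair (measurable_cst w) (@measurable_id _ _ setT))).
have [M HM] := @continuous_path_bounded _ _ _ sde_paths_continuous w T.
(* Time [0] lies in no left-open cell of the simple process, where the value is therefore the empty
   sum; it is dropped as a null set. *)
have -> : (fun k => \int[@lebesgue_measure R]_(r in `[0%R, t]) (err' k w r)%:E)%E =
    (fun k => \int[@lebesgue_measure R]_(r in `]0%R, t]) (err' k w r)%:E)%E.
  apply/funext => k; rewrite integral_itv_obnd_cbnd//.
  by apply/measurable_EFinP; exact: measurable_funTS.
have M0 : 0 <= M by rewrite (le_trans _ (HM 0 _))// lexx ltW.
have mR : \forall k \near \oo, `|c| * M <= (m k)%:R.
  have H : (m k)%:R @[k --> \oo] --> (+oo : set_system R) by exact/cvgrnyP.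
  by move/cvgryPge : H; exact.
have cM r : 0 < r <= t -> `|c * S (Num.max 0 r) w| <= `|c| * M.
  move=> /andP[r0 rt]; rewrite normrM ler_wpM2l//.
  by rewrite (max_idPr (ltW r0)) HM// (ltW r0) (le_trans rt).
have vM k r : 0 < r <= t -> `|sp_value (phi k) r w| <= `|c| * M.
  move=> /andP[r0 rt].
  have [|i [iN /andP[ir ri] ->]] := @euler_process_value (h k) (h_gt0 k) (n k) (m k) r w.
    by rewrite r0 hn (le_trans rt).
  rewrite /euler_coef (le_trans (normr_clamp_le _ _))// normrM ler_wpM2l//.
  by rewrite HM// mulr_ge0 ?(ltW (h_gt0 _))//= -(hn k) ler_wpM2r ?ler_nat ?(ltW (h_gt0 _))// ltnW.
rewrite -(@integral0 _ _ _ (@lebesgue_measure R) `]0%R, t]%classic).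
have [||||||_ _] := @dominated_convergence _ _ _ (@lebesgue_measure R) `]0%R, t]%classic
  _ (fun k r => (err' k w r)%:E) (cst 0%E) (cst ((2 * (`|c| * M)) ^+ 2)%:E) => //.
- by move=> k; apply/measurable_EFinP; apply: (measurable_funTS (merr k)).
- apply: aeW => r; rewrite /= in_itv/= => /andP[r0 rt]; apply: cvg_EFin; first exact: nearW.
  have rT : r <= T by exact: le_trans tT.
  suff : sp_value (phi k) r w - c * S (Num.max 0 r) w @[k --> \oo] --> 0.
    by move=> H; rewrite -(mulr0 0); under eq_fun do rewrite /err' expr2; exact: cvgM.
  apply/cvgrPdist_lt => e e0; rewrite (max_idPr (ltW r0)).
  have e'0 : 0 < e / (`|c| + 1) by rewrite divr_gt0// ltr_wpDl.
  have [dl dl0 Hdl] := continuous_path_dist sde_paths_continuous w (ltW r0) e'0.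
  near=> k.
  have [|i [iN /andP[ir ri] ->]] := @euler_process_value (h k) (h_gt0 k) (n k) (m k) r w.
    by rewrite r0 hn.
  have ih0 : 0 <= i%:R * h k by rewrite mulr_ge0// ltW.
  have ihT : i%:R * h k <= T by rewrite (le_trans (ltW ir)).
  rewrite /euler_coef clamp_id.
    rewrite sub0r normrN -mulrBr normrM distrC.
    apply: (@le_lt_trans _ _ (`|c| * (e / (`|c| + 1)))).
      apply: ler_wpM2l => //; apply/ltW/Hdl => //.
      rewrite gtr0_norm ?subr_gt0//.
      apply: (@le_lt_trans _ _ (h k)); first by move: ri; rewrite -natr1 mulrDl mul1r; lra.
      near: k; have := h_cvg0 => /cvgrPdist_lt/(_ _ dl0); apply: filterS => k.
      by rewrite sub0r normrN gtr0_norm.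
    by rewrite mulrCA -[ltRHS]mulr1 ltr_pM2l// ltr_pdivrMr ?ltr_wpDl// mul1r ltrDl.
  rewrite normrM (@le_trans _ _ (`|c| * M))//.
    by apply: ler_wpM2l => //; apply: HM; rewrite ih0.
  near: k; exact: mR.
- apply/integrableP; split => //; rewrite /= integral_cst//= lebesgue_measure_itv/=.
  by case: ifP => _; rewrite ?mule0 ?ltry// -EFinB -EFinM ltry.
- apply: aeW => r k /=; rewrite in_itv/= => r0t; rewrite lee_fin ger0_norm ?sqr_ge0//.
  rewrite /err' -(real_normK (num_real (_ - _))) ler_sqr ?nnegrE ?mulr_ge0//.
  rewrite (le_trans (ler_normB _ _))// mulr_natl mulr2n lerD// ?vM ?cM//.
Unshelve. all: by end_near. Qed.

Lemma euler_approximates (t : R) : 0 <= t <= T ->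
  approximates P (fun r w => c * S r w) t phi.
Proof.
move=> tT e e0; apply: cvg_probability0.
  move=> k; rewrite -[X in measurable X]setTI; apply: emeasurable_fun_c_infty => //.
  have := measurable_integral_err k t; congr (measurable_fun _ _).
  by apply/funext => w; rewrite -integral_errE.
apply: aeW => w; have := integral_err_cvg w tT; move/fine_cvgP => [fn].
move/cvgrPdist_lt => /(_ _ e0); apply: filterS2 fn => k fn /=.
rewrite -integral_errE in fn *; rewrite sub0r normrN => H.
apply/negP; rewrite -ltNge -[ltLHS]fineK// lte_fin.
exact: le_lt_trans (ler_norm _) H.
Qed.

Lemma euler_converges (t : R) : 0 <= t <= T -> forall e : R, 0 < e ->
  P [set w | e <= `|simple_integral B (phi k) t w - (S t w - s)|] @[k --> \oo] --> 0%E.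
Proof.
move=> tT e e0; case: hS => _ _ _ H; have /andP[t0 _] := tT.
exact: (H t t0).2 phi (euler_approximates tT) e e0.
Qed.

End euler_convergence.
End euler_approximation.

(** * Stopped Riemann sums *)

Lemma measurable_set_le d (T : measurableType d) (R : realType) (f g : T -> R) :
  measurable_fun setT f -> measurable_fun setT g -> measurable [set x | f x <= g x].
Proof. by move=> mf mg; rewrite -[X in measurable X]setTI; exact: measurable_fun_le. Qed.

Lemma measurable_set_lt d (T : measurableType d) (R : realType) (f g : T -> R) :
  measurable_fun setT f -> measurable_fun setT g -> measurable [set x | f x < g x].
Proof.
move=> mf mg; have := measurableC (measurable_set_le mg mf).
by congr measurable; apply/seteqP; split => x /=; rewrite ltNge => /negP.
Qed.

(** The coarse time attached to a fine index does not come after the fine time. Hence an indicator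
    frozen at the former is known at the latter, which makes the stopped coefficients
    predictable. *)
Lemma coarse_time_le (R : realType) (T : R) (N M i : nat) : 0 < T ->
  (i %/ M.+1)%:R * (T / N.+1%:R) <= i%:R * (T / (N.+1 * M.+1)%:R).
Proof.
move=> T0; have h0 : 0 < T / (N.+1 * M.+1)%:R by rewrite divr_gt0// ltr0n.
have -> : (i %/ M.+1)%:R * (T / N.+1%:R) = ((i %/ M.+1) * M.+1)%:R * (T / (N.+1 * M.+1)%:R).
  have [a0 b0] : (N.+1%:R != 0 :> R) /\ (M.+1%:R != 0 :> R) by rewrite !pnatr_eq0.
  rewrite !natrM; move: (N.+1%:R : R) (M.+1%:R : R) a0 b0 => a b a0 b0.
  by field; rewrite a0 b0.
by rewrite ler_pM2r// ler_nat leq_divM.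
Qed.

Lemma cvg_divS (R : realType) (a : R) : a / n.+1%:R @[n --> \oo] --> 0.
Proof. by rewrite -[X in _ --> X](mulr0 a); apply: cvgM; [exact: cvg_cst|exact: cvg_harmonic]. Qed.

Section stopped_euler.
Context (R : realType) d (Omega : measurableType d) (P : probability Omega R).
Variables (F : R -> set (set Omega)) (B S : R -> Omega -> R) (c s : R).
Hypothesis hF : filtration F.
Hypothesis hB : brownian_motion P F B.
Hypothesis hS : solves_sde P F B (fun x => c * x) s S.

Definition real_stopping_time (tau : Omega -> R) :=
  (forall w, 0 <= tau w) /\ (forall t, 0 <= t -> F t [set w | tau w <= t]).

(* The integrand [c S 1_{[0, tau[}] is frozen on a grid of [N.+1 * M.+1] steps, but the
   indicator only on the coarse grid of [N.+1] steps: letting [M] tend to infinity first makes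
   each coarse increment converge to an increment of [S], and only then does [N] approximate
   [tau].  The truncation at level [L] keeps all the sums square-integrable. *)
Definition stopped_coef (T L : R) (N M : nat) (tau : Omega -> R) (i : nat) (w : Omega) : R :=
  clamp L (c * S (i%:R * (T / (N.+1 * M.+1)%:R)) w) *
    \1_[set w | (i %/ M.+1)%:R * (T / N.+1%:R) < tau w] w.

Definition grid_increment (h : R) (i : nat) (w : Omega) : R := B (i.+1%:R * h) w - B (i%:R * h) w.

Definition stopped_sum (T L : R) (N M : nat) (tau : Omega -> R) : Omega -> R :=
  transform (grid_increment (T / (N.+1 * M.+1)%:R)) (stopped_coef T L N M tau) (N.+1 * M.+1).

Lemma stopping_time_measurable tau : real_stopping_time tau -> measurable_fun setT tau.
Proof.
move=> [tau0 Ftau]; apply: (measurability (@RGenOInfty.G R)) => [|/= _ [_] [r] -> <-].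
  exact: RGenOInfty.measurableE.
have [r0|r0] := leP 0 r.
  case: hF => _ Fm _; have := measurableC (Fm r r0 _ (Ftau r r0)).
  congr measurable; apply/seteqP; split => w /=; rewrite in_itv/= andbT ltNge.
    by move=> H; split => //; exact/negP.
  by move=> [_ /negP].
rewrite (_ : _ `&` _ = setT)//; apply/seteqP; split => w //= _; split=> //.
by rewrite in_itv/= andbT (lt_le_trans r0).
Qed.

Lemma measurable_stopped (tau : Omega -> R) : measurable_fun setT tau -> (forall w, 0 <= tau w) ->
  measurable_fun setT (fun w => S (tau w) w).
Proof.
move=> mtau tau0.
have J : measurable_fun setT (fun p : Omega * R => S (Num.max 0 p.2) p.1).
  apply: (@measurable_continuous_process _ _ _ (fun r w => S (Num.max 0 r) w)).
    by move=> r; apply: (sde_measurable hF hS); rewrite le_max lexx.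
  by move=> w; exact: (continuous_path_max (sde_paths_continuous hS)).
have := measurableT_comp J (measurable_fun_pair (@measurable_id _ _ setT) mtau).
by congr (measurable_fun _ _); apply/funext => w /=; rewrite (max_idPr _).
Qed.

Lemma ae_probability1 (A : set Omega) : measurable A -> P A = 1%E -> {ae P, forall w, A w}.
Proof.
move=> mA PA; exists (~` A); split; first exact: measurableC.
  by rewrite probability_setC// PA subee.
by [].
Qed.

Lemma sde_initial : {ae P, forall w, S 0 w = s}.
Proof.
apply: ae_probability1; last by case: hS.
rewrite -[X in measurable X]setTI.
exact: (sde_measurable hF hS (lexx 0) measurableT (measurable_set1 s)).
Qed.

Section core.
Variables (T K : R) (tau : Omega -> R).
Hypotheses (T0 : 0 < T) (K0 : 0 < K) (sK : `|s| <= K).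
Hypothesis tau_st : real_stopping_time tau.
Hypothesis tauT : forall w, tau w <= T.
Hypothesis bound_S : forall w r, 0 <= r < tau w -> `|S r w| <= K.

Let mtau : measurable_fun setT tau := stopping_time_measurable tau_st.
Let tau0 : forall w, 0 <= tau w := tau_st.1.

(** Counts the coarse grid points strictly before [tau w], as [lt_idx] shows; accordingly [tauN] is
    the first coarse grid point not before [tau w]. *)
Let idx N (w : Omega) : nat := `|Num.ceil (tau w * N.+1%:R / T)|%N.

Let lt_idx N w (j : nat) : (j < idx N w)%N = (j%:R * (T / N.+1%:R) < tau w).
Proof.
have c0 : 0 <= Num.ceil (tau w * N.+1%:R / T).
  by rewrite ceil_ge0 (@lt_le_trans _ _ 0)// !mulr_ge0// invr_ge0 ltW.
rewrite /idx -ltz_nat gez0_abs// ceil_gt_int.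
by rewrite ltr_pdivlMr// mulrA ltr_pdivrMr// natz.
Qed.

Let idx_le N w : (idx N w <= N.+1)%N.
Proof.
rewrite leqNgt lt_idx mulrC divfK ?pnatr_eq0//.
by rewrite -leNgt.
Qed.

Let tauN N (w : Omega) : R := (idx N w)%:R * (T / N.+1%:R).

Let tauN_bounds N w : tau w <= tauN N w < tau w + T / N.+1%:R.
Proof.
have TN : 0 < T / N.+1%:R by rewrite divr_gt0.
have := lt_idx N w (idx N w); rewrite ltnn => /esym/negbT; rewrite -leNgt => -> /=.
have := lt_idx N w (idx N w).-1; rewrite /tauN; case: (idx N w) => [|i]/=.
  by move=> _; rewrite mul0r ltr_wpDl.
by rewrite ltnSn => /esym H; rewrite -natr1 mulrDl mul1r ltrD2r.
Qed.

Let measurable_tauN N : measurable_fun setT (tauN N).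
Proof.
have -> : tauN N = (fun x : R => `|(Num.ceil (x * N.+1%:R / T))%:~R| * (T / N.+1%:R)) \o tau.
  by apply/funext => w; rewrite /tauN /idx /= -intr_norm -abszE.
apply: measurableT_comp => //; apply: measurable_funM => //.
apply: measurableT_comp => //.
apply: nondecreasing_measurable => // x y xy; rewrite ler_int; apply: le_ceil.
by rewrite ler_pM2r ?invr_gt0// ler_pM2r.
Qed.

Let h_gt0 N M : 0 < T / (N.+1 * M.+1)%:R.
Proof. by rewrite divr_gt0// ltr0n. Qed.

(** The coarse indicator keeps exactly the fine steps of the first [idx N w] coarse ones. A stopped
    sum is therefore the unstopped integral read at [tauN N w], a random time with finitely many
    possible values, and convergence at deterministic times applies to it. *)
Let stopped_sum_simple N M m w : stopped_sum T m%:R N M tau w =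
  simple_integral B (euler_process hF hS (h_gt0 N M) (N.+1 * M.+1) m) (tauN N w) w.
Proof.
have -> : tauN N w = (idx N w * M.+1)%:R * (T / (N.+1 * M.+1)%:R).
  have [a0 b0] : (N.+1%:R != 0 :> R) /\ (M.+1%:R != 0 :> R) by rewrite !pnatr_eq0.
  rewrite /tauN !natrM; move: (N.+1%:R : R) (M.+1%:R : R) a0 b0 => a b a0 b0.
  by field; rewrite a0 b0.
rewrite euler_process_integral; last by rewrite leq_mul2r idx_le orbT.
rewrite (big_ord_widen (N.+1 * M.+1) (fun i => euler_coef S c (T / (N.+1 * M.+1)%:R) m i w *
  (B (i.+1%:R * (T / (N.+1 * M.+1)%:R)) w - B (i%:R * (T / (N.+1 * M.+1)%:R)) w))); last first.
  by rewrite leq_mul2r idx_le orbT.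
rewrite [RHS]big_mkcond/=; apply: eq_bigr => i _.
rewrite /stopped_coef indicE -ltn_divLR// lt_idx.
case: ifPn => H; first by rewrite mem_set// mulr1.
by rewrite memNset ?mulr0 ?mul0r//=; exact/negP.
Qed.

Let simple_measurable N M m (t : R) : 0 <= t -> measurable_fun setT
  (simple_integral B (euler_process hF hS (h_gt0 N M) (N.+1 * M.+1) m) t).
Proof.
move=> t0; apply: measurable_sum => i; apply: measurable_funM.
  move=> _ A mA; rewrite setTI; have [_ Fm _] := hF.
  apply: (Fm (i%:R * (T / (N.+1 * M.+1)%:R))); first by rewrite mulr_ge0// ltW.
  by apply: (euler_coef_measurable hF hS) => //; exact: ltW.
have mB r : 0 <= r -> measurable_fun setT (B r).
  by move=> r0; apply: (adapted_measurable hF) => //; case: hB => -[].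
apply: measurable_funB; apply: mB; rewrite le_min t0/= mulr_ge0// ltW//.
Qed.

(** Off this event no truncation acts: the bound [K] valid before [tau] degrades to at most [K + 1]
    during one further coarse step. Rational multiples of [T] make the union countable and still
    include all grid times. *)
Let bad N : set Omega := \bigcup_(q in [set q : rat | 0 <= q <= 1])
  [set w | T * ratr q < tau w + T / N.+1%:R /\ K + 1 < `|S (T * ratr q) w|].

Let bad_measurable N : measurable (bad N).
Proof.
rewrite /bad bigcup_mkcond; apply: countable_bigcupT_measurable => // q.
case: ifPn => //; rewrite inE/= => /andP[q0 q1].
have TN : 0 < T / N.+1%:R by rewrite divr_gt0.
have q0' : 0 <= T * ratr q by rewrite mulr_ge0 ?ler0q// ltW.
apply: measurableI; first by apply: measurable_set_lt => //; exact: measurable_funD.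
apply: measurable_set_lt => //; apply: measurableT_comp => //.
exact: (sde_measurable hF hS).
Qed.

Let S0 : {ae P, forall w, S 0 w = s}.
Proof. exact: sde_initial. Qed.

(** A positive [tau] inherits the bound by continuity from the left. At [tau w = 0] nothing lies to
    the left and the initial value decides, which is why the bound is only almost sure. *)
Lemma stopped_ae_bounded : {ae P, forall w, `|S (tau w) w| <= K}.
Proof.
apply: filterS S0 => w S0w.
have [tw|tw] := ltP 0 (tau w); last by rewrite (_ : tau w = 0) ?S0w//; apply/le_anti; rewrite tw tau0.
rewrite leNgt; apply/negP => H.
have H0 : 0 < `|S (tau w) w| - K by rewrite subr_gt0.
have [dl dl0 Hdl] := continuous_path_dist (sde_paths_continuous hS) w (tau0 w) H0.
pose r := Num.max 0 (tau w - dl / 2).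
have r0 : 0 <= r by rewrite le_max lexx.
have rt : r < tau w by rewrite gt_max tw/= ltrBlDr ltrDl divr_gt0.
have := bound_S (r := r) (w := w); rewrite r0 rt => /(_ isT) SK.
have := Hdl r r0; rewrite gtr0_norm ?subr_gt0//.
have : tau w - r < dl by rewrite ltrBlDr -ltrBlDl lt_max; apply/orP; right; lra.
by move=> -> /(_ isT); have := lerB_dist (S (tau w) w) (S r w); lra.
Qed.

Let bad_eventually : {ae P, forall w, \forall N \near \oo, ~ bad N w}.
Proof.
apply: filterS stopped_ae_bounded => w Stau.
have [dl dl0 Hdl] := continuous_path_dist (sde_paths_continuous hS) w (tau0 w) ltr01.
have := cvg_divS T; move/cvgrPdist_lt => /(_ _ dl0); apply: filterS => N.
rewrite sub0r normrN gtr0_norm ?divr_gt0// => TN [q /= /andP[q0 q1] [qt]].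
have q0' : 0 <= T * ratr q by rewrite mulr_ge0 ?ler0q// ltW.
apply/negP; rewrite -leNgt; have [qtau|qtau] := ltP (T * ratr q) (tau w).
  by rewrite (le_trans (bound_S _))// ?q0'//; lra.
have := Hdl _ q0'; rewrite ler0_norm ?subr_le0// => H.
have {}H : `|S (tau w) w - S (T * ratr q) w| < 1.
  by apply: H; rewrite opprB ltrBlDl (lt_trans qt)// ltrD2l.
by have := lerB_dist (S (T * ratr q) w) (S (tau w) w); rewrite distrC; lra.
Qed.

Let stopped_sum_measurable N M L : measurable_fun setT (stopped_sum T L N M tau).
Proof.
have mB r : 0 <= r -> measurable_fun setT (B r).
  by move=> r0; apply: (adapted_measurable hF) => //; case: hB => -[].
apply: measurable_sum => i; apply: measurable_funM.
  apply: measurable_funM.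
    apply: measurableT_comp; first exact: measurable_clamp.
    apply: measurable_funM => //.
    by apply: (sde_measurable hF hS); rewrite mulr_ge0// ltW.
  apply: measurable_indic; exact: measurable_set_lt.
by apply: measurable_funB; apply: mB; rewrite mulr_ge0// ltW.
Qed.

Let simple_err N M (j : nat) (e : R) : set Omega := [set w | e <=
  `|simple_integral B (euler_process hF hS (h_gt0 N M) (N.+1 * M.+1) M) (j%:R * (T / N.+1%:R)) w
    - (S (j%:R * (T / N.+1%:R)) w - s)|].

Let measurable_simple_err N M j (e : R) : measurable (simple_err N M j e).
Proof.
have j0 : 0 <= j%:R * (T / N.+1%:R) by rewrite mulr_ge0// divr_ge0// ltW.
rewrite -[X in measurable X]setTI; apply: measurable_fun_le => //.
apply: measurableT_comp => //; apply: measurable_funB; first exact: simple_measurable.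
by apply: measurable_funB => //; exact: (sde_measurable hF hS).
Qed.

Let grid_err N (e : R) : set Omega := [set w | e <= `|S (tauN N w) w - S (tau w) w|].

Let measurable_grid_err N (e : R) : measurable (grid_err N e).
Proof.
rewrite -[X in measurable X]setTI; apply: measurable_fun_le => //.
apply: measurableT_comp => //; apply: measurable_funB; apply: measurable_stopped => //.
by move=> w; rewrite (le_trans (tau0 w))//; have /andP[] := tauN_bounds N w.
Qed.

Let grid_err_eventually (e : R) : 0 < e -> {ae P, forall w, \forall N \near \oo, ~ grid_err N e w}.
Proof.
move=> e0; apply: aeW => w.
have [dl dl0 Hdl] := continuous_path_dist (sde_paths_continuous hS) w (tau0 w) e0.
have := cvg_divS T; move/cvgrPdist_lt => /(_ _ dl0); apply: filterS => N.
rewrite sub0r normrN gtr0_norm ?divr_gt0// => TN.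
have /andP[t1 t2] := tauN_bounds N w.
apply/negP; rewrite -ltNge distrC; apply: Hdl; first exact: le_trans (tau0 w) t1.
by rewrite ler0_norm ?subr_le0// opprB ltrBlDl (lt_trans t2)// ltrD2l.
Qed.

(** The error is below [e] off three kinds of events: a visible truncation, a large move of [S]
    between [tau] and [tauN], and an error of the unstopped integral at one of the [N.+2] coarse
    times. The first two are small for large [N]; for fixed [N] the last are finitely many and small
    for large [M], whence the order of the quantifiers. *)
Lemma stopped_sum_converges (e : R) : 0 < e ->
  exists N0, forall N, (N0 <= N)%N -> exists M0, forall M, (M0 <= M)%N ->
  fine (P [set w | e <= `|stopped_sum T (`|c| * (K + 1)) N M tau w - (S (tau w) w - s)|]) <= e.
Proof.
move=> e0; have e2 : 0 < e / 2 by rewrite divr_gt0.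
have e3 : 0 < e / 3 by rewrite divr_gt0.
have /fine_cvgP[_ /cvgrPdist_lt/(_ _ e3) b1] := cvg_probability0 bad_measurable bad_eventually.
have /fine_cvgP[_ /cvgrPdist_lt/(_ _ e3) b2] :=
  cvg_probability0 (fun N => measurable_grid_err N (e / 2)) (grid_err_eventually e2).
have [N0 _ HN0] : \forall N \near \oo, fine (P (bad N)) < e / 3 /\ fine (P (grid_err N (e / 2))) < e / 3.
  apply: filterS2 b1 b2 => N; rewrite !sub0r !normrN => H1 H2.
  by split; apply: le_lt_trans (ler_norm _) _.
exists N0 => N /HN0[{}b1 {}b2].
have sumcvg : \sum_(j < N.+2) fine (P (simple_err N M j (e / 2))) @[M --> \oo] --> \sum_(j < N.+2) (0 : R).
  apply: cvg_big; first exact: add_continuous.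
  move=> j _.
  have jT : 0 <= j%:R * (T / N.+1%:R) <= T.
    rewrite mulr_ge0 ?divr_ge0 ?(ltW T0)//= mulrA ler_pdivrMr// mulrC ler_pM2l// ler_nat.
    by rewrite -ltnS.
  have n_gt0 k : (0 < N.+1 * k.+1)%N by [].
  have n_oo : (N.+1 * k.+1)%N @[k --> \oo] --> \oo.
    apply/cvgnyPge => A; near=> k; apply: (@leq_trans k.+1); last exact: leq_pmull.
    by apply: leqW; near: k; exact: nbhs_infty_ge.
  have := @euler_converges R d Omega P F B S c s hF hS T T0
    (fun M => N.+1 * M.+1)%N id n_gt0 n_oo (@cvg_id _ _) (j%:R * (T / N.+1%:R)) jT _ e2.
  by move/fine_cvgP => [_]; exact.
rewrite big1// in sumcvg.
have [M0 _ HM0] : \forall M \near \oo, \sum_(j < N.+2) fine (P (simple_err N M j (e / 2))) < e / 3.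
  move/cvgrPdist_lt : sumcvg => /(_ _ e3); apply: filterS => M.
  by rewrite sub0r normrN; apply: le_lt_trans; exact: ler_norm.
pose L := `|c| * (K + 1).
exists (maxn M0 (Num.truncn L).+1) => M; rewrite geq_max => /andP[/HM0 sumM LM].
have LM' : L <= M%:R by rewrite ltW// (lt_le_trans (truncnS_gt L))// ler_nat.
pose A (i : nat) : set Omega := if i is j.+2 then simple_err N M j (e / 2) else
  if i == 1%N then grid_err N (e / 2) else bad N.
have mA i : measurable (A i).
  case: i => [|[|i]] /=; [exact: bad_measurable|exact: measurable_grid_err|exact: measurable_simple_err].
set E := [set w | _].
have mE : measurable E.
  apply: measurable_set_le => //; apply: measurableT_comp => //; apply: measurable_funB => //.
  by apply: measurable_funB => //; exact: measurable_stopped.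
have EA : E `<=` \big[setU/set0]_(i < N.+4) A i.
  move=> w Ew; rewrite -bigcup_mkord; apply: contrapT => nA.
  have nAi i : (i < N.+4)%N -> ~ A i w by move=> iN Ai; apply: nA; exists i.
  have nbad : ~ bad N w by exact: (nAi 0).
  have ngrid : ~ grid_err N (e / 2) w by exact: (nAi 1%N).
  have := nAi (idx N w).+2 (idx_le N w); rewrite /= /simple_err /= => nsimple.
  move: Ew; rewrite /E /=; apply/negP; rewrite -ltNge.
  (* The simple process is truncated at the integer [M], the stopped sum at [L]. Off [bad N] both
     truncations are the identity on every step that the indicator keeps. *)
  have <- : stopped_sum T M%:R N M tau w = stopped_sum T L N M tau w.
    apply: eq_bigr => i _; congr (_ * _); rewrite /stopped_coef indicE.
    have [wi|] := boolP (w \in _); last by rewrite !mulr0.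
    congr (_ * _); rewrite inE/= in wi.
    have NM0 : (N.+1 * M.+1)%:R != 0 :> R by rewrite pnatr_eq0.
    have SL : `|c * S (i%:R * (T / (N.+1 * M.+1)%:R)) w| <= L.
      rewrite normrM; apply: ler_wpM2l => //.
      rewrite leNgt; apply/negP => H; apply: nbad.
      (* The fine time as a rational multiple of [T]: it is at most the next coarse point, hence
         less than one coarse step after [tau w]. *)
      exists (i%:Q / (N.+1 * M.+1)%:Q) => /=.
        rewrite divr_ge0 ?ler0n//= ler_pdivrMr ?ltr0n// mul1r ler_nat.
        exact: ltnW.
      rewrite fmorph_div/= !ratr_nat mulrCA; split => //.
      apply: le_lt_trans (_ : _ <= ((i %/ M.+1).+1)%:R * (T / N.+1%:R)) _; last first.
        by rewrite -natr1 mulrDl mul1r ltrD2r.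
      have -> : T / N.+1%:R = M.+1%:R * (T / (N.+1 * M.+1)%:R).
        have [a0 b0] : (N.+1%:R != 0 :> R) /\ (M.+1%:R != 0 :> R) by rewrite !pnatr_eq0.
        rewrite !natrM; move: (N.+1%:R : R) (M.+1%:R : R) a0 b0 => a b a0 b0.
        by field; rewrite a0 b0.
      rewrite [leRHS]mulrA -natrM; apply: ler_wpM2r; first by rewrite ltW.
      by rewrite ler_nat ltnW// ltn_ceil.
    by rewrite !clamp_id// (le_trans SL).
  move: nsimple ngrid => /negP; rewrite -ltNge -stopped_sum_simple => H1 /negP.
  rewrite -ltNge => H2.
  have -> : stopped_sum T M%:R N M tau w - (S (tau w) w - s) =
    (stopped_sum T M%:R N M tau w - (S (tauN N w) w - s)) + (S (tauN N w) w - S (tau w) w) by ring.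
  by rewrite (le_lt_trans (ler_normD _ _))//; move: H1 H2; rewrite /tauN; lra.
have := @content_subadditive _ _ _ P E A N.+4 (fun k _ => mA k) mE EA.
rewrite big_ord_recl big_ord_recl/=.
rewrite -[X in (X <= _)%E]fineK ?fin_num_measure//.
rewrite -[P (bad N)]fineK ?fin_num_measure// -[P (grid_err N _)]fineK ?fin_num_measure//.
under eq_bigr do rewrite -[P _]fineK ?fin_num_measure//.
rewrite sumEFin -!EFinD lee_fin => H; apply: le_trans H _.
by move: b1 b2 sumM; lra.
Unshelve. all: by end_near. Qed.

End core.
End stopped_euler.

(** * Exit times *)

Lemma rat_segment_dense (R : realType) (t r e : R) : 0 <= r <= t -> 0 < e ->
  exists2 q : rat, 0 <= q <= 1 & `|r - t * ratr q| < e.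
Proof.
move=> /andP[r0 rt] e0; have := le_trans r0 rt; rewrite le_eqVlt => /predU1P[t0|t0].
  by exists 0 => //; rewrite rmorph0 mulr0 subr0 (_ : r = 0) ?normr0//; apply/le_anti; rewrite r0 t0 rt.
have et : 0 < e / t by rewrite divr_gt0.
have rt1 : r / t <= 1 by rewrite ler_pdivrMr// mul1r.
have rt0 : 0 <= r / t by rewrite divr_ge0// ltW.
have : Num.max 0 (r / t - e / t) < Num.min 1 (r / t + e / t).
  by rewrite gt_max !lt_min; apply/andP; split; apply/andP; split; lra.
move=> /rat_in_itvoo[q]; rewrite in_itv/= gt_max lt_min => /andP[/andP[q0 q1] /andP[q2 q3]].
exists q.
  by apply/andP; split; [rewrite -(ler0q R) ltW|rewrite -(ler_rat R) rmorph1 ltW].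
rewrite ltr_norml; have -> : r - t * ratr q = t * (r / t - ratr q) by field; rewrite lt0r_neq0.
have et' : t * (e / t) = e by rewrite mulrC divfK ?lt0r_neq0.
by rewrite -et' -mulrN !ltr_pM2l//; apply/andP; split; lra.
Qed.

Section exit_times.
Context (R : realType) d (Omega : measurableType d).
Variables (F : R -> set (set Omega)) (S : R -> Omega -> R).
Hypothesis hF : filtration F.
Hypothesis aS : adapted F S.
Hypothesis cS : continuous_paths S.

(** The infimum is attained: a continuous path that is inside the open interval up to and including
    [t] remains inside for some further time, which pushes the infimum beyond [t]. *)
Lemma exit_time_leP (a b t : R) (w : Omega) : a < b -> 0 <= t ->
  (exit_time S a b w <= t%:E)%E <-> exists r, 0 <= r <= t /\ ~ (a < S r w < b).
Proof.
move=> ab t0; rewrite /exit_time ab; split; last first.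
  move=> [r [/andP[r0 rt] Sr]]; apply: (@le_trans _ _ r%:E); last by rewrite lee_fin.
  by apply: ereal_inf_lbound; exists r.
move=> H; apply: contrapT => nex.
have inside r : 0 <= r -> r <= t -> a < S r w < b.
  by move=> r0 rt; apply: contrapT => Sr; apply: nex; exists r; rewrite r0.
have /andP[at_ tb] := inside t t0 (lexx t).
have e0 : 0 < Num.min (S t w - a) (b - S t w) by rewrite lt_min !subr_gt0 at_.
have [dl dl0 Hdl] := continuous_path_dist cS w t0 e0.
have : ((t + dl)%:E <= exit_time S a b w)%E.
  rewrite /exit_time ab; apply: le_ereal_inf_tmp => _ [r [r0 Sr] <-]; rewrite lee_fin leNgt.
  apply/negP => rt; apply: Sr; have [|tr] := leP r t; first exact: inside.
  have := Hdl r r0; rewrite ltr0_norm ?subr_lt0// opprB ltrBlDl => /(_ rt).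
  by rewrite lt_min => /andP[]; rewrite !ltr_norml => /andP[_ H1] /andP[H2 _]; apply/andP; split; lra.
rewrite /exit_time ab => H'; have := le_trans H' H; rewrite lee_fin; lra.
Qed.

Lemma exit_time_ge0 (a b : R) (w : Omega) : (0 <= exit_time S a b w)%E.
Proof.
rewrite /exit_time; case: ifP => // _.
by apply: le_ereal_inf_tmp => _ [r [r0 _] <-]; rewrite lee_fin.
Qed.

Let measF (t : R) (t0 : 0 <= t) (A : set (g_sigma_algebraType (F t))) : measurable A -> F t A.
Proof. by have [sF _ _] := hF; rewrite /measurable/= sigma_algebra_id//; exact: sF. Qed.

(** On the compact [[0, t]] the path attains its extrema, so staying inside the open interval means
    keeping some distance [1 / k.+1] from both ends. That closed condition can be tested at the
    countably many times [t * q], all of which are at most [t]. *)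
Lemma hitting_set_measurable (a b t : R) : 0 <= t ->
  F t [set w | exists r, 0 <= r <= t /\ ~ (a < S r w < b)].
Proof.
move=> t0; apply: measF => //.
have [sF _ Fmono] := hF.
have inside : [set w | exists r, 0 <= r <= t /\ ~ (a < S r w < b)] =
   ~` \bigcup_(k : nat) \bigcap_(q : rat)
     [set w | 0 <= q <= 1 -> a + k.+1%:R^-1 <= S (t * ratr q) w <= b - k.+1%:R^-1 ].
  apply/seteqP; split => w /=.
    move=> [r [/andP[r0 rt] Sr]] [k _ Hk]; apply: Sr.
    have k0 : 0 < k.+1%:R^-1 :> R by rewrite invr_gt0.
    have {k0} [e [e0 Hk']] : exists e : R, 0 < e /\
        forall q : rat, 0 <= q <= 1 -> a + e <= S (t * ratr q) w <= b - e.
      by exists k.+1%:R^-1; split => // q q01; exact: Hk.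
    have [dl dl0 Hdl] := continuous_path_dist cS w r0 e0.
    have r0t : 0 <= r <= t by rewrite r0.
    have [q q01 /Hdl Hq] := rat_segment_dense r0t dl0.
    have /andP[H1 H2] := Hk' q q01.
    have := Hq; rewrite mulr_ge0 ?ler0q//; last by case/andP: q01.
    by move=> /(_ isT); rewrite ltr_norml => /andP[H3 H4]; apply/andP; split; lra.
  move=> H; apply: contrapT => nex; apply: H.
  have ins r : 0 <= r <= t -> a < S r w < b by move=> r0t; apply: contrapT => Sr; apply: nex; exists r.
  have cN : {within `[0, t], continuous (fun r : R => S (Num.max 0 r) w)}.
    by apply: continuous_subspaceT; exact: continuous_path_max.
  have [c1 c1t H1] := EVT_min t0 cN; have [c2 c2t H2] := EVT_max t0 cN.
  rewrite !in_itv/= in c1t c2t; have /andP[c10 _] := c1t; have /andP[c20 _] := c2t.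
  rewrite (max_idPr c10) in H1; rewrite (max_idPr c20) in H2.
  have /andP[ac _] := ins _ c1t; have /andP[_ cb] := ins _ c2t.
  have e0 : 0 < Num.min (S c1 w - a) (b - S c2 w) by rewrite lt_min !subr_gt0 ac.
  have [k] := ltr_add_invr e0; rewrite add0r lt_min => /andP[k1 k2]; exists k => // q _ /= /andP[q0 q1].
  have tq0 : 0 <= t * ratr q by rewrite mulr_ge0 ?ler0q.
  have tqt : t * ratr q \in `[0, t].
    by rewrite in_itv/= tq0/= ler_piMr// -(rmorph1 (@ratr R)) ler_rat.
  have := H1 _ tqt; have := H2 _ tqt; rewrite (max_idPr tq0).
  by move: k1 k2; move: (k.+1%:R^-1 : R) => e k1 k2 H3 H4; apply/andP; split; lra.
rewrite inside; apply: measurableC; apply: bigcupT_measurable => k.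
rewrite -[X in measurable X]setCK setC_bigcap; apply: measurableC.
apply: countable_bigcupT_measurable => // q; apply: measurableC.
have [q01|q01] := boolP (0 <= q <= 1); last first.
  by rewrite (_ : [set w | _] = setT)//; apply/seteqP; split.
have /andP[q0 q1] := q01.
have tq0 : 0 <= t * ratr q by rewrite mulr_ge0 ?ler0q.
have tqt : t * ratr q <= t by rewrite ler_piMr// -(rmorph1 (@ratr R)) ler_rat.
rewrite (_ : [set w | _] = S (t * ratr q) @^-1` `[a + k.+1%:R^-1, b - k.+1%:R^-1]); last first.
  by apply/seteqP; split => w /=; rewrite in_itv/= => H; [apply: H|].
rewrite /measurable/= sigma_algebra_id; last exact: sF.
by apply: (Fmono _ _ tq0 tqt); apply: aS.
Qed.

Lemma exit_time_stopping (a b : R) : stopping_time F (exit_time S a b).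
Proof.
split; first exact: exit_time_ge0.
move=> t t0; have [ab|ba] := ltP a b.
  have := hitting_set_measurable a b t0; congr (F t _).
  by apply/seteqP; split => w /=; rewrite exit_time_leP.
rewrite (_ : [set w | _] = setT).
  by apply: measF => //; exact: measurableT.
apply/seteqP; split => w //= _; rewrite /exit_time; case: ifPn; first by rewrite ltNge ba.
by rewrite lee_fin.
Qed.

Definition capped (tau : Omega -> \bar R) (T : R) (w : Omega) : R := fine (Order.min (tau w) T%:E).

Section capped.
Variables (tau : Omega -> \bar R).
Hypothesis st : stopping_time F tau.

Lemma cappedE (T : R) (w : Omega) : 0 <= T -> (capped tau T w)%:E = Order.min (tau w) T%:E.
Proof.
move=> T0; rewrite /capped; have := st.1 w; case: (tau w) => [r||]//=.
  by move=> r0; rewrite -EFin_min.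
Qed.

Lemma capped_ge0 (T : R) w : 0 <= T -> 0 <= capped tau T w.
Proof. by move=> T0; rewrite -lee_fin cappedE// le_min st.1 lee_fin. Qed.

Lemma capped_le (T : R) w : 0 <= T -> capped tau T w <= T.
Proof. by move=> T0; rewrite -lee_fin cappedE// ge_min lexx orbT. Qed.

Lemma le_capped (T r : R) w : 0 <= T -> (capped tau T w <= r) = (tau w <= r%:E)%E || (T <= r).
Proof. by move=> T0; rewrite -lee_fin cappedE// ge_min lee_fin. Qed.

Lemma capped_stopping (T : R) : 0 <= T -> real_stopping_time F (capped tau T).
Proof.
move=> T0; split; first by move=> w; exact: capped_ge0.
move=> t t0; have [Tt|tT] := leP T t.
  rewrite (_ : [set w | _] = setT); first by apply: measF => //; exact: measurableT.
  by apply/seteqP; split => w //= _; exact: le_trans (capped_le _ _) Tt.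
have := st.2 t t0; congr (F t _); apply/seteqP; split => w /=; rewrite le_capped//.
  by move=> ->.
by rewrite (leNgt T) tT orbF.
Qed.

Lemma lt_capped (T r : R) w : 0 <= T -> (r < capped tau T w) = (r%:E < tau w)%E && (r < T).
Proof. by move=> T0; rewrite -lte_fin cappedE// lt_min lte_fin. Qed.

Lemma capped_lt (T : R) w : 0 <= T -> capped tau T w < T -> tau w = (capped tau T w)%:E.
Proof.
move=> T0; rewrite -lte_fin cappedE// => H; apply/esym/min_idPl; rewrite leNgt; apply/negP => Tt.
by move: H; rewrite (min_idPr (ltW Tt)) ltxx.
Qed.

Lemma capped_min (T t : R) w : 0 <= t -> t <= T -> capped tau t w = Num.min (capped tau T w) t.
Proof.
move=> t0 tT; have T0 : 0 <= T by exact: le_trans tT.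
apply/EFin_inj; rewrite EFin_min !cappedE// -minA; congr (Order.min _ _).
by rewrite -EFin_min (min_idPr tT).
Qed.

End capped.

Section capped_exit.
Variables (a b T : R).
Hypotheses (ab : a < b) (T0 : 0 <= T).
Let X := capped (exit_time S a b) T.
Let st := exit_time_stopping a b.

Lemma before_capped_exit w r : 0 <= r -> r < X w -> a < S r w < b.
Proof.
move=> r0; rewrite lt_capped// => /andP[+ _]; rewrite ltNge => /negP H.
by apply: contrapT => Sr; apply/H/(exit_time_leP _ ab r0); exists r; rewrite r0 lexx.
Qed.

Lemma at_capped_exit w : X w < T -> ~ (a < S (X w) w < b).
Proof.
move=> XT; have X0 : 0 <= X w by exact: capped_ge0.
have : (exit_time S a b w <= (X w)%:E)%E by rewrite (capped_lt st T0 XT).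
move/(exit_time_leP _ ab X0) => [r [/andP[r0]]]; rewrite le_eqVlt => /predU1P[->//|rX].
by move=> nr; have := before_capped_exit r0 rX.
Qed.

(** At a positive capped time the value is a limit of values taken strictly before it, which lie in
    the open interval. *)
Lemma capped_exit_between w : a <= S 0 w <= b -> a <= S (X w) w <= b.
Proof.
move=> S0; have X0 : 0 <= X w by exact: capped_ge0.
have [XE|Xpos] := eqVneq (X w) 0; first by rewrite XE.
have {}Xpos : 0 < X w by rewrite lt_neqAle eq_sym Xpos.
apply: contrapT => out.
have [e e0 He] : exists2 e : R, 0 < e & forall y, `|S (X w) w - y| < e -> ~ (a < y < b).
  have [Sa|Sa] := ltP (S (X w) w) a.
    exists (a - S (X w) w); first by rewrite subr_gt0.
    by move=> y; rewrite ltr_norml => /andP[H1 H2] /andP[H3 H4]; lra.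
  have Sb : b < S (X w) w by rewrite ltNge; apply/negP => Sb; apply: out; rewrite Sa.
  exists (S (X w) w - b); first by rewrite subr_gt0.
  by move=> y; rewrite ltr_norml => /andP[H1 H2] /andP[H3 H4]; lra.
have [dl dl0 Hdl] := continuous_path_dist cS w X0 e0.
pose r := Num.max 0 (X w - dl / 2).
have r0 : 0 <= r by rewrite le_max lexx.
have rX : r < X w by rewrite gt_max Xpos/= ltrBlDr ltrDl divr_gt0.
apply: (He (S r w)); last exact: before_capped_exit.
apply: Hdl => //; rewrite gtr0_norm ?subr_gt0//.
by rewrite ltrBlDr -ltrBlDl lt_max; apply/orP; right; lra.
Qed.

Lemma capped_exit_hit w : a <= S 0 w <= b -> X w < T -> S (X w) w = a \/ S (X w) w = b.
Proof.
move=> /capped_exit_between/andP[aX Xb] /at_capped_exit.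
move: aX Xb; rewrite !le_eqVlt => /predU1P[->|aX]; first by left.
by move=> /predU1P[->|Xb]; [right|rewrite aX Xb].
Qed.

End capped_exit.

Lemma capped_exit_le (a b a' b' T : R) w : a < b -> a' < b' -> a <= a' -> b' <= b -> 0 <= T ->
  capped (exit_time S a' b') T w <= capped (exit_time S a b) T w.
Proof.
move=> ab a'b' aa' b'b T0; rewrite leNgt; apply/negP => H.
have X0 : 0 <= capped (exit_time S a b) T w by apply: capped_ge0 => //; exact: exit_time_stopping.
have XT : capped (exit_time S a b) T w < T.
  by apply: lt_le_trans H _; apply: capped_le => //; exact: exit_time_stopping.
apply: (at_capped_exit ab T0 XT).
have /andP[H1 H2] := before_capped_exit a'b' T0 X0 H.
by apply/andP; split; [exact: le_lt_trans aa' H1|exact: lt_le_trans H2 b'b].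
Qed.

Lemma real_stopping_min (s1 s2 : Omega -> R) : real_stopping_time F s1 -> real_stopping_time F s2 ->
  real_stopping_time F (fun w => Num.min (s1 w) (s2 w)).
Proof.
move=> [p1 m1] [p2 m2]; split; first by move=> w; rewrite le_min p1 p2.
move=> t t0; have [sF _ _] := hF; have sFt := sF t t0.
have GE : @measurable _ (g_sigma_algebraType (F t)) = F t by exact: sigma_algebra_id.
rewrite (_ : [set w | _] = [set w | s1 w <= t] `|` [set w | s2 w <= t]); last first.
  by apply/seteqP; split => w /=; rewrite ge_min => /orP.
have := m1 t t0; have := m2 t t0; rewrite -GE => h2 h1; exact: measurableU.
Qed.

End exit_times.

(** * Isometry for stopped sums and positivity *)

Section martingale.
Context (R : realType) d (Omega : measurableType d) (P : probability Omega R).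
Variables (F : R -> set (set Omega)) (B S : R -> Omega -> R) (c s : R).
Hypothesis hF : filtration F.
Hypothesis hB : brownian_motion P F B.
Hypothesis hS : solves_sde P F B (fun x => c * x) s S.
Hypothesis s0 : 0 < s.

Let aS : adapted F S. Proof. by case: hS. Qed.
Let cS : continuous_paths S. Proof. by case: hS. Qed.

Lemma square_integrable_ae_bounded (X : Omega -> R) (M : R) : measurable_fun setT X ->
  {ae P, forall w, `|X w| <= M} -> square_integrable P X.
Proof.
move=> mX bX; split => //; apply/integrableP; split.
  by apply/measurable_EFinP; exact: measurable_funX.
rewrite (@le_lt_trans _ _ (\int[P]_w (M ^+ 2)%:E)%E)//.
  apply: ae_ge0_le_integral => //.
  - by do 2 apply: measurableT_comp => //; exact: measurable_funX.
  - by move=> w _; rewrite lee_fin sqr_ge0.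
  - apply: filterS bX => w Xw _; rewrite /= lee_fin ger0_norm ?sqr_ge0//.
    by rewrite -(real_normK (num_real (X w))) ler_sqr ?nnegrE// (le_trans _ Xw).
by rewrite integral_cst//= probability_setT mule1 ltry.
Qed.

Lemma Rintegral_sqr_ae_le (X : Omega -> R) (M : R) : measurable_fun setT X ->
  {ae P, forall w, `|X w| <= M} -> (\int[P]_w (X w ^+ 2))%R <= M ^+ 2.
Proof.
move=> mX bX; have [_ iX] := square_integrable_ae_bounded mX bX.
rewrite -lee_fin /Rintegral fineK; last exact: integrable_fin_num.
rewrite (@le_trans _ _ (\int[P]_w (M ^+ 2)%:E)%E)//.
  apply: ae_ge0_le_integral => //.
  - by move=> w _; rewrite lee_fin sqr_ge0.
  - by apply/measurable_EFinP; exact: measurable_funX.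
  - by move=> w _; rewrite lee_fin sqr_ge0.
  - apply: filterS bX => w Xw _; rewrite /= lee_fin.
    by rewrite -(real_normK (num_real (X w))) ler_sqr ?nnegrE// (le_trans _ Xw).
by rewrite integral_cst//= probability_setT mule1.
Qed.

Section grid.
Variables (T : R) (T0 : 0 < T) (N M : nat).
Let n := (N.+1 * M.+1)%N.
Let h : R := T / n%:R.
Let h0 : 0 < h. Proof. by rewrite divr_gt0// ltr0n. Qed.
Let G (i : nat) := F (i%:R * h).
Let ih0 i : 0 <= i%:R * h. Proof. by rewrite mulr_ge0// ltW. Qed.
Let ihS i : i%:R * h < i.+1%:R * h. Proof. by rewrite ltr_pM2r// ltr_nat. Qed.

Let sG i : sigma_algebra setT (G i). Proof. by case: hF => H _ _; exact: H. Qed.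
Let G_meas i : G i `<=` measurable. Proof. by case: hF => _ H _; exact: H. Qed.
Let G_mono i : G i `<=` G i.+1.
Proof. by case: hF => _ _ H; apply: H => //; exact: ltW. Qed.

Let D := grid_increment B h.

Let D_sq i : square_integrable P (D i).
Proof. exact: (brownian_increment_square_integrable hF hB (ih0 i) (ihS i)). Qed.

Let mD i : measurable_wrt (G i.+1) (D i).
Proof. exact: (brownian_increment_measurable hF hB (ih0 i) (ihS i)). Qed.

Let D_mean i : (\int[P]_w (D i w))%R = 0.
Proof. exact: (brownian_increment_mean hF hB (ih0 i) (ihS i)). Qed.

Let D_var i : (\int[P]_w (D i w ^+ 2))%R = h.
Proof.
rewrite /D /grid_increment (brownian_increment_variance hF hB (ih0 i) (ihS i)).
by rewrite -natr1; ring.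
Qed.

Let D_indep i (E : set Omega) (A : set R) : G i E -> measurable A ->
  P (E `&` (D i @^-1` A)) = (P E * P (D i @^-1` A))%E.
Proof. exact: (brownian_increment_indep hB (ih0 i) (ihS i)). Qed.

Lemma grid_isometry xi eta : predictable_bounded G xi -> predictable_bounded G eta ->
  (\int[P]_w (transform D xi n w * transform D eta n w))%R =
  \sum_(i < n) (\int[P]_w (xi i w * eta i w))%R * h.
Proof. exact: (transform_isometry sG G_meas G_mono mD D_sq D_mean D_var D_indep). Qed.

Lemma grid_transform_mean xi : predictable_bounded G xi -> (\int[P]_w (transform D xi n w))%R = 0.
Proof. exact: (transform_mean G_meas D_sq D_mean D_indep). Qed.

Lemma grid_transform_square_integrable xi : predictable_bounded G xi ->
  square_integrable P (transform D xi n).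
Proof. exact: (transform_square_integrable G_meas D_sq). Qed.

Lemma stopped_coef_predictable (L : R) tau : 0 <= L -> real_stopping_time F tau ->
  predictable_bounded G (stopped_coef S c T L N M tau).
Proof.
move=> L0 [tau0 tauF] i; split; last first.
  exists L => w; rewrite /stopped_coef normrM indicE; case: (_ \in _).
    by rewrite normr1 mulr1 normr_clamp.
  by rewrite normr0 mulr0.
apply: measurable_wrtM => //.
  apply: (measurable_wrt_comp (sG i) (f := fun x => clamp L (c * x))).
    by apply: measurableT_comp; [exact: measurable_clamp|exact: mulrl_measurable].
  exact: aS.
apply: measurable_wrt_indic => //.
set r := (_ %/ _)%:R * _.
have r0 : 0 <= r by rewrite mulr_ge0// divr_ge0// ltW.
have rih : r <= i%:R * h by exact: coarse_time_le.
have [_ _ Fmono] := hF; have H := Fmono _ _ r0 rih _ (tauF r r0).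
have [_ sC _] := sG i; have := sC _ H; rewrite setTD; congr (G i _).
by apply/seteqP; split => w /=; rewrite ltNge => /negP.
Qed.

Lemma stopped_sum_square_integrable (L : R) tau : 0 <= L -> real_stopping_time F tau ->
  square_integrable P (stopped_sum B S c T L N M tau).
Proof.
by move=> L0 st; apply: grid_transform_square_integrable; exact: stopped_coef_predictable.
Qed.

Lemma stopped_sum_mean (L : R) tau : 0 <= L -> real_stopping_time F tau ->
  (\int[P]_w (stopped_sum B S c T L N M tau w))%R = 0.
Proof. by move=> L0 st; apply: grid_transform_mean; exact: stopped_coef_predictable. Qed.

Lemma stopped_coef_sub_predictable (L : R) tau1 tau2 : 0 <= L ->
  real_stopping_time F tau1 -> real_stopping_time F tau2 ->
  predictable_bounded G (fun i w => stopped_coef S c T L N M tau1 i w - stopped_coef S c T L N M tau2 i w).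
Proof.
move=> L0 st1 st2 i.
have [m1 [K1 b1]] := stopped_coef_predictable L0 st1 i.
have [m2 [K2 b2]] := stopped_coef_predictable L0 st2 i.
split; last by exists (K1 + K2) => w; rewrite (le_trans (ler_normB _ _))// lerD.
apply: measurable_wrtD => //.
exact: (measurable_wrt_comp (sG i) (f := fun x => - x) (@oppr_measurable _ _)).
Qed.

Lemma stopped_sum_sub_second_moment (L : R) tau1 tau2 : 0 <= L ->
  real_stopping_time F tau1 -> real_stopping_time F tau2 ->
  (\int[P]_w ((stopped_sum B S c T L N M tau1 w - stopped_sum B S c T L N M tau2 w) ^+ 2))%R =
  \sum_(i < n) (\int[P]_w ((stopped_coef S c T L N M tau1 i w - stopped_coef S c T L N M tau2 i w) ^+ 2))%R * h.
Proof.
move=> L0 st1 st2; have pc := stopped_coef_sub_predictable L0 st1 st2.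
transitivity (\int[P]_w (transform D (fun i w => stopped_coef S c T L N M tau1 i w - stopped_coef S c T L N M tau2 i w) n w ^+ 2))%R; last first.
  under eq_Rintegral do rewrite expr2.
  by rewrite (grid_isometry pc pc); apply: eq_bigr => i _; congr (_ * _); apply: eq_Rintegral => w _; rewrite expr2.
apply: eq_Rintegral => w _; congr (_ ^+ 2).
by rewrite /stopped_sum /transform -sumrB; apply: eq_bigr => i _; rewrite mulrBl.
Qed.

(** The bound is free of [N] and [M]; it is the uniform L^2 bound under which convergence in
    probability becomes weak convergence. *)
Lemma stopped_sum_second_moment (L : R) tau : 0 <= L -> real_stopping_time F tau ->
  (\int[P]_w (stopped_sum B S c T L N M tau w ^+ 2))%R <= L ^+ 2 * T.
Proof.
move=> L0 st; have pc := stopped_coef_predictable L0 st.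
under eq_Rintegral do rewrite expr2; rewrite grid_isometry//.
have -> : L ^+ 2 * T = \sum_(i < n) L ^+ 2 * h.
  rewrite sumr_const card_ord -mulr_natl /h; field; by rewrite pnatr_eq0.
apply: ler_sum => i _; apply: ler_wpM2r; first exact: ltW.
have [mx [K bK]] := pc i.
under eq_Rintegral do rewrite -expr2; apply: Rintegral_sqr_ae_le.
  by move=> _ A mA; rewrite setTI; apply: (@G_meas i); exact: mx.
apply: aeW => w; rewrite /stopped_coef normrM indicE; case: (_ \in _).
  by rewrite normr1 mulr1 normr_clamp.
by rewrite normr0 mulr0.
Qed.

End grid.

Section bounded_stopping.
Variables (T K : R) (tau : Omega -> R).
Hypotheses (T0 : 0 < T) (K0 : 0 < K) (sK : `|s| <= K).
Hypothesis tau_st : real_stopping_time F tau.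
Hypothesis tauT : forall w, tau w <= T.
Hypothesis bound_S : forall w r, 0 <= r < tau w -> `|S r w| <= K.

Let L := `|c| * (K + 1).
Let L0 : 0 <= L. Proof. by rewrite mulr_ge0// addr_ge0// ltW. Qed.

Let X (w : Omega) : R := S (tau w) w - s.

Lemma stopped_increment_measurable : measurable_fun setT X.
Proof.
apply: measurable_funB => //; apply: (measurable_stopped hF hS); last by case: tau_st.
exact: stopping_time_measurable tau_st.
Qed.

Lemma stopped_increment_bounded : {ae P, forall w, `|X w| <= K + `|s|}.
Proof.
apply: filterS (stopped_ae_bounded hF hS sK tau_st bound_S) => w Sw.
by rewrite (le_trans (ler_normB _ _))// lerD2r.
Qed.

Lemma stopped_increment_square_integrable : square_integrable P X.
Proof.
exact: square_integrable_ae_bounded stopped_increment_measurable stopped_increment_bounded.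
Qed.

Lemma stopped_sum_weak_limit (Z : Omega -> R) (eta : R) : square_integrable P Z -> 0 < eta ->
  exists N0, forall N, (N0 <= N)%N -> exists M0, forall M, (M0 <= M)%N ->
  `|(\int[P]_w (stopped_sum B S c T L N M tau w * Z w))%R - (\int[P]_w (X w * Z w))%R| <= eta.
Proof.
move=> sZ eta0; have sX := stopped_increment_square_integrable.
(* From [(y - x) ^+ 2 <= 2 * y ^+ 2 + 2 * x ^+ 2], with the isometry bound for the sum and the
   almost sure bound for its limit. *)
pose C := 2 * (L ^+ 2 * T) + 2 * (K + `|s|) ^+ 2.
have C0 : 0 <= C by rewrite addr_ge0// mulr_ge0// ?sqr_ge0// mulr_ge0 ?sqr_ge0// ltW.
have [dl dl0 H] := weak_convergence sX sZ C0 eta0.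
have [N0 HN] := stopped_sum_converges hF hB hS T0 sK tau_st tauT bound_S dl0.
exists N0 => N /HN[M0 HM]; exists M0 => M /HM PM; apply: H => //.
  exact: stopped_sum_square_integrable.
have sY := @stopped_sum_square_integrable T T0 N M L tau L0 tau_st.
have sYX := square_integrableB sY sX.
have i1 : P.-integrable setT (EFin \o (fun w => 2 * stopped_sum B S c T L N M tau w ^+ 2)).
  exact: (integrableZl _ _ sY.2).
have i2 : P.-integrable setT (EFin \o (fun w => 2 * X w ^+ 2)).
  exact: (integrableZl _ _ sX.2).
apply: (@le_trans _ _ (\int[P]_w (2 * stopped_sum B S c T L N M tau w ^+ 2 + 2 * X w ^+ 2))%R).
  apply: le_Rintegral => //; [exact: sYX.2|exact: (integrableD measurableT i1 i2)|].
  move=> w _; rewrite -subr_ge0.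
  set y := stopped_sum _ _ _ _ _ _ _ _ _; set x := X w.
  have -> : 2 * y ^+ 2 + 2 * x ^+ 2 - (y - x) ^+ 2 = (y + x) ^+ 2 by ring.
  by rewrite sqr_ge0.
rewrite RintegralD// !RintegralZl//; [|exact: sX.2|exact: sY.2].
rewrite /C lerD//; apply: ler_wpM2l => //; first exact: stopped_sum_second_moment.
exact: Rintegral_sqr_ae_le stopped_increment_measurable stopped_increment_bounded.
Qed.

(** The weak limit tested against the constant [1]: every stopped sum has mean zero. *)
Lemma stopped_mean : (\int[P]_w (S (tau w) w))%R = s.
Proof.
have sX := stopped_increment_square_integrable.
suff : (\int[P]_w X w)%R = 0.
  have iX := square_integrable_integrable sX.
  have -> : (\int[P]_w (S (tau w) w))%R = (\int[P]_w (X w + s))%R.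
    by apply: eq_Rintegral => w _; rewrite /X subrK.
  rewrite RintegralD//; last exact: finite_measure_integrable_cst.
  by move=> ->; rewrite Rintegral_cst//= probability_setT add0r mulr1.
apply/eqP; rewrite -normr_le0; apply/ler_addgt0Pl => eta eta0; rewrite addr0.
have [N0 /(_ N0 (leqnn _))[M0 /(_ M0 (leqnn _))]] :=
  stopped_sum_weak_limit (square_integrable_cst P 1) eta0.
under eq_Rintegral do rewrite mulr1; under [X in _ - X]eq_Rintegral do rewrite mulr1.
by rewrite stopped_sum_mean// sub0r normrN.
Qed.

End bounded_stopping.
(** Weak lower semicontinuity of the L^2 norm. With [Z] the difference of the limits and [J1 - J2]
    that of the sums, testing against [Z] itself gives, up to [eta / 2], that the mean of [Z ^+ 2]
    is at most the mean of [(J1 - J2) * Z], hence at most half the sum of the two second moments;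
    half the mean of [Z ^+ 2] is then absorbed. *)
Lemma stopped_difference_second_moment (T K Q : R) (tau1 tau2 : Omega -> R) :
  0 < T -> 0 < K -> `|s| <= K ->
  real_stopping_time F tau1 -> (forall w, tau1 w <= T) ->
  (forall w r, 0 <= r < tau1 w -> `|S r w| <= K) ->
  real_stopping_time F tau2 -> (forall w, tau2 w <= T) ->
  (forall w r, 0 <= r < tau2 w -> `|S r w| <= K) ->
  (forall N M, \sum_(i < N.+1 * M.+1)
     (\int[P]_w ((stopped_coef S c T (`|c| * (K + 1)) N M tau1 i w -
                  stopped_coef S c T (`|c| * (K + 1)) N M tau2 i w) ^+ 2))%R *
      (T / (N.+1 * M.+1)%:R) <= Q) ->
  (\int[P]_w ((S (tau1 w) w - S (tau2 w) w) ^+ 2))%R <= Q.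
Proof.
move=> T0 K0 sK st1 le1 b1 st2 le2 b2 HQ.
have s1 := stopped_increment_square_integrable sK st1 b1.
have s2 := stopped_increment_square_integrable sK st2 b2.
have sZ := square_integrableB s1 s2.
set Z := fun w => _ in sZ.
have ZE w : Z w = S (tau1 w) w - S (tau2 w) w by rewrite /Z; ring.
under eq_Rintegral do rewrite -ZE.
apply/ler_addgt0Pl => eta eta0.
have e4 : 0 < eta / 4 by rewrite divr_gt0.
have [N1 H1] := stopped_sum_weak_limit T0 K0 sK st1 le1 b1 sZ e4.
have [N2 H2] := stopped_sum_weak_limit T0 K0 sK st2 le2 b2 sZ e4.
have [M1 {}H1] := H1 _ (leq_maxl N1 N2); have [M2 {}H2] := H2 _ (leq_maxr N1 N2).
have {}H1 := H1 _ (leq_maxl M1 M2); have {}H2 := H2 _ (leq_maxr M1 M2).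
move: H1 H2 (HQ (maxn N1 N2) (maxn M1 M2)).
set N := maxn N1 N2; set M := maxn M1 M2; set L := `|c| * (K + 1).
have L0 : 0 <= L by rewrite mulr_ge0// addr_ge0// ltW.
rewrite -stopped_sum_sub_second_moment//.
have sJ1 : square_integrable P (stopped_sum B S c T L N M tau1) by exact: stopped_sum_square_integrable.
have sJ2 : square_integrable P (stopped_sum B S c T L N M tau2) by exact: stopped_sum_square_integrable.
set J1 := stopped_sum B S c T L N M tau1 in sJ1 *.
set J2 := stopped_sum B S c T L N M tau2 in sJ2 *.
have sJ := square_integrableB sJ1 sJ2.
move=> H1 H2 H3.
have i1 := square_integrable_mul sJ1 sZ; have i2 := square_integrable_mul sJ2 sZ.
have k1 := square_integrable_mul s1 sZ; have k2 := square_integrable_mul s2 sZ.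
have ZZ : (\int[P]_w (Z w ^+ 2))%R = (\int[P]_w ((S (tau1 w) w - s) * Z w))%R -
    (\int[P]_w ((S (tau2 w) w - s) * Z w))%R.
  rewrite -RintegralB//; apply: eq_Rintegral => w _.
  by rewrite -mulrBl -/(Z w) expr2.
have JZ : (\int[P]_w (J1 w * Z w))%R - (\int[P]_w (J2 w * Z w))%R <=
    2^-1 * (\int[P]_w ((J1 w - J2 w) ^+ 2))%R + 2^-1 * (\int[P]_w (Z w ^+ 2))%R.
  have j1 : P.-integrable setT (EFin \o (fun w => 2^-1 * (J1 w - J2 w) ^+ 2)).
    exact: (integrableZl _ _ sJ.2).
  have j2 : P.-integrable setT (EFin \o (fun w => 2^-1 * Z w ^+ 2)).
    exact: (integrableZl _ _ sZ.2).
  rewrite -RintegralB// -!RintegralZl//; [|exact: sZ.2|exact: sJ.2].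
  rewrite -RintegralD//; apply: le_Rintegral => //.
  - exact: (integrableB measurableT i1 i2).
  - exact: (integrableD measurableT j1 j2).
  move=> w _; rewrite -mulrBl -subr_ge0; set y := J1 w - J2 w; set z := Z w.
  have -> : 2^-1 * y ^+ 2 + 2^-1 * z ^+ 2 - y * z = 2^-1 * (y - z) ^+ 2 by field.
  by rewrite mulr_ge0 ?sqr_ge0.
by move: H1 H2; rewrite !ler_norml => /andP[H1 _] /andP[_ H2]; move: H3 JZ; rewrite ZZ; lra.
Qed.

(* Positivity of [S].  Stopped at the exit times [sig] of []-K, K[[ and [rho] of []0, K[[ capped
   at [t], the difference [X t] of the two values of [S] has, by the isometry, a second moment
   [f t] bounded by [4 c ^+ 2] times the integral of [f] over [[0, t]]: past [rho], where [S]
   vanished, the integrand of the difference is of order [c * X].  Iterating with the weight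
   [expR (lam * t)] halves the bound each time, so [f] vanishes. *)
Section nonnegativity.
Variables (K : R).
Hypotheses (K1 : 1 <= K) (sK : s < K).

Let K0 : 0 < K. Proof. exact: lt_le_trans K1. Qed.
Let NK : - K < K. Proof. by rewrite gtrN. Qed.
Let snK : `|s| <= K. Proof. by rewrite gtr0_norm// ltW. Qed.

Let sig (t : R) := capped (exit_time S (- K) K) t.
Let rho (t : R) := capped (exit_time S 0 K) t.
Let X (t : R) (w : Omega) : R := S (sig t w) w - S (rho t w) w.

Let st_sig (t : R) : 0 <= t -> real_stopping_time F (sig t).
Proof. by move=> t0; apply: capped_stopping => //; exact: exit_time_stopping. Qed.
Let st_rho (t : R) : 0 <= t -> real_stopping_time F (rho t).
Proof. by move=> t0; apply: capped_stopping => //; exact: exit_time_stopping. Qed.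
Let sig_le (t : R) w : 0 <= t -> sig t w <= t.
Proof. exact: (capped_le (exit_time_stopping hF aS cS (- K) K) w). Qed.
Let rho_le (t : R) w : 0 <= t -> rho t w <= t.
Proof. exact: (capped_le (exit_time_stopping hF aS cS 0 K) w). Qed.
Let b_sig (t : R) : 0 <= t -> forall w r, 0 <= r < sig t w -> `|S r w| <= K.
Proof.
move=> t0 w r /andP[r0 rs]; have /andP[H1 H2] := before_capped_exit hF aS cS NK t0 r0 rs.
by rewrite ler_norml !ltW.
Qed.
Let b_rho (t : R) : 0 <= t -> forall w r, 0 <= r < rho t w -> `|S r w| <= K.
Proof.
move=> t0 w r /andP[r0 rs]; have /andP[H1 H2] := before_capped_exit hF aS cS K0 t0 r0 rs.
by rewrite ger0_norm ?ltW.
Qed.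

Let X_sq (t : R) : 0 <= t -> square_integrable P (X t).
Proof.
move=> t0.
have s1 := stopped_increment_square_integrable snK (st_sig t0) (b_sig t0).
have s2 := stopped_increment_square_integrable snK (st_rho t0) (b_rho t0).
have := square_integrableB s1 s2; congr (square_integrable P _).
by apply/funext => w; rewrite /X; ring.
Qed.

(** The coefficients differ only when the coarse time lies in [[rho, sig[]. There [S] vanishes at
    [rho], since leaving through [K] would also end [sig], so [X] is the value of [S] at the earlier
    of [sig] and the fine time. If [sig] comes first, that value has modulus [K] while the
    coefficient may reach [|c| * (K + 1)]; [1 <= K] and the factor [2] absorb the difference. *)
Let coef_bound (T : R) N M (i : nat) w : 0 < T -> (i < N.+1 * M.+1)%N -> S 0 w = s ->
  `|stopped_coef S c T (`|c| * (K + 1)) N M (sig T) i w -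
    stopped_coef S c T (`|c| * (K + 1)) N M (rho T) i w| <=
  2 * `|c| * `|X (i%:R * (T / (N.+1 * M.+1)%:R)) w|.
Proof.
move=> T0 iNM S0; rewrite /stopped_coef; set co := (i %/ _)%:R * _; set ti := i%:R * _.
have c2 : 0 <= 2 * `|c| by rewrite mulr_ge0.
have h0 : 0 < T / (N.+1 * M.+1)%:R by rewrite divr_gt0// ltr0n.
have ti0 : 0 <= ti by rewrite mulr_ge0// ltW.
have co_ti : co <= ti by exact: coarse_time_le.
have tiT : ti < T.
  by rewrite /ti mulrA ltr_pdivrMr ?ltr0n// mulrC ltr_pM2l// ltr_nat.
have TT := ltW T0; have ti_T := ltW tiT.
have S0sig : - K <= S 0 w <= K by rewrite S0; apply/andP; split; move: s0 sK K0; lra.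
have S0rho : 0 <= S 0 w <= K by rewrite S0; apply/andP; split; move: s0 sK K0; lra.
have rho_sig : rho T w <= sig T w.
  by apply: (capped_exit_le hF aS cS) => //; rewrite oppr_le0 ltW.
have indE (tau : Omega -> R) : \1_[set w | co < tau w] w = (co < tau w)%R%:R :> R.
  by rewrite indicE (_ : (w \in _) = (co < tau w)%R)//; apply/idP/idP; rewrite inE.
rewrite !indE.
have [co_rho|rho_co] := ltP co (rho T w).
  by rewrite (lt_le_trans co_rho rho_sig) subrr normr0 mulr_ge0.
have [co_sig|sig_co] := ltP co (sig T w); last by rewrite subrr normr0 mulr_ge0.
rewrite mulr1 mulr0 subr0.
have rhoT : rho T w < T by exact: le_lt_trans rho_co (le_lt_trans co_ti tiT).
have Srho : S (rho T w) w = 0.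
  have [//|SK] := capped_exit_hit hF aS cS K0 TT S0rho rhoT.
  have rho0 : 0 <= rho T w by exact: (st_rho TT).1.
  have := before_capped_exit hF aS cS NK TT rho0 (le_lt_trans rho_co co_sig).
  by rewrite -/(rho T w) SK ltxx andbF.
have rho_ti : rho ti w = rho T w.
  rewrite /rho (capped_min (exit_time_stopping hF aS cS 0 K) w ti0 ti_T).
  by apply/min_idPl; exact: le_trans rho_co co_ti.
rewrite /X rho_ti Srho subr0.
have -> : sig ti w = Num.min (sig T w) ti.
  exact: (capped_min (exit_time_stopping hF aS cS (- K) K) w ti0 ti_T).
have [sig_ti|ti_sig] := ltP (sig T w) ti.
  have -> : `|S (sig T w) w| = K.
    have [->|->] := capped_exit_hit hF aS cS NK TT S0sig (lt_trans sig_ti tiT).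
      by rewrite normrN gtr0_norm.
    by rewrite gtr0_norm.
  rewrite (le_trans (normr_clamp _ _))//; first by rewrite mulr_ge0// addr_ge0// ltW.
  have -> : 2 * `|c| * K = `|c| * (K + K) by ring.
  by apply: ler_wpM2l => //; rewrite lerD2l.
rewrite (le_trans (normr_clamp_le _ _))//; first by rewrite mulr_ge0// addr_ge0// ltW.
by rewrite normrM -mulrA; apply: ler_peMl; [rewrite mulr_ge0|rewrite ler1n].
Qed.

Let f (t : R) := (\int[P]_w (X t w ^+ 2))%R.
(** Here [8 * c ^+ 2] is twice the constant [4 * c ^+ 2] of the isometry estimate. With this rate
    each term [4 * c ^+ 2 * A * expR (lam * ti) * h] is at most the increment of
    [A / 2 * expR (lam * t)] over its grid cell, and these increments telescope. *)
Let lam := 8 * c ^+ 2 + 1.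

Let f_step (T A : R) : 0 < T -> 0 <= A -> (forall t, 0 <= t -> f t <= A * expR (lam * t)) ->
  f T <= A / 2 * expR (lam * T).
Proof.
move=> T0 A0 HA; have TT := ltW T0.
apply: (@stopped_difference_second_moment T K _ (sig T) (rho T)) => //.
- exact: st_sig.
- by move=> w; exact: sig_le.
- exact: b_sig.
- exact: st_rho.
- by move=> w; exact: rho_le.
- exact: b_rho.
move=> N M; set n := (N.+1 * M.+1)%N; set h := T / n%:R.
have h0 : 0 < h by rewrite divr_gt0// ltr0n.
have L0 : 0 <= `|c| * (K + 1) by rewrite mulr_ge0// addr_ge0// ltW.
have tele : A / 2 * (expR (lam * T) - 1) = \sum_(i < n) A / 2 * (expR (lam * (i.+1%:R * h)) - expR (lam * (i%:R * h))).
  rewrite -mulr_sumr -(big_mkord xpredT (fun i => expR (lam * (i.+1%:R * h)) - expR (lam * (i%:R * h)))).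
  rewrite (telescope_sumr (fun i : nat => expR (lam * (i%:R * h))))//.
  rewrite mul0r mulr0 expR0; congr (_ * (expR (_ * _) - _)).
  by rewrite /h mulrC divfK// pnatr_eq0.
apply: (@le_trans _ _ (A / 2 * (expR (lam * T) - 1))); last first.
  by apply: ler_wpM2l; [rewrite divr_ge0|rewrite lerBlDr lerDl].
rewrite tele; apply: ler_sum => i _; set ti := i%:R * h.
have ti0 : 0 <= ti by rewrite mulr_ge0// ltW.
have : (\int[P]_w ((stopped_coef S c T (`|c| * (K + 1)) N M (sig T) i w -
                  stopped_coef S c T (`|c| * (K + 1)) N M (rho T) i w) ^+ 2))%R <=
   4 * c ^+ 2 * f ti.
  have sX := X_sq ti0.
  rewrite /f -RintegralZl//; last exact: sX.2.
  have pc := @stopped_coef_sub_predictable T T0 N M _ _ _ L0 (st_sig TT) (st_rho TT) i.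
  have sD : square_integrable P (fun w => stopped_coef S c T (`|c| * (K + 1)) N M (sig T) i w -
                  stopped_coef S c T (`|c| * (K + 1)) N M (rho T) i w).
    have [mp [k bk]] := pc; apply: (@square_integrable_ae_bounded _ k); last exact: aeW.
    move=> _ D mD; rewrite setTI; have [_ Fm _] := hF; apply: (Fm ti) => //; exact: mp.
  rewrite /Rintegral; apply: fine_le.
  - by apply: integrable_fin_num => //; exact: sD.2.
  - by apply: integrable_fin_num => //; exact: (integrableZl _ _ sX.2).
  apply: ae_ge0_le_integral => //.
  - by move=> w _; rewrite lee_fin sqr_ge0.
  - by apply/measurable_EFinP; apply: measurable_funX; exact: sD.1.
  - by move=> w _; rewrite lee_fin mulr_ge0 ?sqr_ge0// mulr_ge0 ?sqr_ge0.
  - apply/measurable_EFinP; apply: measurable_funM => //; apply: measurable_funX; exact: sX.1.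
  apply: filterS (sde_initial hF hS) => w Sw _; rewrite lee_fin.
  have := coef_bound T0 (ltn_ord i) Sw; rewrite -/h -/ti => H.
  rewrite -(real_normK (num_real (_ - _))).
  have -> : 4 * c ^+ 2 * X ti w ^+ 2 = (2 * `|c| * `|X ti w|) ^+ 2.
    by rewrite !exprMn !real_normK ?num_real//; congr (_ * _ * _); rewrite -natrX.
  by rewrite ler_sqr ?nnegrE// !mulr_ge0.
move/(fun H => ler_wpM2r (ltW h0) H)/le_trans; apply.
have Hf := HA _ ti0.
apply: (@le_trans _ _ (4 * c ^+ 2 * (A * expR (lam * ti)) * h)).
  by apply: ler_wpM2r; [exact: ltW|apply: ler_wpM2l => //; rewrite mulr_ge0// sqr_ge0].
have -> : expR (lam * (i.+1%:R * h)) = expR (lam * ti) * expR (lam * h).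
  by rewrite -expRD -natr1 /ti; congr expR; ring.
have := expR_ge1Dx (lam * h); have := expR_gt0 (lam * ti).
move: (expR (lam * ti)) (expR (lam * h)) => x y x0 y1.
have -> : A / 2 * (x * y - x) = A / 2 * x * (y - 1) by ring.
apply: (@le_trans _ _ (A / 2 * x * (lam * h))).
  rewrite /lam -subr_ge0.
  have -> : A / 2 * x * ((8 * c ^+ 2 + 1) * h) - 4 * c ^+ 2 * (A * x) * h = A / 2 * x * h by field.
  by rewrite !mulr_ge0// ltW.
by apply: ler_wpM2l; [rewrite !mulr_ge0// ltW|rewrite lerBrDl].
Qed.

Let f_bound (j : nat) (t : R) : 0 <= t -> f t <= (2 * K) ^+ 2 / 2 ^+ j * expR (lam * t).
Proof.
elim: j t => [|j IH] t t0.
  apply: (@le_trans _ _ ((2 * K) ^+ 2)); last first.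
    rewrite expr0 divr1 ler_peMr ?sqr_ge0// -(expR0 R) ler_expR.
    by rewrite mulr_ge0// addr_ge0// mulr_ge0// sqr_ge0.
  apply: Rintegral_sqr_ae_le; first by have [] := X_sq t0.
  have := stopped_ae_bounded hF hS snK (st_sig t0) (b_sig t0).
  have := stopped_ae_bounded hF hS snK (st_rho t0) (b_rho t0).
  apply: filterS2 => w H1 H2; rewrite /X (le_trans (ler_normB _ _))//.
  by rewrite mulr_natl mulr2n lerD.
move: t0; rewrite le_eqVlt => /predU1P[<-|t0].
  rewrite /f (_ : (fun w => _) = cst 0); last first.
    apply/funext => w; rewrite /X.
    have -> : sig 0 w = 0 by apply/le_anti; rewrite sig_le//= (st_sig (lexx 0)).1.
    have -> : rho 0 w = 0 by apply/le_anti; rewrite rho_le//= (st_rho (lexx 0)).1.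
    by rewrite subrr expr0n.
  by rewrite Rintegral_cst// mul0r mulr_ge0 ?expR_ge0// divr_ge0 ?sqr_ge0.
have -> : (2 * K) ^+ 2 / 2 ^+ j.+1 = (2 * K) ^+ 2 / 2 ^+ j / 2 by rewrite (exprSr 2 j) invfM mulrA.
by apply: f_step => //; rewrite divr_ge0 ?sqr_ge0.
Qed.

Lemma stopped_exit_eq (t : R) : 0 <= t ->
  {ae P, forall w, S (capped (exit_time S (- K) K) t w) w = S (capped (exit_time S 0 K) t w) w}.
Proof.
move=> t0; have sX := X_sq t0.
have : f t <= 0.
  apply/ler_addgt0Pl => e e0; rewrite addr0.
  have C0 : 0 < (2 * K) ^+ 2 * expR (lam * t) by rewrite mulr_gt0 ?expR_gt0// exprn_gt0// mulr_gt0.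
  have eC : 0 < e / ((2 * K) ^+ 2 * expR (lam * t)) by rewrite divr_gt0.
  have [j _ Hj] := near_infty_natSinv_expn_lt (PosNum eC).
  apply: (le_trans (f_bound j t0)).
  have := Hj j (leqnn _); rewrite /= ltr_pdivlMr// mul1r => /ltW; apply: le_trans.
  by rewrite le_eqVlt; apply/orP; left; apply/eqP; ring.
rewrite /f => fle.
have I0 : (\int[P]_w `|(X t w ^+ 2)%:E| = 0)%E.
  under eq_integral do rewrite gee0_abs ?lee_fin ?sqr_ge0//.
  rewrite -(fineK (integrable_fin_num measurableT sX.2)); congr (_%:E).
  apply/le_anti; rewrite fle/= fine_ge0//.
  by apply: integral_ge0 => w _; rewrite lee_fin sqr_ge0.
have mX : measurable_fun setT (fun w => (X t w ^+ 2)%:E).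
  by apply/measurable_EFinP; apply: measurable_funX; exact: sX.1.
have := (ae_eq_integral_abs P measurableT mX).1 I0.
apply: filterS => w /(_ I) /= [] /eqP; rewrite sqrf_eq0 subr_eq0 => /eqP.
by [].
Qed.

End nonnegativity.

(** The equalities of stopped values hold simultaneously, almost surely, for countably many levels
    [K k] and times [n / m.+1]. At such a time, a level above the maximum of the path makes the exit
    from []-K k, K k[] come too late to matter, so [S] equals its value stopped on leaving []0, K
    k[], which is nonnegative. Continuity gives the other times. *)
Lemma sde_ge0 : {ae P, forall w, forall t : R, 0 <= t -> 0 <= S t w}.
Proof.
pose K (k : nat) : R := k%:R + s + 1.
have K1 k : 1 <= K k by rewrite /K -[leLHS]add0r lerD2r addr_ge0// ltW.
have sK k : s < K k by have := ler0n R k; rewrite /K; move: (k%:R : R) => x; lra.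
have tm0 (n m : nat) : 0 <= n%:R / m.+1%:R :> R by rewrite divr_ge0.
have H : {ae P, forall w, forall n m k : nat,
    S (capped (exit_time S (- K k) (K k)) (n%:R / m.+1%:R) w) w =
    S (capped (exit_time S 0 (K k)) (n%:R / m.+1%:R) w) w}.
  by do 3 (apply/ae_foralln => ?); exact: stopped_exit_eq.
apply: filterS2 H (sde_initial hF hS) => w Hw Sw t t0.
have frac (n m : nat) : 0 <= S (n%:R / m.+1%:R) w.
  set r := n%:R / m.+1%:R.
  have [M HM] := continuous_path_bounded cS w r.
  pose k := (Num.truncn `|M|).+1.
  have MK : M < K k.
    have := truncnS_gt `|M|; have := ler_norm M; rewrite -/k /K; move: s0; lra.
  have K0 : 0 < K k by exact: lt_le_trans (K1 k).
  have NK : - K k < K k by rewrite gtrN.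
  have S0K : 0 <= S 0 w <= K k by rewrite Sw (ltW s0) ltW.
  suff <- : capped (exit_time S (- K k) (K k)) r w = r.
    rewrite Hw; have := capped_exit_between hF aS cS K0 (tm0 n m) S0K.
    by case/andP.
  apply/le_anti; rewrite (capped_le (exit_time_stopping hF aS cS (- K k) (K k)) w (tm0 n m))/=.
  rewrite leNgt; apply/negP => lt_r.
  have X0 := capped_ge0 (exit_time_stopping hF aS cS (- K k) (K k)) w (tm0 n m).
  apply: (at_capped_exit hF aS cS NK (tm0 n m) lt_r).
  by rewrite -ltr_norml (le_lt_trans _ MK)// HM// X0 ltW.
rewrite leNgt; apply/negP => St.
have e0 : 0 < - S t w by rewrite oppr_gt0.
have [dl dl0 Hdl] := continuous_path_dist cS w t0 e0.
have [m] := ltr_add_invr dl0; rewrite add0r => mdl.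
pose n := Num.truncn (t * m.+1%:R).
have tm : 0 <= t * m.+1%:R by rewrite mulr_ge0.
have := truncn_itv tm; rewrite -/n => /andP[n1 n2].
have m0 : 0 < m.+1%:R :> R by [].
have := Hdl _ (tm0 n m); rewrite ger0_norm ?subr_ge0 ?ler_pdivrMr// => /(_ _)/wrap[].
  apply: lt_trans mdl; rewrite ltrBlDr.
  by move: n2; rewrite -ltr_pdivlMr// -natr1 mulrDl mul1r addrC.
rewrite ltr_norml => /andP[H1 _]; have := frac n m; lra.
Qed.

End martingale.

(** * Optional sampling *)

Section ae_Rintegral.
Context (R : realType) d (Omega : measurableType d) (P : probability Omega R).
Implicit Types X Y : Omega -> R.

Lemma ae_eq_Rintegral X Y : measurable_fun setT X -> measurable_fun setT Y ->
  {ae P, forall w, X w = Y w} -> (\int[P]_w X w)%R = (\int[P]_w Y w)%R.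
Proof.
move=> mX mY XY; rewrite /Rintegral; congr fine; apply: ae_eq_integral => //.
- exact/measurable_EFinP.
- exact/measurable_EFinP.
- by apply: filterS XY => w ->.
Qed.

Lemma ae_le_Rintegral X Y : P.-integrable setT (EFin \o X) -> P.-integrable setT (EFin \o Y) ->
  {ae P, forall w, X w <= Y w} -> (\int[P]_w X w)%R <= (\int[P]_w Y w)%R.
Proof.
move=> iX iY XY; rewrite -subr_ge0 -RintegralB//.
have mX : measurable_fun setT X by apply/measurable_EFinP; exact: measurable_int iX.
have mY : measurable_fun setT Y by apply/measurable_EFinP; exact: measurable_int iY.
have mYX : measurable_fun setT (Y \- X) by exact: measurable_funB.
rewrite (@ae_eq_Rintegral _ (fun w => Num.max 0 (Y w - X w)))//.
- by apply: Rintegral_ge0 => w _; rewrite le_max lexx.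
- exact: measurable_maxr.
- by apply: filterS XY => w XYw; rewrite max_r// subr_ge0.
Qed.

End ae_Rintegral.

Section optional_sampling.
Context (R : realType) d (Omega : measurableType d) (P : probability Omega R).
Variables (F : R -> set (set Omega)) (B S : R -> Omega -> R) (c s : R).
Hypothesis hF : filtration F.
Hypothesis hB : brownian_motion P F B.
Hypothesis hS : solves_sde P F B (fun x => c * x) s S.
Hypothesis s0 : 0 < s.

Let aS : adapted F S. Proof. by case: hS. Qed.
Let cS : continuous_paths S. Proof. by case: hS. Qed.

Lemma capped_near (tau : Omega -> \bar R) w : (0 <= tau w)%E -> (tau w < +oo)%E ->
  \forall n \near \oo, capped tau n.+1%:R w = fine (tau w).
Proof.
move=> t0 tw; have tfin : tau w \is a fin_num by rewrite ge0_fin_numE.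
near=> n; rewrite /capped (min_idPl _)// -(fineK tfin) lee_fin.
apply: (@le_trans _ _ n%:R); last by rewrite ler_nat.
by near: n; exact: nbhs_infty_ger.
Unshelve. all: by end_near. Qed.

Lemma stopping_time_emeasurable tau : stopping_time F tau -> measurable_fun setT tau.
Proof.
move=> st; apply: (emeasurable_fun_cvg (fun n w => (capped tau n.+1%:R w)%:E)).
  move=> n; apply/measurable_EFinP; apply: (stopping_time_measurable hF).
  exact: capped_stopping.
move=> w _; have [tw|] := ltP (tau w) +oo%E.
  have tfin : tau w \is a fin_num by rewrite ge0_fin_numE// st.1.
  rewrite -(fineK tfin); apply: cvg_EFin; first exact: nearW.
  by apply: cvg_near_cst; exact: capped_near (st.1 w) tw.
rewrite leye_eq => /eqP tw; rewrite tw; apply/cvgeyPge => M; near=> n.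
rewrite /capped tw (min_idPr _) ?leey//= lee_fin (@le_trans _ _ n%:R) ?ler_nat//.
near: n; exact: nbhs_infty_ger.
Unshelve. all: by end_near. Qed.

Lemma stopped_value_measurable tau : stopping_time F tau -> measurable_fun setT (stopped_value S tau).
Proof.
move=> st; apply: (measurable_stopped hF hS (tau := fun w => fine (tau w))); last first.
  by move=> w; rewrite fine_ge0// st.1.
by apply: measurableT_comp => //; exact: stopping_time_emeasurable.
Qed.

Section exit.
Variables (a b : R).
Hypotheses (a0 : 0 < a) (a_s : a < s) (sb : s < b).

Let ab : a < b. Proof. exact: lt_trans sb. Qed.
Let b0 : 0 < b. Proof. exact: lt_trans ab. Qed.
Let snb : `|s| <= b. Proof. by rewrite gtr0_norm// ltW. Qed.
Let st := exit_time_stopping hF aS cS a b.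

Let bounded_before (T : R) : 0 <= T -> forall w r, 0 <= r < capped (exit_time S a b) T w -> `|S r w| <= b.
Proof.
move=> T0 w r /andP[r0 rX]; have /andP[H1 H2] := before_capped_exit hF aS cS ab T0 r0 rX.
by rewrite ger0_norm ltW// (lt_trans a0).
Qed.

Let mul_clamp_ge0 (m x : R) : 0 <= m -> 0 <= x -> 0 <= c * clamp m (c * x).
Proof.
move=> m0; rewrite le_eqVlt => /predU1P[<-|x0]; first by rewrite mulr0 clamp_id ?normr0// mulr0.
by have := clamp_mul_ge0 (c * x) m0; rewrite mulrAC pmulr_lge0.
Qed.

(* Before leaving []a, b[[ the integrand satisfies [c * (c * S) >= c ^+ 2 * a], so testing the
   stopped integral against [B T - B 0] bounds [P (exit_time >= T) * T] by a multiple of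
   [sqrt T]. *)
Lemma exit_time_probability (l : R) : 0 < l ->
  fine (P [set w | l ^+ 2 <= capped (exit_time S a b) (l ^+ 2) w]) * (c ^+ 2 * a * l) <=
  (c ^+ 2 * (b + s) ^+ 2 + 1) / 2.
Proof.
move=> l0; set T := l ^+ 2; have T0 : 0 < T by rewrite exprn_gt0.
have TT := ltW T0; pose tau := capped (exit_time S a b) T.
rewrite -/tau; set A := [set w | _].
have stt : real_stopping_time F tau by exact: capped_stopping.
have mtau : measurable_fun setT tau by exact: stopping_time_measurable hF _ stt.
have mA : measurable A.
  by rewrite /A -[X in measurable X]setTI; exact: (measurable_fun_le measurableT (measurable_cst T) mtau).
pose L := `|c| * (b + 1); have L0 : 0 <= L by rewrite mulr_ge0// addr_ge0// ltW.
pose Z w := B T w - B 0 w.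
have sZ : square_integrable P Z by exact: (brownian_increment_square_integrable hF hB).
pose X w := S (tau w) w - s.
have sX : square_integrable P X.
  exact: (stopped_increment_square_integrable hF hS snb stt (bounded_before TT)).
set p := fine _.
have lower N M : c ^+ 2 * a * p * T <=
    c * (\int[P]_w (stopped_sum B S c T L N M tau w * Z w))%R.
  set n := (N.+1 * M.+1)%N; set h := T / n%:R.
  have h0 : 0 < h by rewrite divr_gt0// ltr0n.
  have ih0 i : 0 <= i%:R * h by rewrite mulr_ge0// ltW.
  have pc := @stopped_coef_predictable _ _ _ P F B S c s hF hS T T0 N M L tau L0 stt.
  have p1 : predictable_bounded (fun i : nat => F (i%:R * h)) (fun (_ : nat) (_ : Omega) => 1 : R).
    move=> i; split; last by exists 1 => w; rewrite normr1.
    by apply: measurable_wrt_cst; case: hF => H _ _; exact: H.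
  have ZE w : Z w = transform (grid_increment B h) (fun (_ : nat) (_ : Omega) => 1 : R) n w.
    rewrite /transform /grid_increment; under eq_bigr do rewrite mul1r.
    rewrite -(big_mkord xpredT (fun i => B (i.+1%:R * h) w - B (i%:R * h) w)).
    rewrite (telescope_sumr (fun i : nat => B (i%:R * h) w))//.
    by rewrite mul0r /Z /h [n%:R * _]mulrC divfK// pnatr_eq0.
  under eq_Rintegral do rewrite ZE.
  rewrite (grid_isometry hF hB T0 pc p1) mulr_sumr.
  have -> : c ^+ 2 * a * p * T = \sum_(i < n) c ^+ 2 * a * p * h.
    by rewrite sumr_const card_ord -mulr_natl /h; field; rewrite pnatr_eq0.
  apply: ler_sum => i _; rewrite [X in _ <= X]mulrA; apply: ler_wpM2r; first exact: ltW.
  under eq_Rintegral do rewrite mulr1.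
  have [mc [k bk]] := pc i.
  have iC : P.-integrable setT (EFin \o stopped_coef S c T L N M tau i).
    apply: square_integrable_integrable; apply: (@square_integrable_bounded _ _ _ _ _ k) => //.
    by move=> _ D mD; rewrite setTI; have [_ Fm _] := hF; apply: (Fm _ (ih0 i)); exact: mc.
  have iA := integrable_indic_probability P mA.
  rewrite -RintegralZl// /p -Rintegral_indic_probability// -RintegralZl//.
  apply: ae_le_Rintegral; [exact: (integrableZl _ _ iA)|exact: (integrableZl _ _ iC)|].
  (* On [A] the whole grid precedes the exit and [a] bounds [S] from below. Off [A] only the sign of
     the term matters; a fine time may then follow the exit, so positivity of [S] is what settles
     it. *)
  apply: filterS (sde_ge0 hF hB hS s0) => w Sw.
  rewrite /stopped_coef !indicE mulrA; have [wA|wA] := boolP (w \in A); last first.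
    by rewrite mulr0 mulr_ge0// mul_clamp_ge0// Sw// ih0.
  have tauT : T <= tau w by move: wA; rewrite inE.
  have tiT : i%:R * h < T.
    by rewrite /h mulrA ltr_pdivrMr ?ltr0n// mulrC ltr_pM2l// ltr_nat.
  have co_ti := coarse_time_le N M i T0.
  have -> : w \in [set w | (i %/ M.+1)%:R * (T / N.+1%:R) < tau w].
    by rewrite inE /=; apply: le_lt_trans co_ti (lt_le_trans tiT tauT).
  have /andP[Sa Sb] := before_capped_exit hF aS cS ab TT (ih0 i) (lt_le_trans tiT tauT).
  rewrite !mulr1 clamp_id; last first.
    rewrite normrM /L; apply: ler_wpM2l => //.
    by rewrite ger0_norm; [rewrite (le_trans (ltW Sb))// lerDl|exact: le_trans (ltW a0) (ltW Sa)].
  by rewrite mulrA -expr2; apply: ler_wpM2l; [rewrite sqr_ge0|exact: ltW].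
(* The weight [l] balances the two squares: the second moment of [X] is bounded independently of
   [l], that of [Z] is [l ^+ 2], and both contributions come out of order [l], against [l ^+ 2] in
   the lower bound. *)
have upper : c * (\int[P]_w (X w * Z w))%R <= l * (c ^+ 2 * (b + s) ^+ 2 + 1) / 2.
  have iXZ := square_integrable_mul sX sZ.
  rewrite -RintegralZl//.
  have i1 : P.-integrable setT (EFin \o (fun w => l * c ^+ 2 / 2 * X w ^+ 2)).
    exact: (integrableZl _ _ sX.2).
  have i2 : P.-integrable setT (EFin \o (fun w => (2 * l)^-1 * Z w ^+ 2)).
    exact: (integrableZl _ _ sZ.2).
  apply: (@le_trans _ _ (\int[P]_w (l * c ^+ 2 / 2 * X w ^+ 2 + (2 * l)^-1 * Z w ^+ 2))%R).
    apply: le_Rintegral => //; first exact: (integrableZl _ _ iXZ).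
      exact: (integrableD measurableT i1 i2).
    move=> w _; rewrite -subr_ge0.
    have -> : l * c ^+ 2 / 2 * X w ^+ 2 + (2 * l)^-1 * Z w ^+ 2 - c * (X w * Z w) =
       (2 * l)^-1 * (l * c * X w - Z w) ^+ 2 by field; rewrite lt0r_neq0.
    by rewrite mulr_ge0 ?sqr_ge0// invr_ge0 mulr_ge0// ltW.
  rewrite RintegralD// !RintegralZl//; [|exact: sZ.2|exact: sX.2].
  have -> : (\int[P]_w (Z w ^+ 2))%R = l ^+ 2.
    by rewrite /Z (brownian_increment_variance hF hB)// subr0.
  have HX : (\int[P]_w (X w ^+ 2))%R <= (b + s) ^+ 2.
    apply: Rintegral_sqr_ae_le; first by case: sX.
    have := stopped_increment_bounded hF hS snb stt (bounded_before TT).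
    by apply: filterS => w; rewrite (gtr0_norm s0).
  have -> : (2 * l)^-1 * l ^+ 2 = l / 2 by field; rewrite lt0r_neq0.
  have -> : l * (c ^+ 2 * (b + s) ^+ 2 + 1) / 2 = l * c ^+ 2 / 2 * (b + s) ^+ 2 + l / 2 by field.
  by rewrite lerD2r; apply: ler_wpM2l => //; rewrite divr_ge0// mulr_ge0 ?sqr_ge0// ltW.
have : c ^+ 2 * a * p * T <= l * (c ^+ 2 * (b + s) ^+ 2 + 1) / 2.
  apply/ler_addgt0Pl => e e0.
  have e1 : 0 < e / (`|c| + 1) by rewrite divr_gt0// ltr_wpDl.
  have [N0 /(_ N0 (leqnn _))[M0 /(_ M0 (leqnn _))]] :=
    stopped_sum_weak_limit hF hB hS T0 b0 snb stt (fun w => capped_le st w TT) (bounded_before TT) sZ e1.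
  have := lower N0 M0; rewrite -/L.
  move: upper; set x := (\int[P]_w (X w * Z w))%R; set y := (\int[P]_w (_ * Z w))%R => U Lo H.
  apply: (le_trans Lo); rewrite -[y](subrK x) mulrDr lerD//.
  rewrite (le_trans (ler_norm _))// normrM (@le_trans _ _ (`|c| * (e / (`|c| + 1))))//.
    exact: ler_wpM2l.
  rewrite mulrCA; apply: ler_piMr; first exact: ltW.
  by rewrite ler_pdivrMr ?mul1r ?lerDl// ltr_wpDl.
have -> : c ^+ 2 * a * p * T = l * (p * (c ^+ 2 * a * l)) by rewrite /T; ring.
by rewrite -[X in _ <= X]mulrA ler_pM2l.
Qed.

Hypothesis c0 : c != 0.

Let cc_gt0 : 0 < c ^+ 2 * a.
Proof. by rewrite mulr_gt0// exprn_even_gt0. Qed.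

(** A path that never leaves belongs to every [A n], and the probability of [A n] is at most a
    constant divided by [n.+1]. *)
Lemma exit_time_finite : {ae P, forall w, (exit_time S a b w < +oo)%E}.
Proof.
pose A n := [set w | n.+1%:R ^+ 2 <= capped (exit_time S a b) (n.+1%:R ^+ 2) w].
have mA n : measurable (A n).
  have n0 : 0 <= n.+1%:R ^+ 2 :> R by rewrite sqr_ge0.
  rewrite /A -[X in measurable X]setTI; apply: measurable_fun_le => //.
  exact: (stopping_time_measurable hF (capped_stopping hF st n0)).
have mI : measurable (\bigcap_n A n) by exact: bigcapT_measurable.
exists (\bigcap_n A n); split => //; last first.
  move=> w /= /negP; rewrite -leNgt leye_eq => /eqP tw n _; rewrite /A /= /capped tw.
  by rewrite (_ : Order.min _ _ = (n.+1%:R ^+ 2)%:E)//; apply/min_idPr; rewrite leey.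
rewrite -(fineK (fin_num_measure P _ mI)); congr (_%:E).
set p := fine _; set C := (c ^+ 2 * (b + s) ^+ 2 + 1) / 2.
have Hp n : p * (c ^+ 2 * a * n.+1%:R) <= C.
  apply: le_trans (exit_time_probability (ltr0Sn R n)).
  apply: ler_wpM2r; first by rewrite ltW// mulr_gt0.
  apply: fine_le; rewrite ?fin_num_measure//; first exact: (mA n).
  by apply: le_measure; rewrite ?inE//; [exact: (mA n)|move=> w; exact].
apply/le_anti; rewrite fine_ge0 ?measure_ge0// andbT leNgt; apply/negP => p0.
have D0 : 0 < p * (c ^+ 2 * a) by rewrite mulr_gt0.
have := Hp (Num.truncn (C / (p * (c ^+ 2 * a)))); rewrite mulrA mulrC -ler_pdivlMr//.
by rewrite leNgt truncnS_gt.
Qed.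

Lemma exit_value_cvg : {ae P, forall w,
  S (capped (exit_time S a b) n.+1%:R w) w @[n --> \oo] --> stopped_value S (exit_time S a b) w}.
Proof.
apply: filterS exit_time_finite => w tw; apply: cvg_near_cst.
by apply: filterS (capped_near (st.1 w) tw) => n ->.
Qed.

Lemma exit_value : {ae P, forall w,
  stopped_value S (exit_time S a b) w = a \/ stopped_value S (exit_time S a b) w = b}.
Proof.
apply: filterS2 exit_time_finite (sde_initial hF hS) => w tw Sw.
have tfin : exit_time S a b w \is a fin_num by rewrite ge0_fin_numE// st.1.
have T0 : 0 <= fine (exit_time S a b w) + 1 by rewrite addr_ge0// fine_ge0// st.1.
have S0 : a <= S 0 w <= b by rewrite Sw !ltW.
have cE : capped (exit_time S a b) (fine (exit_time S a b w) + 1) w = fine (exit_time S a b w).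
  by rewrite /capped (min_idPl _)// -{1}(fineK tfin) lee_fin lerDl.
have := capped_exit_hit hF aS cS ab T0 S0; rewrite /= cE; apply.
by rewrite ltrDl.
Qed.

Lemma exit_value_mean : (\int[P]_w stopped_value S (exit_time S a b) w)%R = s.
Proof.
have T0 n : 0 < n.+1%:R :> R by [].
have : (\int[P]_w S (capped (exit_time S a b) n.+1%:R w) w)%R @[n --> \oo] -->
    (\int[P]_w stopped_value S (exit_time S a b) w)%R.
  apply: (@Rintegral_dominated_cvg _ _ _ _ _ _ (cst b)).
  - move=> n; have stc := capped_stopping hF st (ltW (T0 n)).
    exact: (measurable_stopped hF hS (stopping_time_measurable hF stc) stc.1).
  - exact: stopped_value_measurable.
  - exact: exit_value_cvg.
  - exact: finite_measure_integrable_cst.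
  - apply/ae_foralln => n.
    exact: (stopped_ae_bounded hF hS snb (capped_stopping hF st (ltW (T0 n))) (bounded_before (ltW (T0 n)))).
rewrite (_ : (fun n => _) = cst s).
  by move=> /(cvg_lim (@norm_hausdorff _ _)); rewrite lim_cst.
apply/funext => n.
exact: (stopped_mean hF hB hS (T0 n) b0 snb (capped_stopping hF st (ltW (T0 n)))
  (fun w => capped_le st w (ltW (T0 n))) (bounded_before (ltW (T0 n)))).
Qed.

Lemma exit_value_probability :
  fine (P [set w | stopped_value S (exit_time S a b) w = b]) = (s - a) / (b - a).
Proof.
set V := stopped_value S (exit_time S a b).
have mV : measurable_fun setT V by exact: stopped_value_measurable.
set E := [set w | V w = b].
have mE : measurable E by rewrite /E -[X in measurable X]setTI; exact: (mV measurableT _ (measurable_set1 b)).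
have iE := integrable_indic_probability P mE.
have := exit_value_mean; rewrite -/V (@ae_eq_Rintegral _ _ _ _ _ (fun w => a + (b - a) * \1_E w))//.
- rewrite RintegralD//; [|exact: finite_measure_integrable_cst|exact: (integrableZl _ _ iE)].
  rewrite RintegralZl// Rintegral_indic_probability// Rintegral_cst//= probability_setT mulr1 => <-.
  by rewrite addrAC subrr add0r mulrAC mulfV ?mul1r// subr_eq0 gt_eqF.
- apply: measurable_funD => //; apply: measurable_funM => //; exact: measurable_indic.
- apply: filterS exit_value; rewrite -/V => w [Vw|Vw]; rewrite indicE.
    by rewrite memNset ?mulr0 ?addr0// /E /= Vw => /eqP; rewrite lt_eqF.
  by rewrite mem_set// mulr1 addrC subrK.
Qed.

End exit.

(** Fatou's lemma along the times [rho n], which are bounded and keep [S] bounded, so that the mean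
    there is exactly [s]. Almost every path is bounded up to its finite [tau], hence [rho n]
    eventually equals [tau]. Only an inequality survives in the limit. The maximum with [0] makes
    the integrands nonnegative everywhere and changes nothing almost surely. *)
Lemma stopped_value_mean_le tau : finite_stopping_times P F tau ->
  (\int[P]_w (Num.max 0 (stopped_value S tau w))%:E <= s%:E)%E.
Proof.
move=> [st fin_tau].
pose K (n : nat) : R := n%:R + s + 1.
have K0 n : 0 < K n by rewrite /K -addrA ltr_wpDl// addr_gt0.
have snK n : `|s| <= K n by rewrite gtr0_norm// /K; have := ler0n R n; move: (n%:R : R) => x; lra.
have NK n : - K n < K n by rewrite gtrN.
have T0 (n : nat) : 0 < n.+1%:R :> R by [].
have ste n := exit_time_stopping hF aS cS (- K n) (K n).
pose rho n w := Num.min (capped tau n.+1%:R w) (capped (exit_time S (- K n) (K n)) n.+1%:R w).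
have st_rho n : real_stopping_time F (rho n).
  by apply: real_stopping_min => //; exact: capped_stopping.
have le_rho n w : rho n w <= n.+1%:R by rewrite ge_min (capped_le st w (ltW (T0 n))).
have b_rho n w r : 0 <= r < rho n w -> `|S r w| <= K n.
  move=> /andP[r0]; rewrite lt_min => /andP[_ rK].
  have /andP[H1 H2] := before_capped_exit hF aS cS (NK n) (ltW (T0 n)) r0 rK.
  by rewrite ler_norml !ltW.
have mS n : measurable_fun setT (fun w => S (rho n w) w).
  exact: (measurable_stopped hF hS (stopping_time_measurable hF (st_rho n)) (st_rho n).1).
have mean n : (\int[P]_w (Num.max 0 (S (rho n w) w))%:E = s%:E)%E.
  rewrite -[in RHS](stopped_mean hF hB hS (T0 n) (K0 n) (snK n) (st_rho n) (le_rho n) (@b_rho n)).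
  have sX : square_integrable P (fun w => S (rho n w) w).
    apply: square_integrable_ae_bounded (mS n) _.
    exact: (stopped_ae_bounded hF hS (snK n) (st_rho n) (@b_rho n)).
  rewrite /Rintegral fineK; last first.
    by apply: integrable_fin_num => //; exact: square_integrable_integrable sX.
  apply: ae_eq_integral => //.
  - by apply/measurable_EFinP; exact: measurable_maxr.
  - exact/measurable_EFinP.
  - apply: filterS (sde_ge0 hF hB hS s0) => w Sw _ /=; rewrite max_r// Sw//.
    exact: (st_rho n).1.
have fin : {ae P, forall w, (tau w < +oo)%E}.
  apply: ae_probability1 => //.
  by rewrite -[X in measurable X]setTI; apply: emeasurable_fun_infty_o => //; exact: stopping_time_emeasurable.
have lim : {ae P, forall w, (limn_einf (fun n => (Num.max 0 (S (rho n w) w))%:E)) =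
     (Num.max 0 (stopped_value S tau w))%:E}.
  apply: filterS fin => w tw; 
  have [] := @cvg_limn_einf_sup R (fun n => (Num.max 0 (S (rho n w) w))%:E) (Num.max 0 (stopped_value S tau w))%:E; last by [].
  apply: cvg_near_cst.
  have [M HM] := continuous_path_bounded cS w (fine (tau w)).
  near=> n.
  suff -> : rho n w = fine (tau w) by [].
  have cE : capped tau n.+1%:R w = fine (tau w).
    by near: n; exact: capped_near (st.1 w) tw.
  rewrite /rho cE; apply/min_idPl; rewrite leNgt; apply/negP => lt_tau.
  have tle : fine (tau w) <= n.+1%:R by rewrite -cE (capped_le st w (ltW (T0 n))).
  have X0 := capped_ge0 (ste n) w (ltW (T0 n)).
  apply: (at_capped_exit hF aS cS (NK n) (ltW (T0 n)) (lt_le_trans lt_tau tle)).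
  rewrite -ltr_norml; apply: (@le_lt_trans _ _ M); first by rewrite HM// X0 ltW.
  rewrite /K -addrA ltr_wpDr ?addr_ge0 ?(ltW s0)//.
  near: n; exact: nbhs_infty_gtr.
have mtau := stopped_value_measurable st.
rewrite (@ae_eq_integral _ _ _ P setT (fun w => limn_einf (fun n => (Num.max 0 (S (rho n w) w))%:E)))//.
- apply: (le_trans (fatou P measurableT _ _)).
  + by move=> n; apply/measurable_EFinP; exact: measurable_maxr.
  + by move=> n w _; rewrite lee_fin le_max lexx.
  under eq_fun do rewrite mean.
  by have [-> _] := cvg_limn_einf_sup (cvg_cst s%:E : (fun=> s%:E) @ \oo --> s%:E).
- by apply/measurable_EFinP; exact: measurable_maxr.
- rewrite (_ : (fun w => _) = (fun w => - limn_esup (fun n => - (Num.max 0 (S (rho n w) w))%:E))%E).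
    apply: measurableT_comp => //; apply: measurable_fun_limn_esup => n.
    by apply: measurableT_comp => //; apply/measurable_EFinP; exact: measurable_maxr.
  by apply/funext => w; rewrite -[X in limn_esup X]/(-%E \o _) limn_esupN oppeK.
- by apply: filterS lim => w ->.
Unshelve. all: by end_near. Qed.

End optional_sampling.

(** * The distortion inequality *)

Section distortion.
Variables (R : realType) (w : R -> R).
Hypothesis hw : distortion_function w.

Lemma distortion_le (p q : R) : 0 <= p -> p <= q -> q <= 1 -> w p <= w q.
Proof.
move=> p0; rewrite le_eqVlt => /predU1P[->//|pq] q1.
by have [_ _ H _] := hw; exact/ltW/H.
Qed.

Lemma distortion_continuous (e : R) : 0 < e -> exists2 dl : R, 0 < dl &
  forall p q : R, 0 <= p -> p <= q -> q <= 1 -> q - p < dl -> w q - w p < e.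
Proof.
have [_ _ _ ac] := hw; move=> /ac[dl dl0 H]; exists dl => // p q p0 pq q1 qp.
have := H 1%N (fun=> p) (fun=> q); rewrite !big_ord1 => H1.
apply: le_lt_trans (ler_norm _) (H1 _ _ qp) => //.
by move=> i j _ _ _; rewrite !ord1.
Qed.

Hypothesis hconv : convex_function (`[0, 1]%classic : set R) w.

Lemma distortion_convex (x y z : R) : 0 <= x -> x < y -> y < z -> z <= 1 ->
  w y * (z - x) <= w x * (z - y) + w z * (y - x).
Proof.
move=> x0 xy yz z1; have xz : 0 < z - x by rewrite subr_gt0 (lt_trans xy).
pose t := (z - y) / (z - x).
have t0 : 0 <= t by rewrite divr_ge0 ?ltW// subr_gt0.
have t1 : t <= 1 by rewrite ler_pdivrMr// mul1r lerD2l lerN2 ltW.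
have xin : x \in (`[0, 1]%classic : set R) by rewrite inE /= in_itv/= x0 ltW// (lt_le_trans (lt_trans xy yz)).
have zin : z \in (`[0, 1]%classic : set R) by rewrite inE /= in_itv/= z1 andbT ltW// (le_lt_trans x0 (lt_trans xy yz)).
have : w (t * x + (1 - t) * z) <= t * w x + (1 - t) * w z := hconv (Itv01 t0 t1) xin zin.
have -> : t * x + (1 - t) * z = y by rewrite /t; field; rewrite lt0r_neq0.
have -> : t * w x + (1 - t) * w z = (w x * (z - y) + w z * (y - x)) / (z - x).
  by rewrite /t; field; rewrite lt0r_neq0.
by rewrite ler_pdivlMr.
Qed.

(* Outside [[t, g]] the secant line through [t] and [g] lies below [w]; inside, it exceeds
   [w t] by at most the increment [w g - w t]. *)
Lemma distortion_secant (t g y : R) : 0 <= t -> t < g -> g <= 1 -> 0 <= y <= 1 ->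
  w t + (w g - w t) / (g - t) * (y - g) <= w y.
Proof.
move=> t0 tg g1 /andP[y0 y1]; have gt0 : 0 < g - t by rewrite subr_gt0.
have k0 : 0 <= w g - w t by rewrite subr_ge0 distortion_le// ltW.
rewrite -subr_ge0 -(pmulr_lge0 _ gt0).
have -> : (w y - (w t + (w g - w t) / (g - t) * (y - g))) * (g - t) =
  (w y - w t) * (g - t) - (w g - w t) * (y - g) by field; rewrite lt0r_neq0.
have [yt|ty] := ltP y t.
  have := distortion_convex y0 yt tg g1; nra.
have [yg|gy] := leP y g.
  have wty : 0 <= w y - w t by rewrite subr_ge0 distortion_le.
  have h1 : 0 <= (w g - w t) * (g - y) by rewrite mulr_ge0// subr_ge0.
  have h2 : 0 <= (w y - w t) * (g - t) by rewrite mulr_ge0// ltW.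
  by move: h1 h2; lra.
have := distortion_convex t0 tg gy y1; nra.
Qed.

Lemma measurable_distortion : measurable_fun setT (fun x : R => w (Num.max 0 (Num.min 1 x))).
Proof.
apply: nondecreasing_measurable => // x y xy; apply: distortion_le.
- by rewrite le_max lexx.
- rewrite ge_max le_max lexx/= le_max; apply/orP; right.
  by rewrite le_min ge_min lexx/= ge_min xy orbT.
- by rewrite ge_max ler01 ge_min lexx.
Qed.

End distortion.

Section payoff.
Variables (R : realType) (u : R -> R).
Hypothesis hu : payoff_function u.

Lemma payoff_le (x y : R) : 0 <= x -> x <= y -> u x <= u y.
Proof. by have [_ _ H _] := hu; exact: H. Qed.

Lemma payoff_ge0 (x : R) : 0 <= x -> 0 <= u x.
Proof. by have [_ H _ _] := hu; exact: H. Qed.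

Lemma measurable_payoff : measurable_fun setT (fun x : R => u (Num.max 0 x)).
Proof.
apply: nondecreasing_measurable => // x y xy; apply: payoff_le; first by rewrite le_max lexx.
by rewrite ge_max le_max lexx/= le_max xy orbT.
Qed.

End payoff.

Section survival.
Context (R : realType) d (Omega : measurableType d) (P : probability Omega R).
Variables (w : R -> R).
Hypothesis hw : distortion_function w.

Lemma probability_itv (A : set Omega) : measurable A -> 0 <= fine (P A) <= 1.
Proof.
move=> mA; rewrite fine_ge0//=; have := probability_le1 P mA.
by rewrite -lee_fin fineK// fin_num_measure.
Qed.

Lemma measurable_survival (E : R -> set Omega) : (forall x, measurable (E x)) ->
  (forall x y, x <= y -> E y `<=` E x) -> measurable_fun setT (fun x => (w (fine (P (E x))))%:E).
Proof.
move=> mE dE; apply/measurable_EFinP; apply: nonincreasing_measurable => // x y xy.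
have /andP[y0 _] := probability_itv (mE y); have /andP[_ x1] := probability_itv (mE x).
apply: distortion_le => //; apply: fine_le; rewrite ?fin_num_measure//.
by apply: le_measure; rewrite ?inE//; exact: dE.
Qed.

End survival.

Section two_point.
Variables (R : realType) (u w : R -> R) (s V : R).
Hypotheses (hu : payoff_function u) (hw : distortion_function w) (s0 : 0 < s).
Hypothesis twoV : forall ab, admissible s ab -> two_point_value u w s ab <= V.

Lemma two_point_bound_ge0 : 0 <= V.
Proof.
have adm : admissible s (s, s) by split.
by apply: le_trans (twoV adm); rewrite /two_point_value eqxx payoff_ge0// ltW.
Qed.

Lemma two_point_weight (a b : R) : a <= s -> s < b -> 0 <= (s - a) / (b - a) <= 1.
Proof.
move=> a_s sb; have ab : 0 < b - a by rewrite subr_gt0 (le_lt_trans a_s).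
apply/andP; split; first by rewrite divr_ge0 ?subr_ge0// ltW// -subr_gt0.
by rewrite ler_pdivrMr// mul1r lerD2r ltW.
Qed.

(* The paper excludes [a = 0]; it is a limit of admissible pairs. *)
Lemma two_point_bound (a b : R) : 0 <= a -> a <= s -> s < b ->
  u a + w ((s - a) / (b - a)) * (u b - u a) <= V.
Proof.
have [_ w01 _ _] := hw.
have pos a' : 0 < a' -> a' <= s -> s < b -> u a' + w ((s - a') / (b - a')) * (u b - u a') <= V.
  move=> a0 a_s sb; have adm : admissible s (a', b) by split => //=; exact: ltW.
  apply: le_trans (twoV adm); rewrite /two_point_value lt_eqF ?(le_lt_trans a_s)//.
  by rewrite le_eqVlt; apply/orP; left; apply/eqP; ring.
rewrite le_eqVlt => /predU1P[<-|]; last exact: pos.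
move=> _ sb; have b0 := lt_trans s0 sb.
have [-> _ _ _] := hu; rewrite !subr0 add0r.
have := payoff_ge0 hu (ltW b0); rewrite le_eqVlt => /predU1P[<-|ub0].
  by rewrite mulr0 two_point_bound_ge0.
apply/ler_addgt0Pr => e e0; have [dl dl0 Hdl] := distortion_continuous hw (divr_gt0 e0 ub0).
(* Raising the lower point from [0] to [a'] lowers the weight by [a' * (b - s) / (b * (b - a'))],
   which is at most [a' / b] because [a' <= s]; so this choice keeps the loss below [dl]. *)
pose a' := Num.min s (b * dl / 2).
have a'0 : 0 < a' by rewrite lt_min s0 divr_gt0// mulr_gt0.
have a's : a' <= s by rewrite ge_min lexx.
have a'b : a' <= b * dl / 2 by rewrite ge_min lexx orbT.
have ba' : 0 < b - a' by rewrite subr_gt0 (le_lt_trans a's).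
have /andP[p0 p1] := two_point_weight a's sb.
have sb1 : s / b <= 1 by rewrite ler_pdivrMr// mul1r ltW.
have E : s / b - (s - a') / (b - a') = a' * (b - s) / (b * (b - a')).
  by field; rewrite !lt0r_neq0.
have ps : (s - a') / (b - a') <= s / b.
  by rewrite -subr_ge0 E divr_ge0 ?mulr_ge0 ?(ltW a'0) ?(ltW b0) ?(ltW ba') ?subr_ge0 ?(ltW sb).
have pd : s / b - (s - a') / (b - a') < dl.
  rewrite E ltr_pdivrMr ?mulr_gt0//; apply: (@le_lt_trans _ _ (b * dl / 2 * (b - a'))).
    by apply: ler_pM => //; [exact: ltW|rewrite subr_ge0 ltW|rewrite lerD2l lerN2].
  have -> : dl * (b * (b - a')) = b * dl * (b - a') by ring.
  by rewrite ltr_pM2r// ltr_pdivrMr// ltr_pMr ?mulr_gt0// ltr1n.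
have := Hdl _ _ p0 ps sb1 pd; rewrite ltr_pdivlMr// => wd.
have := pos a' a'0 a's sb.
have /andP[w0 w1] := w01 _ (two_point_weight a's sb).
have : 0 <= (1 - w ((s - a') / (b - a'))) * u a' by rewrite mulr_ge0 ?subr_ge0// payoff_ge0// ltW.
by move: wd; move: (w _) (w _) (u _) (u _) => x y z t; lra.
Qed.

End two_point.

Lemma integral_itv_indic (R : realType) (D : set (measurableTypeR R)) (r : R) : 0 <= r ->
  measurable D -> `[0, r[%classic `<=` D ->
  (\int[@lebesgue_measure R]_(x in D) (\1_(`[0, r[%classic : set (measurableTypeR R)) x : R)%:E = r%:E)%E.
Proof.
move=> r0 mD rD; have mJ : measurable (`[0, r[%classic : set (measurableTypeR R)) by exact: measurable_itv.
transitivity (@lebesgue_measure R (`[0, r[%classic : set R)).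
  by rewrite integral_indic//; congr (lebesgue_measure _); exact/setIidPl.
rewrite lebesgue_measure_itv /= lte_fin -EFinB subr0.
by case: ltP => // r0'; congr (_%:E); apply/le_anti; rewrite r0 r0'.
Qed.

(** * Mixtures of two-point laws and Jensen's inequality *)

Section mixture.
Context (R : realType) d (Omega : measurableType d) (P : probability Omega R).
Variables (u w : R -> R) (s V : R) (Y : Omega -> R).
Hypotheses (hu : payoff_function u) (hw : distortion_function w) (s0 : 0 < s).
Hypothesis hconv : convex_function (`[0, 1]%classic : set R) w.
Hypothesis twoV : forall ab, admissible s ab -> two_point_value u w s ab <= V.
Hypotheses (mY : measurable_fun setT Y) (Y0 : forall om, 0 <= Y om).
Hypothesis meanY : (\int[P]_om (Y om)%:E = s%:E)%E.

Lemma integral_product_mul (f g : Omega -> R) : measurable_fun setT f -> measurable_fun setT g ->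
  (forall om, 0 <= f om) -> (forall om, 0 <= g om) ->
  (\int[P \x P]_z (f z.1 * g z.2)%:E = (\int[P]_om (f om)%:E) * (\int[P]_om (g om)%:E))%E.
Proof.
move=> mf mg f0 g0; rewrite fubini_tonelli1//; last 2 first.
- apply/measurable_EFinP; apply: measurable_funM.
    by apply: measurableT_comp => //; exact: measurable_fst.
  by apply: measurableT_comp => //; exact: measurable_snd.
- by move=> z; rewrite lee_fin mulr_ge0.
have g_ge0 : (0 <= \int[P]_om (g om)%:E)%E by apply: integral_ge0 => om _; rewrite lee_fin.
rewrite -ge0_integralZr//; last 2 first.
- exact/measurable_EFinP.
- by move=> om _; rewrite lee_fin.
apply: eq_integral => x _; rewrite /fubini_F /=.
under eq_integral do rewrite EFinM; rewrite ge0_integralZl//.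
- exact/measurable_EFinP.
- by move=> om _; rewrite lee_fin.
- by rewrite lee_fin.
Qed.

Let alpha om := Num.max 0 (s - Y om).
Let beta om := Num.max 0 (Y om - s).
Let low := [set om | Y om <= s].
Let high := [set om | s < Y om].
Let m := fine (\int[P]_om (beta om)%:E)%E.

Let malpha : measurable_fun setT alpha.
Proof. by apply: measurable_maxr => //; exact: measurable_funB. Qed.
Let mbeta : measurable_fun setT beta.
Proof. by apply: measurable_maxr => //; exact: measurable_funB. Qed.
Let mlow : measurable low. Proof. exact: measurable_set_le. Qed.
Let mhigh : measurable high. Proof. exact: measurable_set_lt. Qed.

Let iY : P.-integrable setT (EFin \o Y).
Proof.
apply/integrableP; split; first exact/measurable_EFinP.
by under eq_integral do rewrite /= ger0_norm//; rewrite meanY ltry.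
Qed.

Let alpha0 om : 0 <= alpha om. Proof. by rewrite le_max lexx. Qed.
Let beta0 om : 0 <= beta om. Proof. by rewrite le_max lexx. Qed.

Let ialpha : P.-integrable setT (EFin \o alpha).
Proof.
apply: (@square_integrable_integrable _ _ _ P); apply: (@square_integrable_bounded _ _ _ _ _ s) => // om.
by rewrite ger0_norm// /alpha ge_max ltW//= gerBl.
Qed.

Let betaE om : beta om = Y om - s + alpha om.
Proof. by rewrite /beta /alpha; case: leP => H1; case: leP => H2; move: H1 H2; lra. Qed.

Let is_ : P.-integrable setT (EFin \o cst s).
Proof. exact: finite_measure_integrable_cst. Qed.

Let iYs : P.-integrable setT (EFin \o (fun om => Y om - s)).
Proof. exact: (integrableB measurableT iY is_). Qed.

Let integral_beta : (\int[P]_om (beta om)%:E = m%:E)%E.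
Proof.
rewrite /m fineK//; apply: integrable_fin_num => //.
rewrite (_ : (fun om => _) = (fun om => (Y om - s)%:E + (alpha om)%:E)%E).
  exact: (integrableD measurableT iYs ialpha).
by apply/funext => om; rewrite betaE EFinD.
Qed.

Let integral_alpha : (\int[P]_om (alpha om)%:E = m%:E)%E.
Proof.
have Ym : (\int[P]_om Y om)%R = s by rewrite /Rintegral meanY.
rewrite -(fineK (integrable_fin_num measurableT ialpha)); congr (_%:E).
rewrite -/(Rintegral P setT alpha) /m -/(Rintegral P setT beta).
rewrite (_ : beta = fun om => Y om - s + alpha om); last by apply/funext => om; exact: betaE.
by rewrite RintegralD// RintegralB// Rintegral_cst//= probability_setT Ym mulr1 subrr add0r.
Qed.

(* The law of [Y] is the mixture of the two-point laws of mean [s] on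
   [{Y z.1, Y z.2}], [Y z.1 <= s < Y z.2], with density [kern setT] against [P \x P]. *)
Let kern (C : set Omega) (z : Omega * Omega) : R :=
  alpha z.1 * \1_(C `&` high) z.2 + \1_(C `&` low) z.1 * beta z.2.

Let kern_ge0 C z : 0 <= kern C z.
Proof. by rewrite addr_ge0// mulr_ge0. Qed.

Let mkern C : measurable C -> measurable_fun setT (kern C).
Proof.
move=> mC; have h1 : measurable (C `&` high) by exact: measurableI.
have h2 : measurable (C `&` low) by exact: measurableI.
apply: measurable_funD; apply: measurable_funM; (apply: measurableT_comp;
  [|exact: measurable_fst || exact: measurable_snd]) => //; exact: measurable_indic.
Qed.

(** Since [Y] has mean [s], [alpha] and [beta] have the same expectation [m]. The parts of [C] above
    and below [s] thus receive the same factor and recombine into [P C]. *)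
Let integral_kern C : measurable C -> (\int[P \x P]_z (kern C z)%:E = (m * fine (P C))%:E)%E.
Proof.
move=> mC; have h1 : measurable (C `&` high) by exact: measurableI.
have h2 : measurable (C `&` low) by exact: measurableI.
under eq_integral do rewrite EFinD.
rewrite ge0_integralD//; last 4 first.
- by move=> z _; rewrite lee_fin mulr_ge0.
- apply/measurable_EFinP; apply: measurable_funM; (apply: measurableT_comp;
  [|exact: measurable_fst || exact: measurable_snd]) => //; exact: measurable_indic.
- by move=> z _; rewrite lee_fin mulr_ge0.
- apply/measurable_EFinP; apply: measurable_funM; (apply: measurableT_comp;
  [|exact: measurable_fst || exact: measurable_snd]) => //; exact: measurable_indic.
rewrite !integral_product_mul//.
rewrite integral_alpha integral_beta !integral_indic// !setIT muleC -ge0_muleDl//.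
transitivity (P C * m%:E)%E; last by rewrite -{1}(fineK (fin_num_measure P _ mC)) -EFinM mulrC.
congr (_ * _)%E.
rewrite -measureU//; last first.
  by apply/seteqP; split => om //= [[_ h] [_ l]]; move: h; rewrite /high /= ltNge l.
by congr (P _); rewrite -setIUr (_ : high `|` low = setT) ?setIT//; apply/seteqP; split => om //= _; rewrite /high /low /=; case: (leP (Y om) s); [right|left].
Qed.

Let C (x : R) : set Omega := [set om | x < u (Y om)].

Let muY : measurable_fun setT (u \o Y).
Proof.
have -> : u \o Y = (fun x : R => u (Num.max 0 x)) \o Y by apply/funext => om /=; rewrite max_r.
by apply: measurableT_comp => //; exact: measurable_payoff.
Qed.

Let mC x : measurable (C x). Proof. exact: measurable_set_lt. Qed.

Let region : set (Omega * measurableTypeR R) :=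
  [set p | 0 <= (p.2 : R)] `&` [set p | (p.2 : R) < u (Y p.1)].

Let mregion : measurable region.
Proof.
have m2 : measurable_fun setT (fun p : Omega * measurableTypeR R => p.2 : R) by exact: measurable_snd.
apply: measurableI; first exact: measurable_set_le.
apply: measurable_set_lt => //.
by apply: (@measurableT_comp _ _ _ _ _ _ (u \o Y)) => //; exact: measurable_fst.
Qed.

Let region_integral om :
  (\int[@lebesgue_measure R]_x (\1_region (om, x) : R)%:E = (u (Y om))%:E)%E.
Proof.
have uY0 : 0 <= u (Y om) by exact: payoff_ge0.
rewrite -[RHS](integral_itv_indic uY0 measurableT)//.
apply: eq_integral => x _; rewrite !indicE; congr ((nat_of_bool _)%:R%:E).
by apply/idP/idP; rewrite !inE /region /= in_itv/= => /andP.
Qed.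

(** The distorted weight of the upper point [Y z.2]. The reciprocal is written through [expR] and
    [ln], which are measurable, and is correct for a positive gap; [kern] vanishes at all pairs not
    separated by [s]. Clipping keeps the argument in the domain of [w]. *)
Let W (z : Omega * Omega) : R := w (Num.max 0 (Num.min 1 ((s - Y z.1) * expR (- ln (Y z.2 - Y z.1))))).

Let W01 z : 0 <= W z <= 1.
Proof. by have [_ H _ _] := hw; apply: H; rewrite le_max lexx/= ge_max ler01 ge_min lexx. Qed.

Let WE z : Y z.1 <= s -> s < Y z.2 -> W z = w ((s - Y z.1) / (Y z.2 - Y z.1)).
Proof. by move=> h1 h2; have /andP[p0 p1] := two_point_weight h1 h2; rewrite /W expRN lnK ?min_r ?max_r// posrE subr_gt0 (le_lt_trans h1). Qed.

Let mW : measurable_fun setT W.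
Proof.
have m1 : measurable_fun setT (fun z : Omega * Omega => Y z.1).
  by apply: measurableT_comp => //; exact: measurable_fst.
have m2 : measurable_fun setT (fun z : Omega * Omega => Y z.2).
  by apply: measurableT_comp => //; exact: measurable_snd.
apply: (@measurableT_comp _ _ _ _ _ _ (fun x : R => w (Num.max 0 (Num.min 1 x)))).
  exact: measurable_distortion.
apply: measurable_funM; first exact: measurable_funB.
apply: measurableT_comp; first exact: measurable_expR.
apply: measurableT_comp => //; apply: measurableT_comp; first exact: measurable_ln.
exact: measurable_funB.
Qed.

(** The distorted survival function at level [x] of the two-point law attached to [z], times its
    density. Integrated in [x] it gives the two-point value times the density; integrated in [z] it
    dominates the distorted survival function of [u] at [Y] times [m], by Jensen's inequality. *)
Let N (z : Omega * Omega) (x : R) : R :=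
  kern setT z * ((1 - W z) * \1_region (z.1, x) + W z * \1_region (z.2, x)).

Let N_ge0 z x : 0 <= N z x.
Proof.
have /andP[w0 w1] := W01 z.
by rewrite mulr_ge0// addr_ge0// mulr_ge0// ?subr_ge0// indicE.
Qed.

Let mN : measurable_fun setT (fun p : (Omega * Omega) * measurableTypeR R => (N p.1 p.2)%:E).
Proof.
have mf : measurable_fun setT (fun p : (Omega * Omega) * measurableTypeR R => p.1) by exact: measurable_fst.
have ms : measurable_fun setT (fun p : (Omega * Omega) * measurableTypeR R => p.2) by exact: measurable_snd.
have mr (g : Omega * Omega -> Omega) : measurable_fun setT g ->
    measurable_fun setT (fun p : (Omega * Omega) * measurableTypeR R => \1_region (g p.1, p.2) : R).
  move=> mg; apply: (@measurableT_comp _ _ _ _ _ _ (\1_region : _ -> R)); first exact: measurable_indic.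
  by apply: measurable_fun_pair => //; exact: measurableT_comp.
apply/measurable_EFinP; apply: measurable_funM.
  by apply: (@measurableT_comp _ _ _ _ _ _ (kern setT)) => //; exact: mkern.
have mWp : measurable_fun setT (fun p : (Omega * Omega) * measurableTypeR R => W p.1).
  exact: (@measurableT_comp _ _ _ _ _ _ W).
apply: measurable_funD; apply: measurable_funM => //.
- exact: measurable_funB.
- by apply: mr; exact: measurable_fst.
- by apply: mr; exact: measurable_snd.
Qed.

Let kern_out A z : ~~ (Y z.1 <= s < Y z.2) -> kern A z = 0.
Proof.
rewrite negb_and -ltNge -leNgt /kern !indicE => /orP[h|h].
  have -> : alpha z.1 = 0 by rewrite /alpha max_l// subr_le0 ltW.
  by rewrite mul0r add0r memNset ?mul0r// => -[_]; rewrite /low /= leNgt h.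
have -> : beta z.2 = 0 by rewrite /beta max_l// subr_le0.
by rewrite mulr0 addr0 memNset ?mulr0// => -[_]; rewrite /high /= ltNge h.
Qed.

Let kern_in A z : Y z.1 <= s -> s < Y z.2 ->
  kern A z = (s - Y z.1) * \1_A z.2 + \1_A z.1 * (Y z.2 - s).
Proof.
move=> h1 h2; rewrite /kern /alpha /beta !max_r ?subr_ge0 ?(ltW h2)// !indicE.
congr (_ * (nat_of_bool _)%:R + (nat_of_bool _)%:R * _).
  by apply/idP/idP; rewrite !inE; [case|split].
by apply/idP/idP; rewrite !inE; [case|split].
Qed.

(** A supporting line of [w] at [g] would be the natural tool, but its slope may be infinite at
    [g = 1]. A lowered secant through some [t < g] replaces it, at the price of [w t] instead of
    [w g]. *)
Let jensen_pointwise (x t g : R) z : 0 <= x -> 0 <= t -> t < g -> g <= 1 ->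
  w t * kern setT z + (w g - w t) / (g - t) * kern (C x) z <=
  N z x + (w g - w t) / (g - t) * g * kern setT z.
Proof.
move=> x0 t0 tg g1; set k := _ / _; rewrite /N.
have [/andP[h1 h2]|out] := boolP (Y z.1 <= s < Y z.2); last by rewrite !kern_out// !(mulr0, mul0r, addr0).
have ab : 0 < Y z.2 - Y z.1 by rewrite subr_gt0 (le_lt_trans h1).
rewrite !kern_in// WE// !indicT /cst /= mulr1 mul1r.
have -> : s - Y z.1 + (Y z.2 - s) = Y z.2 - Y z.1 by ring.
have regE om : \1_region (om, x) = \1_(C x) om :> R.
  rewrite !indicE; congr ((nat_of_bool _)%:R); apply/idP/idP; rewrite !inE /region /C /=.
    by case.
  by move=> h; split.
rewrite !regE; set p := (s - Y z.1) / _.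
have pE : s - Y z.1 = p * (Y z.2 - Y z.1) by rewrite /p divfK// lt0r_neq0.
have qE : Y z.2 - s = (1 - p) * (Y z.2 - Y z.1) by rewrite mulrBl mul1r -pE; ring.
have C12 : \1_(C x) z.1 <= \1_(C x) z.2 :> R.
  rewrite !indicE ler_nat; case: (boolP (z.1 \in _)) => // /set_mem h.
  by rewrite mem_set// /C /=; apply: lt_le_trans h _; apply: payoff_le => //; exact: le_trans h1 (ltW h2).
rewrite pE qE.
have sec y : 0 <= y <= 1 -> w t + k * (y - g) <= w y by exact: distortion_secant.
have [[w0 w1] _ _ _] := hw.
suff H : w t + k * (p * \1_(C x) z.2 + (1 - p) * \1_(C x) z.1 - g) <=
    (1 - w p) * \1_(C x) z.1 + w p * \1_(C x) z.2.
  have := ler_wpM2r (ltW ab) H; rewrite -subr_ge0 => {}H; rewrite -subr_ge0; apply: le_trans H _.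
  by rewrite le_eqVlt; apply/orP; left; apply/eqP; ring.
(* As [u] is nondecreasing, the two-point law exceeds level [x] with probability [1], [p] or [0];
   the secant bound is applied at each of these arguments of [w]. *)
move: C12; rewrite !indicE; case: (_ \in _); case: (_ \in _); rewrite /= ?ler10// => _.
- by have := sec 1; rewrite ler01 lexx w1 => /(_ isT); rewrite !mulr1 !subrK (addrC p) subrK.
- by have := sec p (two_point_weight h1 h2); rewrite !mulr1 !mulr0 addr0 add0r.
- by have := sec 0; rewrite ler01 lexx w0 => /(_ isT); rewrite !mulr0 addr0.
Qed.

Let m_ge0 : 0 <= m.
Proof. by rewrite fine_ge0//; apply: integral_ge0 => om _; rewrite lee_fin. Qed.

(** The mixture restores the probability [g] of [C x], so after integration the terms linear in the
    slope are equal and finite on both sides and cancel. *)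
Let jensen_below (x t : R) : 0 <= x -> 0 <= t -> t < fine (P (C x)) ->
  ((m * w t)%:E <= \int[P \x P]_z (N z x)%:E)%E.
Proof.
set g := fine _ => x0 t0 tg.
have /andP[g0 g1] : 0 <= g <= 1 by exact: probability_itv.
have mNx : measurable_fun setT (fun z => (N z x)%:E).
  exact: (measurable_fun_pair1 x mN).
have wt0 : 0 <= w t.
  by have [_ H _ _] := hw; have /H/andP[] : 0 <= t <= 1 by rewrite t0 (le_trans (ltW tg)).
pose k := (w g - w t) / (g - t).
have k0 : 0 <= k by rewrite divr_ge0 ?subr_ge0 ?(ltW tg)// distortion_le// ltW.
have kg0 : 0 <= k * g by exact: mulr_ge0.
have mk A : measurable A -> measurable_fun setT (fun z => (kern A z)%:E).
  by move=> mA; apply/measurable_EFinP; exact: mkern.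
have mT : measurable [set: Omega] by exact: measurableT.
have H : (\int[P \x P]_z (w t * kern setT z + k * kern (C x) z)%:E <=
    \int[P \x P]_z (N z x + k * g * kern setT z)%:E)%E.
  apply: ge0_le_integral => //.
  - by move=> z _; rewrite lee_fin addr_ge0// mulr_ge0.
  - by apply/measurable_EFinP; apply: measurable_funD; apply: measurable_funM => //; exact: mkern.
  - apply/measurable_EFinP; apply: measurable_funD; first exact/measurable_EFinP.
    by apply: measurable_funM => //; exact: mkern.
  - by move=> z _; rewrite lee_fin; exact: jensen_pointwise.
have E1 : (\int[P \x P]_z (w t * kern setT z + k * kern (C x) z)%:E = (w t * m + k * (m * g))%:E)%E.
  under eq_integral do rewrite EFinD.
  rewrite ge0_integralD//; last 4 first.
  - by move=> z _; rewrite lee_fin mulr_ge0.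
  - by apply/measurable_EFinP; apply: measurable_funM => //; exact: mkern.
  - by move=> z _; rewrite lee_fin mulr_ge0.
  - by apply/measurable_EFinP; apply: measurable_funM => //; exact: mkern.
  under eq_integral do rewrite EFinM.
  rewrite ge0_integralZl_EFin//; [|by move=> z _; rewrite lee_fin|exact: mk].
  under [X in (_ + X)%E]eq_integral do rewrite EFinM.
  rewrite ge0_integralZl_EFin//; [|by move=> z _; rewrite lee_fin|exact: mk].
  by rewrite !integral_kern// probability_setT/= mulr1 -!EFinM -EFinD.
have E2 : (\int[P \x P]_z (N z x + k * g * kern setT z)%:E =
    \int[P \x P]_z (N z x)%:E + (k * g * m)%:E)%E.
  under eq_integral do rewrite EFinD.
  rewrite ge0_integralD//; last 3 first.
  - by move=> z _; rewrite lee_fin.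
  - by move=> z _; rewrite lee_fin; apply: mulr_ge0 => //; exact: mulr_ge0.
  - by apply/measurable_EFinP; apply: measurable_funM => //; exact: mkern.
  under [X in (_ + X)%E]eq_integral do rewrite EFinM.
  rewrite ge0_integralZl_EFin//; [|by move=> z _; rewrite lee_fin|exact: mk].
  by rewrite integral_kern// probability_setT/= mulr1 -EFinM.
move: H; rewrite E1 E2 (_ : w t * m + k * (m * g) = m * w t + k * g * m); last by ring.
by rewrite EFinD leeD2rE.
Qed.

Let jensen (x : R) : 0 <= x -> ((m * w (fine (P (C x))))%:E <= \int[P \x P]_z (N z x)%:E)%E.
Proof.
move=> x0; have /andP[] := probability_itv P (mC x); set g := fine _ => g0 g1.
have [[w0 _] _ _ _] := hw.
move: g0; rewrite le_eqVlt => /predU1P[<-|g0].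
  by rewrite w0 mulr0; apply: integral_ge0 => z _; rewrite lee_fin.
apply/lee_addgt0Pr => e e0.
have e1 : 0 < e / (m + 1) by rewrite divr_gt0// ltr_wpDl.
have [dl dl0 Hdl] := distortion_continuous hw e1.
pose t := Num.max 0 (g - dl / 2).
have t0 : 0 <= t by rewrite le_max lexx.
have tg : t < g by rewrite gt_max g0/= ltrBlDr ltrDl divr_gt0.
have gt : g - t < dl.
  have : g - dl / 2 <= t by rewrite le_max lexx orbT.
  lra.
have := Hdl _ _ t0 (ltW tg) g1 gt; rewrite ltr_pdivlMr ?ltr_wpDl// => wd.
apply: (@le_trans _ _ ((m * w t)%:E + e%:E)%E); last by apply: leeD2r; exact: jensen_below.
rewrite -EFinD lee_fin.
have wtg : w t <= w g by exact: distortion_le (ltW tg) _.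
move: wd; nra.
Qed.

Let outer z : (\int[@lebesgue_measure R]_x (N z x)%:E <= (V * kern setT z)%:E)%E.
Proof.
have /andP[w0 w1] := W01 z.
have [/andP[h1 h2]|out] := boolP (Y z.1 <= s < Y z.2); last first.
  by rewrite kern_out// mulr0; under eq_integral do rewrite /N kern_out// mul0r; rewrite integral0.
have mr om : measurable_fun setT (fun x : measurableTypeR R => (\1_region (om, x) : R)%:E).
  have := @measurable_indic _ _ R setT _ mregion => /measurable_EFinP H.
  exact: (measurable_fun_pair2 om H).
have -> : (\int[@lebesgue_measure R]_x (N z x)%:E =
   (kern setT z * ((1 - W z) * u (Y z.1) + W z * u (Y z.2)))%:E)%E.
  under eq_integral do rewrite /N mulrDr !mulrA EFinD !(EFinM (_ * _)).
  rewrite ge0_integralD//; last 4 first.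
  - by move=> x _; rewrite lee_fin !mulr_ge0// subr_ge0.
  - by apply: measurable_funeM; exact: mr.
  - by move=> x _; rewrite lee_fin !mulr_ge0.
  - by apply: measurable_funeM; exact: mr.
  rewrite !ge0_integralZl_EFin ?mulr_ge0 ?subr_ge0//; try by move=> x _; rewrite lee_fin.
  by rewrite !region_integral -!EFinM -EFinD; congr (_%:E); ring.
rewrite lee_fin mulrC; apply: ler_wpM2r => //.
rewrite WE//; apply: le_trans (two_point_bound hu hw s0 twoV (Y0 _) h1 h2).
by rewrite le_eqVlt; apply/orP; left; apply/eqP; ring.
Qed.

(** Tonelli's theorem exchanges level and pair: [m] times the distorted payoff is at most the double
    integral of [N], which is at most [V * m]. Dividing requires [0 < m]. *)
Let mixture_nondegenerate : 0 < m ->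
  (\int[@lebesgue_measure R]_(x in `[0%R, +oo[) (w (fine (P (C x))))%:E <= V%:E)%E.
Proof.
move=> m0.
have mI : measurable (`[0, +oo[%classic : set (measurableTypeR R)) by exact: measurable_itv.
have msurv : measurable_fun setT (fun x : measurableTypeR R => (w (fine (P (C x))))%:E).
  apply: (measurable_survival P hw mC) => x y xy om /=; exact: le_lt_trans.
have wge0 x : 0 <= w (fine (P (C x))).
  by have [_ H _ _] := hw; have /andP[] := H _ (probability_itv P (mC x)).
rewrite -(lee_pmul2l (x := m%:E)) ?lte_fin//.
rewrite -ge0_integralZl_EFin//; last 2 first.
- by move=> x _; rewrite lee_fin.
- exact: measurable_funTS.
pose PP : probability (Omega * Omega)%type R := (P \x P)%E.
have NE0 (p : (Omega * Omega) * measurableTypeR R) : (0 <= (N p.1 p.2)%:E)%E by rewrite lee_fin.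
have mG : measurable_fun setT (fun x : measurableTypeR R => \int[P \x P]_z (N z x)%:E)%E.
  exact: (measurable_fun_fubini_tonelli_G (m1 := PP) _ mN NE0).
have Ige0 x : (0 <= \int[P \x P]_z (N z x)%:E)%E by apply: integral_ge0 => z _; rewrite lee_fin.
apply: (@le_trans _ _ (\int[@lebesgue_measure R]_(x in `[0%R, +oo[) \int[P \x P]_z (N z x)%:E)%E).
  apply: ge0_le_integral => //.
  - by move=> x _; rewrite -EFinM lee_fin mulr_ge0.
  - by apply: measurable_funeM; exact: measurable_funTS.
  - exact: measurable_funTS.
  - by move=> x /=; rewrite in_itv/= andbT => x0; exact: jensen.
apply: (@le_trans _ _ (\int[@lebesgue_measure R]_x \int[P \x P]_z (N z x)%:E)%E).
  by apply: ge0_subset_integral.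
rewrite -(fubini_tonelli (m1 := PP) (m2 := @lebesgue_measure R) (fun p => (N p.1 p.2)%:E) mN NE0).
apply: (@le_trans _ _ (\int[P \x P]_z (V * kern setT z)%:E)%E).
  apply: ge0_le_integral => //.
  - by move=> z _; apply: integral_ge0 => x _; rewrite lee_fin.
  - exact: (measurable_fun_fubini_tonelli_F (m2 := @lebesgue_measure R) _ mN NE0).
  - by apply/measurable_EFinP; apply: measurable_funM => //; exact: mkern.
  - by move=> z _; exact: outer.
under eq_integral do rewrite EFinM.
rewrite ge0_integralZl_EFin//; last 3 first.
- by move=> z _; rewrite lee_fin.
- by apply/measurable_EFinP; exact: mkern.
- exact: (two_point_bound_ge0 hu s0 twoV).
by rewrite integral_kern// probability_setT/= mulr1 -EFinM mulrC.
Qed.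

Let ae_eq0 (f : Omega -> R) : measurable_fun setT f -> (forall om, 0 <= f om) ->
  (\int[P]_om (f om)%:E = 0)%E -> {ae P, forall om, f om = 0}.
Proof.
move=> mf f0 If; have mfE : measurable_fun setT (EFin \o f) by exact/measurable_EFinP.
have := (ae_eq_integral_abs P measurableT mfE).1; rewrite /= => H.
have {}H : ae_eq P setT (EFin \o f) (cst 0%E).
  by apply: H; under eq_integral do rewrite ger0_norm//.
by apply: filterS H => om /(_ I) /= [].
Qed.

Lemma distorted_payoff_le :
  (\int[@lebesgue_measure R]_(x in `[0%R, +oo[) (w (fine (P [set om | x < u (Y om)])))%:E <= V%:E)%E.
Proof.
(* If [m = 0] there is no mixture to normalize, but then [alpha] and [beta] vanish almost surely,
   [Y] is almost surely [s], and the degenerate pair [(s, s)] provides the bound. *)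
move: m_ge0; rewrite le_eqVlt => /predU1P[m0|]; last exact: mixture_nondegenerate.
have Ys : {ae P, forall om, Y om = s}.
  have H1 := ae_eq0 malpha alpha0 (etrans integral_alpha (congr1 EFin (esym m0))).
  have H2 := ae_eq0 mbeta beta0 (etrans integral_beta (congr1 EFin (esym m0))).
  by apply: filterS2 H1 H2 => om; have := betaE om; move: (beta om) (alpha om) => x y; lra.
have [[w0 w1] w01 _ _] := hw.
have us0 : 0 <= u s by rewrite payoff_ge0// ltW.
have mI : measurable (`[0, +oo[%classic : set (measurableTypeR R)) by exact: measurable_itv.
have mJ : measurable (`[0, u s[%classic : set (measurableTypeR R)) by exact: measurable_itv.
have msurv : measurable_fun setT (fun x : measurableTypeR R => (w (fine (P (C x))))%:E).
  apply: (measurable_survival P hw mC) => x y xy om /=; exact: le_lt_trans.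
apply: (@le_trans _ _ (\int[@lebesgue_measure R]_x (\1_(`[0, u s[%classic : set (measurableTypeR R)) x : R)%:E)%E).
  rewrite [leLHS]integral_mkcond; apply: ge0_le_integral => //.
  - move=> x _; rewrite patchE; case: ifP => // _; rewrite lee_fin.
    by have /andP[] := w01 _ (probability_itv P (mC x)).
  - by apply/(measurable_restrictT _ mI); exact: measurable_funTS.
  - by apply/measurable_EFinP; exact: measurable_indic.
  move=> x _; rewrite patchE; case: ifPn; last by rewrite lee_fin.
  rewrite inE /= in_itv/= andbT => x0; rewrite lee_fin indicE.
  have [xu|ux] := ltP x (u s).
    rewrite mem_set /= ?in_itv/= ?x0//.
    by have /andP[] := w01 _ (probability_itv P (mC x)).
  have -> : P (C x) = 0%E.
    apply: measure_negligible => //; move: Ys => [A [mA A0 sub]]; exists A; split => //.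
    by apply: subset_trans sub => om /=; rewrite /C /= => xY Ysom; move: xY; rewrite Ysom ltNge ux.
  by rewrite /= w0.
rewrite integral_itv_indic//.
have adm : admissible s (s, s) by split.
by rewrite lee_fin; apply: le_trans (twoV adm); rewrite /two_point_value eqxx.
Qed.

End mixture.

(** * The optimal stopping problem *)

Section optimal_stopping.
Context (R : realType) d (Omega : measurableType d) (P : probability Omega R).
Variables (u w : R -> R).
Hypotheses (hu : payoff_function u) (hw : distortion_function w).

Lemma ae_eq_probability (A D : set Omega) : measurable A -> measurable D ->
  {ae P, forall om, A om <-> D om} -> fine (P A) = fine (P D).
Proof.
move=> mA mD AD; rewrite -!Rintegral_indic_probability//.
apply: (@ae_eq_Rintegral _ _ _ P); [exact: measurable_indic|exact: measurable_indic|].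
apply: filterS AD => om AD; rewrite !indicE; congr ((nat_of_bool _)%:R).
by apply/idP/idP; rewrite !inE => /AD.
Qed.

Lemma measurable_payoff_event (X : Omega -> R) (x : R) : measurable_fun setT X ->
  measurable [set om | 0 <= X om /\ x < u (X om)].
Proof.
move=> mX.
have -> : [set om | 0 <= X om /\ x < u (X om)] =
    [set om | 0 <= X om] `&` [set om | x < u (Num.max 0 (X om))].
  by apply/seteqP; split => om /= [X0]; rewrite max_r.
apply: measurableI; first exact: measurable_set_le.
apply: measurable_set_lt => //.
by apply: (@measurableT_comp _ _ _ _ _ _ (fun x : R => u (Num.max 0 x))) => //; exact: measurable_payoff.
Qed.

(** The survival probability is [1] below [u a], [p] from there up to [u b], and [0] beyond. The
    case [a = b] is included because it describes a process that stops at once. *)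
Lemma two_point_integral (X : Omega -> R) (a b : R) : measurable_fun setT X -> 0 <= a -> a <= b ->
  {ae P, forall om, X om = a \/ X om = b} ->
  let p := fine (P [set om | X om = b]) in
  (\int[@lebesgue_measure R]_(x in `[0%R, +oo[)
    (w (fine (P [set om | 0 <= X om /\ x < u (X om)])))%:E =
  ((1 - w p) * u a + w p * u b)%:E)%E.
Proof.
move=> mX a0 ab Xab p; have b0 := le_trans a0 ab.
have [[w0 w1] w01 _ _] := hw.
have mb : measurable [set om | X om = b].
  by rewrite -[X in measurable X]setTI; exact: (mX measurableT _ (measurable_set1 b)).
have /andP[wp0 wp1] : 0 <= w p <= 1 by apply: w01; exact: probability_itv.
have ua0 := payoff_ge0 hu a0; have ub0 := payoff_ge0 hu b0; have uab := payoff_le hu a0 ab.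
have mJ r : measurable (`[0, r[%classic : set (measurableTypeR R)) by exact: measurable_itv.
have mI : measurable (`[0, +oo[%classic : set (measurableTypeR R)) by exact: measurable_itv.
transitivity (\int[@lebesgue_measure R]_(x in `[0%R, +oo[)
   ((1 - w p)%:E * (\1_(`[0, u a[%classic : set (measurableTypeR R)) x : R)%:E +
    (w p)%:E * (\1_(`[0, u b[%classic : set (measurableTypeR R)) x : R)%:E))%E; last first.
  have mind r : measurable_fun (`[0%R, +oo[%classic : set (measurableTypeR R)) (fun x : measurableTypeR R => (\1_(`[0, r[%classic : set (measurableTypeR R)) x : R)%:E).
    by apply/measurable_EFinP; exact: measurable_indic.
  rewrite ge0_integralD//; last 4 first.
  - by move=> x _; rewrite -EFinM lee_fin mulr_ge0 ?subr_ge0// indicE.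
  - exact: measurable_funeM.
  - by move=> x _; rewrite -EFinM lee_fin mulr_ge0// indicE.
  - exact: measurable_funeM.
  rewrite !ge0_integralZl_EFin ?subr_ge0//; try by move=> x _; rewrite lee_fin indicE.
  have sub r : `[0, r[%classic `<=` (`[0, +oo[%classic : set (measurableTypeR R)).
    by move=> x /=; rewrite !in_itv/= => /andP[->].
  by rewrite !integral_itv_indic// -!EFinM -EFinD.
apply: eq_integral => x; rewrite inE /= in_itv/= andbT => x0; rewrite -!EFinM -EFinD; congr (_%:E).
have mE := measurable_payoff_event x mX.
have indE r : \1_(`[0, r[%classic : set (measurableTypeR R)) x = (x < r)%R%:R :> R.
  by rewrite indicE mem_setE /= in_itv/= x0.
rewrite !indE; have [xa|ax] := ltP x (u a).
  rewrite (lt_le_trans xa uab) !mulr1 subrK (@ae_eq_probability _ setT)//; last first.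
    apply: filterS Xab => om [Xom|Xom]; rewrite /= Xom; split => // _; split => //.
    exact: lt_le_trans xa uab.
  by rewrite probability_setT.
rewrite mulr0 add0r; have [xb|bx] := ltP x (u b).
  rewrite mulr1; congr w; apply: ae_eq_probability => //.
  apply: filterS Xab => om [Xom|Xom]; rewrite /= Xom; split => //.
    by case=> _; rewrite ltNge ax.
  by move=> E; move: xb; rewrite -E ltNge ax.
rewrite mulr0 (@ae_eq_probability _ set0)//; first by rewrite measure0.
by apply: filterS Xab => om [Xom|Xom]; rewrite /= Xom; split => // -[_]; rewrite ltNge ?ax ?bx.
Qed.

Variables (F : R -> set (set Omega)) (B S : R -> Omega -> R) (c s : R).
Hypothesis hF : filtration F.
Hypothesis hB : brownian_motion P F B.
Hypothesis hS : solves_sde P F B (fun x => c * x) s S.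
Hypotheses (s0 : 0 < s) (c0 : c != 0).

Let aS : adapted F S. Proof. by case: hS. Qed.
Let cS : continuous_paths S. Proof. by case: hS. Qed.

Lemma J_exit_time (a b : R) : admissible s (a, b) ->
  finite_stopping_times P F (exit_time S a b) /\
  J P u w S (exit_time S a b) = (two_point_value u w s (a, b))%:E.
Proof.
move=> [/= a0 a_s sb]; have st := exit_time_stopping hF aS cS a b.
have mtau := stopping_time_emeasurable hF st.
have mV := stopped_value_measurable hF hS st.
have mfin : measurable [set om | (exit_time S a b om < +oo)%E].
  by rewrite -[X in measurable X]setTI; exact: emeasurable_fun_infty_o.
have finP : {ae P, forall om, (exit_time S a b om < +oo)%E} ->
    finite_stopping_times P F (exit_time S a b).
  move=> H; split => //; rewrite -(fineK (fin_num_measure P _ mfin)).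
  rewrite (@ae_eq_probability _ setT)//; first by rewrite probability_setT.
  by apply: filterS H => om.
have [[w0 w1] _ _ _] := hw.
have [/andP[a_s' sb']|deg] := boolP (a < s < b).
  split; first exact: (finP (exit_time_finite hF hB hS s0 a0 a_s' sb' c0)).
  rewrite /J (two_point_integral mV (ltW a0) (le_trans a_s sb) (exit_value hF hB hS s0 a0 a_s' sb' c0)).
  rewrite (exit_value_probability hF hB hS s0 a0 a_s' sb' c0) /two_point_value.
  by rewrite lt_eqF// (lt_trans a_s').
(* Here [a = b] or [s] is an endpoint, so the exit time is almost surely [0] and the payoff is
   [u s]. The two-point value agrees: the weight of [b] is [w 0 = 0] when [s = a] and [w 1 = 1] when
   [s = b]. *)
have tau0 : {ae P, forall om, exit_time S a b om = 0%E}.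
  apply: filterS (sde_initial hF hS) => om S0; rewrite /exit_time; case: ifP => // ab.
  apply/le_anti/andP; split.
    by apply: ereal_inf_lbound; exists 0 => //=; rewrite S0 lexx; split => //; exact/negP.
  by apply: le_ereal_inf_tmp => _ [r [r0 _] <-]; rewrite lee_fin.
split; first by apply: finP; apply: filterS tau0 => om ->; rewrite ltry.
have Vs : {ae P, forall om, stopped_value S (exit_time S a b) om = s \/ stopped_value S (exit_time S a b) om = s}.
  apply: filterS2 tau0 (sde_initial hF hS) => om t0 S0; left.
  by rewrite /stopped_value t0.
rewrite /J (two_point_integral mV (ltW s0) (lexx s) Vs); congr (_%:E).
rewrite -mulrDl subrK mul1r /two_point_value; case: eqP => // /eqP ab.
have {}ab : a < b by rewrite lt_neqAle ab (le_trans a_s).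
move: deg; rewrite negb_and -!leNgt => /orP[sa|bs].
  have -> : s = a by apply/le_anti; rewrite sa a_s.
  by rewrite subrr mul0r w0 subr0 mul1r mul0r addr0.
have -> : s = b by apply/le_anti; rewrite sb bs.
by rewrite divff ?w1 ?subr_eq0 ?gt_eqF// subrr mul0r add0r mul1r.
Qed.

Hypothesis hconv : convex_function (`[0, 1]%classic : set R) w.

Lemma J_le (V : R) tau : (forall ab, admissible s ab -> two_point_value u w s ab <= V) ->
  finite_stopping_times P F tau -> (J P u w S tau <= V%:E)%E.
Proof.
move=> twoV ftau; have [st _] := ftau.
have mV := stopped_value_measurable hF hS st; set Z := stopped_value S tau in mV.
pose X om := Num.max 0 (Z om).
have mX : measurable_fun setT X by exact: measurable_maxr.
have X0 om : 0 <= X om by rewrite le_max lexx.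
have iX : (\int[P]_om (X om)%:E <= s%:E)%E by exact: stopped_value_mean_le hF hB hS s0 _ ftau.
have iX0 : (0 <= \int[P]_om (X om)%:E)%E by apply: integral_ge0 => om _; rewrite lee_fin.
have fX : (\int[P]_om (X om)%:E)%E \is a fin_num by rewrite ge0_fin_numE// (le_lt_trans iX) ?ltry.
pose e := s - fine (\int[P]_om (X om)%:E)%E.
have e0 : 0 <= e by rewrite subr_ge0 -lee_fin fineK.
pose Y om := X om + e.
have mY : measurable_fun setT Y by exact: measurable_funD.
have Y0 om : 0 <= Y om by rewrite addr_ge0.
have meanY : (\int[P]_om (Y om)%:E = s%:E)%E.
  under eq_integral do rewrite EFinD.
  rewrite ge0_integralD//; last 2 first.
  - by move=> om _; rewrite lee_fin.
  - exact/measurable_EFinP.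
  by rewrite integral_cst//= probability_setT mule1 -(fineK fX) -EFinD /e addrC subrK.
apply: le_trans (distorted_payoff_le hu hw s0 hconv twoV mY Y0 meanY).
have mI : measurable (`[0, +oo[%classic : set (measurableTypeR R)) by exact: measurable_itv.
have w0 (A : set Omega) : measurable A -> (0 <= (w (fine (P A)))%:E)%E.
  by move=> mA; have [_ H _ _] := hw; rewrite lee_fin; have /andP[] := H _ (probability_itv P mA).
have mE x := measurable_payoff_event x mV.
have mE' x : measurable [set om | x < u (Y om)].
  have := measurable_payoff_event x mY; congr (measurable _).
  by apply/seteqP; split => om /= [].
apply: ge0_le_integral => //.
- by move=> x _; exact: w0.
- apply: measurable_funTS; apply: (measurable_survival P hw mE) => x y xy om /= [Z0 yZ].
  by split => //; exact: le_lt_trans yZ.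
- apply: measurable_funTS; apply: (measurable_survival P hw mE') => x y xy om /=.
  exact: le_lt_trans.
move=> x _; rewrite lee_fin.
have /andP[p0 _] := probability_itv P (mE x); have /andP[_ p1] := probability_itv P (mE' x).
apply: distortion_le => //; apply: fine_le; rewrite ?fin_num_measure//.
apply: le_measure; rewrite ?inE// => om /= [Z0 xZ]; apply: lt_le_trans xZ _.
by apply: payoff_le => //; rewrite /Y /X max_r// lerDl.
Qed.

End optimal_stopping.

Theorem theorem4p2 (R : realType) (d : measure_display)
    (Omega : measurableType d) (P : probability Omega R)
    (F : R -> set (set Omega)) (B S : R -> Omega -> R)
    (sigma beta s : R) (u w : R -> R)
    (hF : filtration F) (hB : brownian_motion P F B)
    (hsigma : 0 < sigma) (hbeta : beta != 0) (hs : 0 < s)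
    (hS : solves_sde P F B (fun x => beta * sigma * x) s S)
    (hu : payoff_function u) (hw : distortion_function w)
    (hconv : convex_function (`[0, 1]%classic : set R) w) :
  ereal_sup [set J P u w S tau | tau in finite_stopping_times P F]
    = ereal_sup [set (two_point_value u w s ab)%:E | ab in admissible s]
  /\
  (forall a b : R, admissible s (a, b) ->
    (forall ab, admissible s ab ->
      two_point_value u w s ab <= two_point_value u w s (a, b)) ->
    finite_stopping_times P F (exit_time S a b) /\
    (forall tau, finite_stopping_times P F tau ->
      (J P u w S tau <= J P u w S (exit_time S a b))%E)).
Proof.
have c0 : beta * sigma != 0 by rewrite mulf_neq0// gt_eqF.
have exit a b := J_exit_time hu hw hF hB hS hs c0 (a := a) (b := b).
split; last first.
  move=> a b adm opt; have [fin ->] := exit a b adm.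
  by split => // tau; exact: (J_le hu hw hF hB hS hs hconv opt).
apply/le_anti/andP; split; apply: ge_ereal_sup.
  move=> _ [tau ftau <-]; set T := ereal_sup _.
  have T_ub ab : admissible s ab -> ((two_point_value u w s ab)%:E <= T)%E.
    by move=> adm; apply: ereal_sup_ubound; exists ab.
  (* The bound [J_le] takes a real [V]: an infinite supremum leaves nothing to prove, and the pair
     [(s, s)] excludes the value minus infinity. *)
  have [TE|T_lt] := eqVneq T +oo%E; first by rewrite TE leey.
  have adm : admissible s (s, s) by split.
  have Tfin : T \is a fin_num.
    rewrite fin_numE T_lt andbT; apply/eqP => TE; have := T_ub _ adm.
    by rewrite TE leeNy_eq.
  rewrite -(fineK Tfin); apply: (J_le hu hw hF hB hS hs hconv) => // ab /T_ub.
  by rewrite -lee_fin fineK.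
move=> _ [[a b] adm <-]; have [fin <-] := exit a b adm.
by apply: ereal_sup_ubound; exists (exit_time S a b).
Qed.
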